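(* The direct limit $$\widetilde{B}_{\mathcal{L}_1(\mathfrak{sl}_2)}=\varinjlim\ \widetilde{B}_{\mathcal{L}_1(\mathfrak{sl}_2),m}$$ (taken over the inclusions $\widetilde{B}_{\mathcal{L}_1(\mathfrak{sl}_2),m}\subset\widetilde{B}_{\mathcal{L}_1(\mathfrak{sl}_2),m-1}$, $m\in\mathbb{Z}$, i.e. the union of this nested family) forms a topological basis of $\mathcal{L}_1(\mathfrak{sl}_2)$.
   Context: Let $\varepsilon_1,\varepsilon_2$ be the basis dual to the matrix units $e_{11},e_{22}$, with form $(\varepsilon_j,\varepsilon_k)=\delta_{jk}$; $\alpha=\varepsilon_1-\varepsilon_2$, $Q=\mathbb{Z}\alpha$, $\lambda_0=0$, $\lambda_1=\alpha/2$. Let $\widehat{\mathfrak{s}}$ be the Lie algebra generated by central $C$ and $a_j(r)$ ($j=1,2$, $r\in\mathbb{Z}\setminus\{0\}$) with $[a_j(r),a_k(s)]=r\delta_{jk}\delta_{r+s,0}C$, and $\widehat{\mathfrak{s}}^-$ the subalgebra generated by $a_j(r)$, $r<0$. For $i=0,1$ let $\mathcal{F}_i=U(\widehat{\mathfrak{s}}^-)[[h]]\otimes\mathbb{C}[Q][[h]]e^{\lambda_i}$ ($h$-adically completed, over $\mathbb{C}[[h]]$), $\boldsymbol{1}=1\otimes1\in\mathcal{F}_0$. On $f\otimes e^\mu$: $C$ acts as $1$; $a_j(r)$ acts by $a_j(r)f\otimes e^\mu$ for $r<0$ and by $[a_j(r),f]\otimes e^\mu$ for $r>0$; $\partial_{\varepsilon_j}(f\otimes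 e^\mu)=(\varepsilon_j,\mu)f\otimes e^\mu$ ($\partial_\beta$ linear in $\beta$); $e^{\beta}(f\otimes e^\mu)=f\otimes e^{\beta+\mu}$. Put $$E^-(u)=\exp\Big(\sum_{r>0}\Big(-\frac{a_1(-r)}{r}\big(u-\tfrac34h\big)^r+\frac{a_2(-r)}{r}\big(u+\tfrac h4\big)^r\Big)\Big),\quad E^+(u)=\exp\Big(\sum_{r>0}\frac{a_1(r)-a_2(r)}{r}\big(u+\tfrac h4\big)^{-r}\Big),$$ $$X_\alpha(u)=\sum_{r\in\mathbb{Z}}x(r)u^{-r-1}=E^-(0)^{-1}E^-(u)E^+(u)\,e^{\alpha}\,u^{\partial_{\alpha/2}}(u+h)^{\partial_{\alpha/2}},$$ $$\widetilde{X}(u)=\sum_{r\in\mathbb{Z}}\widetilde{x}(r)u^{-r-1}=X_\alpha(u)\left(1+h/u\right)^{-\partial_{\alpha/2}}.$$ Expressions such as $(u+ah)^p$ are expanded in nonnegative powers of $h$. Let $B_{W_0}$ (resp. $\widetilde{B}_{W_0}$) be the set of all $x(r_n)\cdots x(r_1)\boldsymbol{1}$ (resp. $\widetilde{x}(r_n)\cdots\widetilde{x}(r_1)\boldsymbol{1}$) in $\mathcal{F}_0$ with $n\geq0$, $r_1\leq-1$ and $r_{j+1}\leq r_j-2$ for $j=1,\ldots,n-1$. $\mathcal{L}_0(\mathfrak{sl}_2)\subset\mathcal{F}_0$ is the $h$-adically completed $\mathbb{C}[[h]]$-span of $\{e^{k\alpha}b: k\in\mathbb{Z},\,b\in B_{W_0}\}$,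 and $\mathcal{L}_1(\mathfrak{sl}_2)=\{e^{\lambda_1}v: v\in\mathcal{L}_0(\mathfrak{sl}_2)\}\subset\mathcal{F}_1$. For $m\in\mathbb{Z}$ let $\widetilde{B}_{\mathcal{L}_1(\mathfrak{sl}_2),m}=\{e^{\lambda_1+m\alpha}b: b\in\widetilde{B}_{W_0}\}$. One has $\widetilde{B}_{\mathcal{L}_1(\mathfrak{sl}_2),m}\subset\widetilde{B}_{\mathcal{L}_1(\mathfrak{sl}_2),m-1}$ for all $m$, since $e^{m\alpha}\widetilde{x}(r_n)\cdots\widetilde{x}(r_1)\boldsymbol{1}=e^{(m-1)\alpha}\widetilde{x}(r_n-2)\cdots\widetilde{x}(r_1-2)\widetilde{x}(-1)\boldsymbol{1}$. A topological basis of an $h$-adically complete $\mathbb{C}[[h]]$-module is a $\mathbb{C}[[h]]$-linearly independent subset whose $\mathbb{C}[[h]]$-span is $h$-adically dense. *)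

(* Defs.v *)
From HB Require Import structures.
From mathcomp Require Import all_boot all_order all_algebra finmap.
From mathcomp Require Import monalg.
From mathcomp Require Import mathcomp_extra boolp classical_sets functions.
From mathcomp Require Import cardinality fsbigop reals.
From mathcomp Require Import complex.

Set Implicit Arguments.
Unset Strict Implicit.
Unset Printing Implicit Defensive.

Import Order.TTheory GRing.Theory Num.Theory.

Local Open Scope classical_set_scope.
Local Open Scope ring_scope.

(* Weights: all the weights that occur lie in the lattice Z alpha/2, and the
   integer w stands for w alpha/2. Since (alpha, alpha) = 2, the operator
   d_{alpha/2} acts on e^{w alpha/2} by w/2 and d_alpha acts by w. *)
Definition weight := int.
Definition alpha : weight := 2.
Definition lambda1 : weight := 1.

(* The generator a_j(-n-1) of s^- is indexed by (j, n), with j : 'I_2 counted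
   from 0. The brackets of s^- vanish (r + s = 0 is impossible for r, s < 0),
   so U(s^-) is the polynomial algebra in these generators, and its basis
   consists of the commutative monomials. *)
Definition mode := ('I_2 * nat)%type.

(* A basis vector (m, w) is the element m (x) e^{w alpha/2}. *)
Definition fkey := ({cmonom mode} * weight)%type.

Section Fock.
Variable K : numFieldType.

(* V = U(s^-) (x) K[Z alpha/2]. *)
Definition V := {malg K[fkey]}.

(* F = V[[h]]: the vector v is the series \sum_n (v n) h^n. It is the direct sum
   of F_0 (even weights) and F_1 (odd weights). *)
Definition F := nat -> V.

(* Power series in h with coefficients in K, as coefficient sequences. *)
Definition Kh := nat -> K.

Definition linext (f : fkey -> V) (v : V) : V :=
  \sum_(k <- msupp v) v@_k *: f k.

(* The action of a_j(r). For r > 0 it is the derivation f |-> [a_j(r), f], which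
   sends a_j(-r) to r and the other generators to 0. The value at r = 0 is
   a dummy. *)
Definition a (j : 'I_2) (r : int) : V -> V :=
  match r with
  | Negz n => linext (fun k => << (mmul k.1 (ucm (j, n)), k.2) >>)
  | Posz 0 => fun=> 0
  | Posz n.+1 => linext (fun k =>
      (n.+1 * k.1 (j, n))%:R *: << (divcm k.1 (ucm (j, n)), k.2) >>)
  end.

Definition expw (b : weight) : V -> V :=
  linext (fun k => << (k.1, k.2 + b) >>).

(* Acts on e^{w alpha/2} by the scalar f w. *)
Definition diagw (f : weight -> K) : V -> V :=
  linext (fun k => f k.2 *: << k >>).

(* Generalized binomial coefficient. *)
Definition gbin (x : K) (n : nat) : K :=
  (\prod_(i < n) (x - i%:R)) / n`!%:R.

(* Coefficient of u^i h^q in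
   (u + c h)^p = \sum_(q >= 0) gbin p q * c^q * h^q * u^(p - q). *)
Definition upow (c : K) (p : int) (i : int) (q : nat) : K :=
  if i == p - q%:Z then gbin p%:~R q * c ^+ q else 0.

(* Operator-valued formal series in u, u^-1 and h: S p q is the coefficient of
   u^p h^q. Infinite sums of coefficients are sums over the finite support of
   the summands once they are applied to a vector; in all the series below these
   supports are finite. *)
Definition series := int -> nat -> V -> V.

Definition sone : series :=
  fun p q v => if (p == 0) && (q == 0%N) then v else 0.

Definition ssub (S T : series) : series := fun p q v => S p q v - T p q v.

Definition smul (S T : series) : series := fun p q v =>
  \sum_(j < q.+1) \sum_(i \in [set: int]) S i j (T (p - i) (q - j)%N v).

Definition sexpn (S : series) (n : nat) : series := iter n (smul S) sone.

Definition sexp (S : series) : series := fun p q v =>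
  \sum_(n \in [set: nat]) (n`!%:R)^-1 *: sexpn S n p q v.

(* The inverse of a series congruent to 1 modulo h: the Neumann series
   \sum_n (1 - S)^n. *)
Definition sinv (S : series) : series := fun p q v =>
  \sum_(n \in [set: nat]) sexpn (ssub sone S) n p q v.

(* Specialization at u = 0 of a series without negative powers of u. *)
Definition at0 (S : series) : series :=
  fun p q v => if p == 0 then S 0 q v else 0.

Definition sconst (f : V -> V) : series :=
  fun p q v => if (p == 0) && (q == 0%N) then f v else 0.

Local Notation a1 := (a ord0).
Local Notation a2 := (a ord_max).

Definition Eminus : series := sexp (fun p q v =>
  \sum_(r \in [set r : nat | (0 < r)%N])
    (- (upow (- (3 / 4)) r%:Z p q / r%:R) *: a1 (- r%:Z) v
     + (upow (1 / 4) r%:Z p q / r%:R) *: a2 (- r%:Z) v)).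

Definition Eplus : series := sexp (fun p q v =>
  \sum_(r \in [set r : nat | (0 < r)%N])
    (upow (1 / 4) (- r%:Z) p q / r%:R) *: (a1 r%:Z v - a2 r%:Z v)).

(* u^{d_alpha} *)
Definition u_dalpha : series := fun p q =>
  if q == 0%N then diagw (fun w => (w == p)%:R) else fun=> 0.

(* (1 + h/u)^{e d_{alpha/2}} *)
Definition one_hu_dhalf (e : K) : series := fun p q =>
  if p == - q%:Z then diagw (fun w => gbin (e * (w%:~R / 2)) q) else fun=> 0.

(* The last two factors u^{d_{alpha/2}} (u + h)^{d_{alpha/2}} of X_alpha(u) are
   written as u^{d_alpha} (1 + h/u)^{d_{alpha/2}}, which has integral powers of
   u on F_1 as well. *)
Definition Xalpha : series :=
  smul (sinv (at0 Eminus)) (smul Eminus (smul Eplus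
    (smul (sconst (expw alpha)) (smul u_dalpha (one_hu_dhalf 1))))).

Definition Xtilde : series := smul Xalpha (one_hu_dhalf (- 1)).

(* The coefficient of u^{-r-1}, as an operator on F. *)
Definition modeop (S : series) (r : int) (v : F) : F := fun n =>
  \sum_(q < n.+1) S (- r - 1) q (v (n - q)%N).

Definition xmode := modeop Xalpha.
Definition xtilde_mode := modeop Xtilde.

Definition vac : F := fun n => if n == 0%N then << (onecm _, 0) >> else 0.

Definition expF (b : weight) (v : F) : F := fun n => expw b (v n).

(* Sequences [:: r_1; ...; r_n]. *)
Definition admissible (rs : seq int) : bool :=
  (if rs is r1 :: _ then r1 <= - 1 else true)
  && sorted (fun r r' => r' <= r - 2) rs.

(* y(r_n) ... y(r_1) 1 *)
Definition monom (y : int -> F -> F) (rs : seq int) : F :=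
  foldl (fun v r => y r v) vac rs.

Definition BW0 : set F := [set monom xmode rs | rs in [set rs | admissible rs]].
Definition BtildeW0 : set F :=
  [set monom xtilde_mode rs | rs in [set rs | admissible rs]].

Definition scaleh (c : Kh) (v : F) : F := fun n =>
  \sum_(i < n.+1) c i *: v (n - i)%N.

(* Multiplication by h^N. *)
Definition hshift (N : nat) (v : F) : F := fun n =>
  if (n < N)%N then 0 else v (n - N)%N.

Definition hspan (B : set F) : set F :=
  [set v | exists n (c : 'I_n -> Kh) (b : 'I_n -> F),
    (forall i, B (b i)) /\ v = \sum_(i < n) scaleh (c i) (b i)].

(* The h-adic completion of a submodule M, realized in F as the set of the sums
   of the series \sum_k h^k (m k) with m k in M. *)
Definition hcomplete (M : set F) : set F :=
  [set v | exists m : nat -> F, (forall k, M (m k)) /\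
    v = fun n => \sum_(k < n.+1) m k (n - k)%N].

Definition hfree (B : set F) : Prop :=
  forall n (c : 'I_n -> Kh) (b : 'I_n -> F),
    injective b -> (forall i, B (b i)) ->
    \sum_(i < n) scaleh (c i) (b i) = 0 -> forall i, c i = 0.

(* Density of D in L for the h-adic topology of L, whose neighbourhoods of 0 are
   the h^N L. *)
Definition hdense (D L : set F) : Prop :=
  forall v, L v -> forall N : nat,
    exists s l : F, [/\ D s, L l & v = s + hshift N l].

Definition topological_basis (B L : set F) : Prop :=
  [/\ B `<=` L, hfree B & hdense (hspan B) L].

Definition L0 : set F :=
  hcomplete (hspan
    [set v | exists (k : int) (b : F), BW0 b /\ v = expF (k * alpha) b]).

Definition L1 : set F := [set expF lambda1 v | v in L0].

Definition BtildeL1 (m : int) : set F :=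
  [set expF (lambda1 + m * alpha) b | b in BtildeW0].

(* The direct limit over the inclusions BtildeL1 m `<=` BtildeL1 (m - 1). *)
Definition BtildeL1_lim : set F := \bigcup_(m in [set: int]) BtildeL1 m.

End Fock.

(* Main.v *)
From HB Require Import structures.
Require Import Defs.
From mathcomp Require Import all_boot all_order all_algebra finmap.
From mathcomp Require Import monalg.
From mathcomp Require Import mathcomp_extra boolp classical_sets functions.
From mathcomp Require Import cardinality fsbigop reals complex.
From mathcomp Require Import ring lra zify.

(** The statement is reduced to one about vectors over the ground field. Write X~ for
    the series with modes x~(r), and let L be the space of all the series in h whose
    coefficients have even weights and which are annihilated by the operators
      D_n = a_1(n + 1) + sum_q C(n+1, q) (-h)^q a_2(n + 1 - q)   (q <= n).
    The shifts of h in E^- are such that D_n commutes with E^-(0)^{-1} E^-(u): its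
    commutator with the exponent of E^-(u) is a constant, which also comes from
    E^-(0) ([D_Hf]). It commutes with E^+(u) and kills the vacuum, so that L contains
    all the vectors produced by x(r), x~(r) and e^{k alpha} ([neutral_x],
    [neutral_xt]). Moreover h v in L implies v in L. Hence a subset of L whose
    reductions modulo h span those of L has dense span ([dense_span]), and every
    element of L is the sum of a series of elements of that span, weighted by powers
    of h ([sub_complete_span]). Linear independence also follows from that of the
    reductions modulo h, one order in h after the other ([ghfree_lim]). The case of
    L_1 is the image of that of L_0 by e^{alpha/2}.

    Modulo h, the modes of X and X~ agree, and an element of L reduces to a vector
    annihilated by all the a_1(n) + a_2(n). Write the reduction of E^-(0)^{-1} E^-(u)
    as the generating series of operators H(i), for i >= 0; they commute with each
    other. An admissible sequence r_1, ..., r_n is encoded by the weakly decreasing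
    sequence of nonnegative integers with entries - r_j - 1 - 2 (j - 1), in the order
    j = n, ..., 1 ([modes_of_adm]). The
    commutation E^+(u) H(v) = (1 - v/u)^2 H(v) E^+(u) ([G_H]) shows that the vector
    with code la is H(la_1) ... H(la_n) 1, in weight 2n, plus a combination of products
    H(nu_1) ... H(nu_n) 1 where nu strictly dominates la, so that nu has a larger sum of
    squares ([vec_hh]). This relation is triangular, and it remains to consider the
    products of H.

    They are independent: H(i) is a_2(-i)/i up to terms that involve a_1 or have a
    higher degree, so that the lowest monomials in the a_2(-i) tell the products apart
    ([hh_free]). They span the common kernel of the a_1(n) + a_2(n): such a vector is
    determined by its coordinates on the monomials without a_1 ([flat_eq0]), and the
    products of the operators a_2(-r) - a_1(-r), which are combinations of products of
    H, realize all these coordinates ([flat_dual]).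

    The nested family is handled through e^alpha x~(r) = x~(r - 2) e^alpha and
    x~(-1) 1 = e^alpha 1, which let e^alpha append a zero to the code ([ewF_vec]). *)

Set Implicit Arguments.
Unset Strict Implicit.
Unset Printing Implicit Defensive.
Import Order.TTheory GRing.Theory Num.Theory.
Local Open Scope ring_scope.

(** * Power series over a ring *)

Section SingleTerm.
Variables (M : nmodType) (n : nat) (F : nat -> M).
Lemma big_ord_last : (forall i, (i < n)%N -> F i = 0) -> \sum_(i < n.+1) F i = F n.
Proof. by move=> F0; rewrite big_ord_recr /= big1 ?add0r // => i _; apply: F0. Qed.
Lemma big_ord_first : (forall i, F i.+1 = 0) -> \sum_(i < n.+1) F i = F 0%N.
Proof. by move=> F0; rewrite big_ord_recl /= big1 ?addr0 // => i _; apply: F0. Qed.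
Lemma big_ord_shift : \sum_(i < n.+1) F i = F 0%N + \sum_(i < n) F i.+1.
Proof. by rewrite big_ord_recl. Qed.
End SingleTerm.

Lemma exchange_triangle (M : nmodType) n (G : nat -> nat -> M) :
  \sum_(j < n.+1) \sum_(l < (n - j).+1) G j l =
  \sum_(l < n.+1) \sum_(j < (n - l).+1) G j l.
Proof.
transitivity (\sum_(j < n.+1) \sum_(l < n.+1 | (l <= n - j)%N) G j l).
  by apply: eq_bigr => j _; rewrite (big_ord_narrow_leq (leq_subr _ _)).
rewrite (exchange_big_dep predT) //=; apply: eq_bigr => l _.
transitivity (\sum_(j < n.+1 | (j <= n - l)%N) G j l).
  by apply: eq_bigl => j; have := ltn_ord j; have := ltn_ord l; lia.
by rewrite (big_ord_narrow_leq (leq_subr _ _)).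
Qed.

Lemma sum_triangle (M : nmodType) n (G : nat -> nat -> M) :
  \sum_(l < n.+1) \sum_(m < (n - l).+1) G l m =
  \sum_(t < n.+1) \sum_(l < t.+1) G l (t - l)%N.
Proof.
rewrite [RHS](reindex_inj rev_ord_inj) /=.
under [RHS]eq_bigr => t _ do rewrite subSS.
rewrite [RHS](exchange_triangle n (fun t l => G l (n - t - l)%N)).
apply: eq_bigr => l _; rewrite (reindex_inj rev_ord_inj) /=.
by apply: eq_bigr => m _; rewrite subSS -!subnDA addnC.
Qed.

(** Wrapped in a record because the type of functions from nat to R already
    carries the pointwise operations. *)
Record fps (R : Type) := Fps { fcoef :> nat -> R }.

Lemma fpsP (R : Type) (f g : fps R) : (forall n, f n = g n) -> f = g.
Proof. by case: f g => [f] [g] /= /funext ->. Qed.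

Section FpsRing.
Variable R : pzRingType.
Implicit Types f g : fps R.

HB.instance Definition _ := gen_eqMixin (fps R).
HB.instance Definition _ := gen_choiceMixin (fps R).

Definition fps0 : fps R := Fps (fun=> 0).
Definition fps_opp f : fps R := Fps (fun n => - f n).
Definition fps_add f g : fps R := Fps (fun n => f n + g n).
Definition fps1 : fps R := Fps (fun n => (n == 0%N)%:R).
Definition fps_mul f g : fps R :=
  Fps (fun n => \sum_(i < n.+1) f i * g (n - i)%N).

Fact fps_addA : associative fps_add.
Proof. by move=> f g h; apply: fpsP => n; apply: addrA. Qed.
Fact fps_addC : commutative fps_add.
Proof. by move=> f g; apply: fpsP => n; apply: addrC. Qed.
Fact fps_add0 : left_id fps0 fps_add.
Proof. by move=> f; apply: fpsP => n; apply: add0r. Qed.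
Fact fps_addN : left_inverse fps0 fps_opp fps_add.
Proof. by move=> f; apply: fpsP => n; apply: addNr. Qed.

HB.instance Definition _ :=
  GRing.isZmodule.Build (fps R) fps_addA fps_addC fps_add0 fps_addN.

Lemma fps_mul_rev f g n : fps_mul f g n = \sum_(i < n.+1) f (n - i)%N * g i.
Proof.
rewrite /= (reindex_inj rev_ord_inj) /=; apply: eq_bigr => i _.
by rewrite subSS subKn // -ltnS ltn_ord.
Qed.

Fact fps_mulA : associative fps_mul.
Proof.
move=> f g h; apply: fpsP => n; rewrite [RHS]fps_mul_rev [LHS]/fcoef /=.
pose c j k := f j * (g (n - j - k)%N * h k).
transitivity (\sum_(j < n.+1) \sum_(k < n.+1 | (k <= n - j)%N) c j k).
  apply: eq_bigr => j _; rewrite -[\sum_(_ < _) _]/(fps_mul g h _) fps_mul_rev.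
  by rewrite mulr_sumr (big_ord_narrow_leq (leq_subr _ _)).
rewrite (exchange_big_dep predT) //=; apply: eq_bigr => k _.
transitivity (\sum_(j < n.+1 | (j <= n - k)%N) c j k).
  by apply: eq_bigl => j; have := ltn_ord j; have := ltn_ord k; lia.
rewrite (big_ord_narrow_leq (leq_subr _ _)) mulr_suml.
by apply: eq_bigr => j _; rewrite /c -!subnDA addnC mulrA.
Qed.
Fact fps_mul1l : left_id fps1 fps_mul.
Proof.
move=> f; apply: fpsP => n; rewrite [LHS]big_ord_recl /= subn0 mul1r.
by rewrite big1 ?addr0 // => i _; rewrite mul0r.
Qed.
Fact fps_mul1r : right_id fps1 fps_mul.
Proof.
move=> f; apply: fpsP => n; rewrite [LHS]big_ord_recr /= subnn mulr1.
by rewrite big1 ?add0r // => i _; rewrite /fps1 subn_eq0 leqNgt ltn_ord mulr0.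
Qed.
Fact fps_mulDl : left_distributive fps_mul fps_add.
Proof.
move=> f g h; apply: fpsP => n; rewrite /= -big_split.
by apply: eq_bigr => i _; apply: mulrDl.
Qed.
Fact fps_mulDr : right_distributive fps_mul fps_add.
Proof.
move=> f g h; apply: fpsP => n; rewrite /= -big_split.
by apply: eq_bigr => i _; apply: mulrDr.
Qed.

HB.instance Definition _ := GRing.Zmodule_isPzRing.Build (fps R)
  fps_mulA fps_mul1l fps_mul1r fps_mulDl fps_mulDr.

Lemma fpsM f g n : (f * g) n = \sum_(i < n.+1) f i * g (n - i)%N.
Proof. by []. Qed.
Lemma fpsD f g n : (f + g) n = f n + g n. Proof. by []. Qed.
Lemma fpsN f n : (- f) n = - f n. Proof. by []. Qed.
Lemma fpsB f g n : (f - g) n = f n - g n. Proof. by []. Qed.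
Lemma fpsMn f k n : (f *+ k) n = f n *+ k.
Proof. by elim: k => // k IHk; rewrite !mulrS fpsD IHk. Qed.
Lemma fps_sum (I : Type) (r : seq I) (P : pred I) (F : I -> fps R) n :
  (\sum_(i <- r | P i) F i) n = \sum_(i <- r | P i) F i n.
Proof. by elim/big_rec2: _ => // i x y _ <-. Qed.

Definition fpsC (x : R) : fps R := Fps (fun n => if n == 0%N then x else 0).

Lemma fpsCM x f n : (fpsC x * f) n = x * f n.
Proof.
rewrite fpsM big_ord_recl /= subn0 big1 ?addr0 // => i _.
by rewrite /fpsC /= mul0r.
Qed.
Lemma fpsMC x f n : (f * fpsC x) n = f n * x.
Proof.
rewrite fpsM big_ord_recr /= subnn /fpsC /= big1 ?add0r // => i _.
by rewrite subn_eq0 leqNgt ltn_ord mulr0.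
Qed.
End FpsRing.

(** * The ring of linear endomorphisms *)

(** Bundled linear maps: composition makes them a ring, over which power series
    can be formed. *)
Record endo (K : comPzRingType) (V : lmodType K) :=
  Endo { efun :> V -> V; endo_linear : linear efun }.

Section Endo.
Variables (K : comPzRingType) (V : lmodType K).
Local Notation E := (endo V).
Implicit Types (f g : E) (v : V) (c : K).

HB.instance Definition _ f :=
  GRing.isLinear.Build K V V *:%R (efun f) (endo_linear f).

Lemma endoP f g : (forall v, f v = g v) -> f = g.
Proof.
case: f g => [f lf] [g lg] /= /funext eq_fg; rewrite -eq_fg in lg *.
by congr Endo; apply: Prop_irrelevance.
Qed.

HB.instance Definition _ := gen_eqMixin E.
HB.instance Definition _ := gen_choiceMixin E.

Fact endo0_linear : linear (fun _ : V => 0 : V).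
Proof. by move=> c u v; rewrite scaler0 addr0. Qed.
Fact endo_opp_linear f : linear (fun v => - f v).
Proof. by move=> c u v; rewrite linearP opprD scalerN. Qed.
Fact endo_add_linear f g : linear (fun v => f v + g v).
Proof. by move=> c u v; rewrite !linearP scalerDr addrACA. Qed.
Fact endo1_linear : linear (fun v : V => v).
Proof. by []. Qed.
Fact endo_mul_linear f g : linear (fun v => f (g v)).
Proof. by move=> c u v; rewrite !linearP. Qed.
Fact endo_scale_linear c f : linear (fun v => c *: f v).
Proof. by move=> d u v; rewrite linearP scalerDr !scalerA mulrC. Qed.

Definition endo0 := Endo endo0_linear.
Definition endo_opp f := Endo (endo_opp_linear f).
Definition endo_add f g := Endo (endo_add_linear f g).
Definition endo1 := Endo endo1_linear.
Definition endo_mul f g := Endo (endo_mul_linear f g).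
Definition endo_scale c f := Endo (endo_scale_linear c f).

Fact endo_addA : associative endo_add.
Proof. by move=> f g h; apply: endoP => v; apply: addrA. Qed.
Fact endo_addC : commutative endo_add.
Proof. by move=> f g; apply: endoP => v; apply: addrC. Qed.
Fact endo_add0 : left_id endo0 endo_add.
Proof. by move=> f; apply: endoP => v; apply: add0r. Qed.
Fact endo_addN : left_inverse endo0 endo_opp endo_add.
Proof. by move=> f; apply: endoP => v; apply: addNr. Qed.
HB.instance Definition _ :=
  GRing.isZmodule.Build E endo_addA endo_addC endo_add0 endo_addN.

Fact endo_mulA : associative endo_mul.
Proof. by move=> f g h; apply: endoP. Qed.
Fact endo_mul1l : left_id endo1 endo_mul.
Proof. by move=> f; apply: endoP. Qed.
Fact endo_mul1r : right_id endo1 endo_mul.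
Proof. by move=> f; apply: endoP. Qed.
Fact endo_mulDl : left_distributive endo_mul endo_add.
Proof. by move=> f g h; apply: endoP. Qed.
Fact endo_mulDr : right_distributive endo_mul endo_add.
Proof. by move=> f g h; apply: endoP => v; rewrite /= linearD. Qed.
HB.instance Definition _ := GRing.Zmodule_isPzRing.Build E
  endo_mulA endo_mul1l endo_mul1r endo_mulDl endo_mulDr.

Fact endo_scaleA c d f : endo_scale c (endo_scale d f) = endo_scale (c * d) f.
Proof. by apply: endoP => v; apply: scalerA. Qed.
Fact endo_scale1 : left_id 1 endo_scale.
Proof. by move=> f; apply: endoP => v; apply: scale1r. Qed.
Fact endo_scaleDr : right_distributive endo_scale +%R.
Proof. by move=> c f g; apply: endoP => v; apply: scalerDr. Qed.
Fact endo_scaleDl f : {morph endo_scale^~ f : c d / c + d}.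
Proof. by move=> c d; apply: endoP => v; apply: scalerDl. Qed.
HB.instance Definition _ := GRing.Zmodule_isLmodule.Build K E
  endo_scaleA endo_scale1 endo_scaleDr endo_scaleDl.

Lemma endoZl c f g : (c *: f) * g = c *: (f * g).
Proof. exact: endoP. Qed.
Lemma endoZr c f g : f * (c *: g) = c *: (f * g).
Proof. by apply: endoP => v; rewrite /= linearZ. Qed.

Lemma endoD f g v : (f + g) v = f v + g v. Proof. by []. Qed.
Lemma endoN f v : (- f) v = - f v. Proof. by []. Qed.
Lemma endoB f g v : (f - g) v = f v - g v. Proof. by []. Qed.
Lemma endoM f g v : (f * g) v = f (g v). Proof. by []. Qed.
Lemma endoZ c f v : (c *: f) v = c *: f v. Proof. by []. Qed.
Lemma endo0E v : (0 : E) v = 0. Proof. by []. Qed.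
Lemma endo1E v : (1 : E) v = v. Proof. by []. Qed.
Lemma endoZv f c v : f (c *: v) = c *: f v. Proof. exact: linearZ. Qed.
Lemma endoDv f u v : f (u + v) = f u + f v. Proof. exact: linearD. Qed.
Lemma endoBv f u v : f (u - v) = f u - f v. Proof. exact: linearB. Qed.
Lemma endo0v f : f 0 = 0. Proof. exact: linear0. Qed.
Lemma endo_sumv f (I : Type) (r : seq I) (P : pred I) (F : I -> V) :
  f (\sum_(i <- r | P i) F i) = \sum_(i <- r | P i) f (F i).
Proof. exact: linear_sum. Qed.
Lemma endoMn f n v : (f *+ n) v = f v *+ n.
Proof. by elim: n => // n IHn; rewrite !mulrS endoD IHn. Qed.
Lemma endo_sum (I : Type) (r : seq I) (P : pred I) (F : I -> E) v :
  (\sum_(i <- r | P i) F i) v = \sum_(i <- r | P i) F i v.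
Proof. by elim/big_rec2: _ => // i x y _ <-. Qed.
End Endo.

(** * Operators on a Fock space *)

Local Notation mon := {cmonom mode}.

(** The Fock space only enters through its basis of monomials times e^{w alpha/2},
    its coordinates and linear extension along the basis. *)
Record fock (K : numFieldType) := Fock {
  fsp :> lmodType K;
  bas : mon -> weight -> fsp;
  coef : mon -> weight -> fsp -> K;
  flin : (mon -> weight -> fsp) -> fsp -> fsp;
  coef_linear : forall k w, scalar (coef k w);
  flin_linear : forall f, linear (flin f);
  coefP : forall u v : fsp, (forall k w, coef k w u = coef k w v) -> u = v;
  coef_bas : forall k w k' w',
    coef k' w' (bas k w) = ((k == k') && (w == w'))%:R;
  bas_expand : forall v : fsp, exists (s : seq (mon * weight)) (c : mon * weight -> K),
    v = \sum_(x <- s) c x *: bas x.1 x.2;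
  flinU : forall f k w, flin f (bas k w) = f k w
}.

Section Monomials.
Implicit Types (k : mon) (x : mode).
(** Multiplication and division by a generator are sealed, so that conversion never
    unfolds monomials. *)
Fact kmul_pack : {m : mon -> mode -> mon |
  forall k x, m k x = mulcm k (ucm x)}.
Proof. by eexists. Qed.
Definition kmul := sval kmul_pack.
Fact kdiv_pack : {m : mon -> mode -> mon |
  forall k x, m k x = divcm k (ucm x)}.
Proof. by eexists. Qed.
Definition kdiv := sval kdiv_pack.
Lemma kmul_def k x : kmul k x = mulcm k (ucm x).
Proof. exact: (svalP kmul_pack). Qed.
Lemma kdiv_def k x : kdiv k x = divcm k (ucm x).
Proof. exact: (svalP kdiv_pack). Qed.
Lemma kmulE k x y : kmul k x y = (k y + (x == y))%N.
Proof. by rewrite kmul_def mulcmE ucmE. Qed.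
Lemma kdivE k x y : kdiv k x y = (k y - (x == y))%N.
Proof. by rewrite kdiv_def divcmE ucmE. Qed.
Lemma kP k (l : mon) : (forall x, k x = l x) -> k = l.
Proof. by move=> eq_kl; apply/eqP/cmP. Qed.
Lemma kmulK k x : kdiv (kmul k x) x = k.
Proof. by apply: kP => z; rewrite kdivE kmulE addnK. Qed.
Lemma kdivK k x : (0 < k x)%N -> kmul (kdiv k x) x = k.
Proof.
by move=> kx; apply: kP => z; rewrite kmulE kdivE subnK //; case: eqP => // <-.
Qed.

Definition wdeg (f : mode -> nat) k : nat := \sum_(x <- finsupp k) k x * f x.

Lemma wdegEw f k (d : {fset mode}) : (finsupp k `<=` d)%fset ->
  wdeg f k = (\sum_(x <- d) k x * f x)%N.
Proof.
move=> sub_d; apply: big_fset_incl => // x _ /fsfun_dflt ->.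
by rewrite mul0n.
Qed.

Lemma wdegM f k x : wdeg f (kmul k x) = (wdeg f k + f x)%N.
Proof.
rewrite [LHS](wdegEw _ (d := (finsupp k `|` [fset x])%fset)); last first.
  apply/fsubsetP => y; rewrite in_fsetU in_fset1 -!cmE_neq0 kmulE.
  by case: (x =P y) => [->|_]; rewrite ?eqxx ?orbT // addn0 => ->.
rewrite [in RHS](wdegEw _ (fsubsetUl (finsupp k) [fset x]%fset)).
under eq_bigr => i _ do rewrite kmulE mulnDl.
rewrite big_split /=; congr addn.
rewrite (big_fsetD1 x) ?in_fsetU ?in_fset1 ?eqxx ?orbT //= mul1n.
rewrite big1_fset ?addn0 // => y; rewrite in_fsetD1 eq_sym => /andP[/negPf -> _] _.
by rewrite mul0n.
Qed.

Definition energy := wdeg (fun x => x.2.+1).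
Lemma energyM k x : energy (kmul k x) = (energy k + x.2.+1)%N.
Proof. exact: wdegM. Qed.

End Monomials.

Section Ops.
Variables (K : numFieldType) (W : fock K).
Local Notation E := (endo (fsp W)).
Local Notation bs := (bas W).
Implicit Types (j : 'I_2) (n : nat) (k : mon) (w : weight) (v : W) (x y : mode) (f g : E).

HB.instance Definition _ k w :=
  GRing.isLinear.Build K (fsp W) K *%R (coef k w) (@coef_linear K W k w).

Lemma wcoefZ k w (c : K) v : coef k w (c *: v) = c * coef k w v.
Proof. by rewrite linearZ. Qed.
Lemma wcoefD k w (u v : W) : coef k w (u + v) = coef k w u + coef k w v.
Proof. exact: linearD. Qed.
Lemma wcoefN k w v : coef k w (- v) = - coef k w v.
Proof. exact: linearN. Qed.
Lemma wcoef0 k w : coef k w (0 : W) = 0.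
Proof. exact: linear0. Qed.

Lemma endo_basisP f g :
  (forall k w, f (bs k w) = g (bs k w)) -> f = g.
Proof.
move=> eq_fg; apply: endoP => v; have [s [c ->]] := bas_expand v.
rewrite !linear_sum; apply: eq_bigr => -[k w] _.
by rewrite !linearZ /= eq_fg.
Qed.

(** At x = (j, n), [cr] is a_j(-n-1) and [an] is a_j(n+1); [ew] translates the
    weights and [dg] is scalar on each weight space. They are locked because their
    relations, not their values, carry the argument. *)
Definition elin F : E := Endo (@flin_linear K W F).
Definition cr x : E := locked (elin (fun k w => bs (kmul k x) w)).
Definition an x : E :=
  locked (elin (fun k w => (x.2.+1 * k x)%:R *: bs (kdiv k x) w)).
Definition ew (b : weight) : E :=
  locked (elin (fun k w => bs k (w + b))).
Definition dg (h : weight -> K) : E :=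
  locked (elin (fun k w => h w *: bs k w)).

Lemma crE x : efun (cr x) = flin (fun k w => bs (kmul k x) w).
Proof. by rewrite /cr -lock. Qed.
Lemma anE x : efun (an x) = flin (fun k w => (x.2.+1 * k x)%:R *: bs (kdiv k x) w).
Proof. by rewrite /an -lock. Qed.
Lemma ewE b : efun (ew b) = flin (fun k w => bs k (w + b)).
Proof. by rewrite /ew -lock. Qed.
Lemma dgE h : efun (dg h) = flin (fun k w => h w *: bs k w).
Proof. by rewrite /dg -lock. Qed.

Lemma crU x k w : cr x (bs k w) = bs (kmul k x) w.
Proof. by rewrite crE flinU. Qed.
Lemma anU x k w : an x (bs k w) = (x.2.+1 * k x)%:R *: bs (kdiv k x) w.
Proof. by rewrite anE flinU. Qed.
Lemma ewU b k w : ew b (bs k w) = bs k (w + b).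
Proof. by rewrite ewE flinU. Qed.
Lemma dgU h k w : dg h (bs k w) = h w *: bs k w.
Proof. by rewrite dgE flinU. Qed.

Lemma an_cr x y :
  an x * cr y = cr y * an x + (if x == y then x.2.+1%:R else 0) *: (1 : E).
Proof.
apply: endo_basisP => k w.
rewrite endoD !endoM endoZ endo1E crU !anU endoZv crU kmulE.
case: eqVneq => [->|neq_xy].
  rewrite kmulK addn1 mulnS natrD scalerDl addrC; congr (_ + _).
  by case kx: (k x) => [|m]; [rewrite muln0 !scale0r|rewrite kdivK ?kx].
rewrite addn0 scale0r addr0; congr (_ *: bs _ _).
apply: kP => z; rewrite kdivE !kmulE kdivE.
case: (x =P z) => [eq_xz|_]; last by rewrite !subn0.
by rewrite -eq_xz (negPf neq_xy) !addn0.
Qed.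

Lemma cr_cr x y : cr x * cr y = cr y * cr x.
Proof.
apply: endo_basisP => k w; rewrite !endoM !crU; congr (bs _ _).
by apply: kP => z; rewrite !kmulE addnAC.
Qed.

Lemma an_an x y : an x * an y = an y * an x.
Proof.
case: (eqVneq x y) => [->//|neq_xy].
apply: endo_basisP => k w; rewrite !endoM !anU !endoZv !anU !scalerA.
rewrite !kdivE (negPf neq_xy) eq_sym (negPf neq_xy) !subn0 mulrC.
congr (_ *: bs _ _); by apply: kP => z; rewrite !kdivE -!subnDA addnC.
Qed.

Lemma cr_ew x b : cr x * ew b = ew b * cr x.
Proof. by apply: endo_basisP => k w; rewrite !endoM crU !ewU crU. Qed.
Lemma an_ew x b : an x * ew b = ew b * an x.
Proof.
by apply: endo_basisP => k w; rewrite !endoM anU !endoZv !ewU !anU.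
Qed.
Lemma cr_dg x h : cr x * dg h = dg h * cr x.
Proof.
by apply: endo_basisP => k w; rewrite !endoM crU !dgU endoZv crU.
Qed.
Lemma an_dg x h : an x * dg h = dg h * an x.
Proof.
apply: endo_basisP => k w; rewrite !endoM anU dgU !endoZv dgU anU.
by rewrite !scalerA mulrC.
Qed.
Lemma dg_ew h b : dg h * ew b = ew b * dg (fun w => h (w + b)).
Proof.
by apply: endo_basisP => k w; rewrite !endoM !ewU !dgU endoZv ewU.
Qed.
Lemma ewD b c v : ew b (ew c v) = ew (c + b) v.
Proof.
rewrite -endoM; congr (fun f : E => f v).
by apply: endo_basisP => k w; rewrite endoM !ewU addrA.
Qed.
Lemma ew0 : ew 0 = 1.
Proof. by apply: endo_basisP => k w; rewrite ewU addr0. Qed.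

Lemma coef_basisP f k w (c : K) k' w' :
  (forall k1 w1, coef k w (f (bs k1 w1)) = c * ((k1 == k') && (w1 == w'))%:R) ->
  forall v, coef k w (f v) = c * coef k' w' v.
Proof.
move=> fE v; have [s [d ->]] := bas_expand v.
rewrite endo_sumv !linear_sum /= mulr_sumr; apply: eq_bigr => -[k1 w1] _.
by rewrite endoZv !wcoefZ fE coef_bas mulrCA.
Qed.

Lemma kdiv_eq k k' x : (0 < k' x)%N -> (kdiv k' x == k) = (k' == kmul k x).
Proof.
by move=> k'x; apply/eqP/eqP => [<-|->]; rewrite ?kdivK ?kmulK.
Qed.

Lemma coef_an x v k w :
  coef k w (an x v) = (x.2.+1 * (k x).+1)%:R * coef (kmul k x) w v.
Proof.
apply: coef_basisP => k' w'; rewrite anU wcoefZ coef_bas.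
case: (posnP (k' x)) => [k'x|k'x_gt0].
  rewrite k'x muln0 mul0r; case: eqP => [k'E|_]; last by rewrite mulr0.
  by move: k'x; rewrite k'E kmulE eqxx addn1.
rewrite kdiv_eq //; case: eqP => [->|_]; last by rewrite !mulr0.
by rewrite kmulE eqxx addn1.
Qed.

Lemma coef_cr x v k w :
  coef k w (cr x v) = if (0 < k x)%N then coef (kdiv k x) w v else 0.
Proof.
case: ifP => [kx_gt0|/negbT]; rewrite -?leqNgt ?leqn0.
  rewrite -[RHS]mul1r; apply: coef_basisP => k' w'.
  by rewrite crU coef_bas mul1r eq_sym -kdiv_eq // eq_sym.
move/eqP => kx0; rewrite -[RHS](mul0r (coef k w v)).
apply: coef_basisP => k' w'; rewrite mul0r crU coef_bas.
case: eqP => //= k'E; by move: kx0; rewrite -k'E kmulE eqxx addn1.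
Qed.

(** Annihilation operators lower the energy and every vector has bounded energy:
    this is why E^+(u) acts by finite sums. *)
Definition energy_lt N v := forall k w, (N <= energy k)%N -> coef k w v = 0.
Definition lowers d f :=
  forall N v, energy_lt N v -> energy_lt (N - d) (f v).

Lemma energy_lt0 v : energy_lt 0 v -> v = 0.
Proof. by move=> v0; apply: coefP => k w; rewrite wcoef0 v0. Qed.

Lemma energy_lt_mono M N v : (M <= N)%N -> energy_lt M v -> energy_lt N v.
Proof. by move=> leMN vM k w leN; apply: vM; apply: leq_trans leN. Qed.

Lemma energy_lt_ex v : exists N, energy_lt N v.
Proof.
have [s [c ->]] := bas_expand v.
exists (\max_(x <- s) (energy x.1)).+1 => k w ltk.
rewrite linear_sum /= big_seq big1 // => -[l w'] s_l.
rewrite wcoefZ coef_bas; case: eqP => [eq_lk|_]; last by rewrite mulr0.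
move: ltk; rewrite -eq_lk ltnNge.
by rewrite (leq_bigmax_seq (F := fun x : mon * weight => energy x.1) _ s_l).
Qed.

Lemma lowers_an x : lowers x.2.+1 (an x).
Proof.
move=> N v vN k w; rewrite leq_subLR addnC => leN.
by rewrite coef_an vN ?mulr0 // energyM.
Qed.
Lemma lowersM d e f g : lowers d f -> lowers e g -> lowers (d + e) (f * g).
Proof. by move=> lf lg N v /lg /lf; rewrite -subnDA addnC. Qed.
Lemma lowers0 d : lowers d 0.
Proof. by move=> N v _ k w _; rewrite endo0E wcoef0. Qed.
Lemma lowers1 : lowers 0 1. Proof. by move=> N v; rewrite subn0. Qed.
Lemma lowersD d f g : lowers d f -> lowers d g -> lowers d (f + g).
Proof.
by move=> lf lg N v vN k w le; rewrite endoD wcoefD (lf _ _ vN) ?(lg _ _ vN) ?addr0.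
Qed.
Lemma lowersN d f : lowers d f -> lowers d (- f).
Proof. by move=> lf N v vN k w le; rewrite endoN wcoefN (lf _ _ vN) ?oppr0. Qed.
Lemma lowersZ d c f : lowers d f -> lowers d (c *: f).
Proof. by move=> lf N v vN k w le; rewrite endoZ wcoefZ (lf _ _ vN) ?mulr0. Qed.
Lemma lowers_sum d (I : Type) (r : seq I) (P : pred I) (F : I -> E) :
  (forall i, P i -> lowers d (F i)) -> lowers d (\sum_(i <- r | P i) F i).
Proof. by move=> lF; elim/big_ind: _ => //; [apply: lowers0|apply: lowersD]. Qed.
Lemma lowers_le d e f : (d <= e)%N -> lowers e f -> lowers d f.
Proof.
by move=> le lf N v /lf; apply: energy_lt_mono; rewrite leq_sub2l.
Qed.

Definition pw (w : weight) : E := dg (fun w' => (w' == w)%:R).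

Lemma coef_dg h v k w : coef k w (dg h v) = h w * coef k w v.
Proof.
apply: coef_basisP => k' w'; rewrite dgU wcoefZ coef_bas.
by case: (w' =P w) => [->//|_]; rewrite andbF !mulr0.
Qed.
Lemma coef_pw w v k w' : coef k w' (pw w v) = if w' == w then coef k w' v else 0.
Proof. by rewrite coef_dg; case: eqP; rewrite ?mul1r ?mul0r. Qed.

Lemma dg_wt h w v : pw w v = v -> dg h v = h w *: v.
Proof.
move=> vw; apply: coefP => k w'; rewrite coef_dg wcoefZ -vw coef_pw.
by case: eqP => [->//|_]; rewrite !mulr0.
Qed.
Lemma pw_ew w b v : pw w v = v -> pw (w + b) (ew b v) = ew b v.
Proof.
move=> vw; rewrite -endoM /pw dg_ew endoM -{2}vw; congr (ew b (dg _ v)).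
by apply/funext => w'; rewrite (inj_eq (addIr b)).
Qed.
Lemma pw_comm w v f : f * pw w = pw w * f -> pw w v = v -> pw w (f v) = f v.
Proof. by move=> fw vw; rewrite -endoM -fw endoM vw. Qed.

Lemma coef_ew b v k w : coef k w (ew b v) = coef k (w - b) v.
Proof.
rewrite -[RHS]mul1r; apply: coef_basisP => k' w'; rewrite ewU coef_bas.
by rewrite mul1r -[w' + b == w]subr_eq0 -[w' == _]subr_eq0 opprB addrA.
Qed.
End Ops.

(** * Formal series of operators *)

(** ** Finitely supported sums over the integers *)

Section FiniteSums.
Variables (M : zmodType).
Implicit Types (F : int -> M).

Definition finsum F : M := \sum_(i \in [set: int]%classic) F i.

(** Sums over infinite support would collapse to 0, so that linearity of the sum
    needs finite support. *)
Definition fin F := exists r : seq int, forall i, i \notin r -> F i = 0.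

Lemma finsumE (r : seq int) F : uniq r -> (forall i, i \notin r -> F i = 0) ->
  finsum F = \sum_(i <- r) F i.
Proof.
move=> ur Fr; rewrite /finsum (fsbigE r) //; last by move=> i _; apply: Fr.
by apply: eq_bigl => i; apply: mem_set.
Qed.

Lemma finsum0 F : (forall i, F i = 0) -> finsum F = 0.
Proof. by move=> F0; rewrite (@finsumE [::]) ?big_nil. Qed.

Lemma finsum1 F j : (forall i, i != j -> F i = 0) -> finsum F = F j.
Proof.
move=> Fj; rewrite (@finsumE [:: j]) ?big_seq1 // => i; rewrite inE; exact: Fj.
Qed.

Lemma eq_finsum F G : F =1 G -> finsum F = finsum G.
Proof. by move=> /funext ->. Qed.

Lemma finsum_nat F n : (forall i : nat, (n < i)%N -> F i = 0) ->
  (forall i, F (Negz i) = 0) -> finsum F = \sum_(i < n.+1) F (Posz i).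
Proof.
move=> Fpos Fneg; rewrite (@finsumE (map Posz (iota 0 n.+1))).
- by rewrite big_map -[n.+1]subn0 -/(index_iota 0 _) big_mkord.
- by rewrite map_inj_uniq ?iota_uniq // => i j [].
move=> [i|i]; last by rewrite Fneg.
rewrite (mem_map (f := Posz)); last by move=> ? ? [].
by rewrite mem_iota add0n ltnS -ltnNge; apply: Fpos.
Qed.

Lemma finsum_sum (N : nat) (G : 'I_N -> int -> M) : (forall k, fin (G k)) ->
  finsum (fun i => \sum_(k < N) G k i) = \sum_(k < N) finsum (G k).
Proof.
move=> finG; have [r Gr] : exists r : 'I_N -> seq int,
    forall k i, i \notin r k -> G k i = 0.
  by have [r rP] := choice finG; exists r.
pose s := undup (flatten [seq r k | k <- enum 'I_N]).
have sG k i : i \notin s -> G k i = 0.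
  move=> Ns; apply: Gr; apply: contra Ns; rewrite mem_undup => rki.
  by apply/flatten_mapP; exists k; rewrite ?mem_enum.
rewrite (@finsumE s) ?undup_uniq //; last first.
  by move=> i Ns; rewrite big1 // => k _; apply: sG.
rewrite exchange_big; apply: eq_bigr => k _.
by rewrite (@finsumE s) ?undup_uniq // => i; apply: sG.
Qed.

Lemma finsum_morph (h : M -> M) F : {morph h : x y / x + y} -> h 0 = 0 -> fin F ->
  h (finsum F) = finsum (fun i => h (F i)).
Proof.
move=> hD h0 [r Fr]; rewrite !(@finsumE (undup r)) ?undup_uniq //.
- by rewrite (big_morph h hD h0).
- by move=> i; rewrite mem_undup => /Fr ->.
by move=> i; rewrite mem_undup; apply: Fr.
Qed.

Lemma finsum_opp F : finsum F = finsum (fun i => F (- i)).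
Proof. by apply: reindex_fsbigT; exists -%R => x; rewrite opprK. Qed.
End FiniteSums.

(** ** Series of operators *)
Section GenericSeries.
Variables (K : numFieldType) (W : lmodType K).

(** The operations of the theorem, over an arbitrary module: the vertex operators are
    studied over an abstract Fock space, and the results are transferred by
    conversion. *)
Definition gseries := int -> nat -> W -> W.
Implicit Types (S T : gseries).

Definition gsone : gseries :=
  fun p q v => if (p == 0) && (q == 0%N) then v else 0.
Definition gssub S T : gseries := fun p q v => S p q v - T p q v.
Definition gsmul S T : gseries := fun p q v =>
  \sum_(j < q.+1) \sum_(i \in [set: int]%classic) S i j (T (p - i) (q - j)%N v).
Definition gsexpn S (n : nat) : gseries := iter n (gsmul S) gsone.
Definition gsexp S : gseries := fun p q v =>
  \sum_(n \in [set: nat]%classic) (n`!%:R)^-1 *: gsexpn S n p q v.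
Definition gsinv S : gseries := fun p q v =>
  \sum_(n \in [set: nat]%classic) gsexpn (gssub gsone S) n p q v.
Definition gat0 S : gseries :=
  fun p q v => if p == 0 then S 0 q v else 0.
Definition gsconst (f : W -> W) : gseries :=
  fun p q v => if (p == 0) && (q == 0%N) then f v else 0.

(** The substitution of 1/u for u, which turns E^+(u) into a series without negative
    powers of u. *)
Definition refl S : gseries := fun p => S (- p).

Lemma refl_one : refl gsone = gsone.
Proof. by apply/funext => p; rewrite /refl /gsone oppr_eq0. Qed.

Lemma refl_mul S T : refl (gsmul S T) = gsmul (refl S) (refl T).
Proof.
apply/funext => p; apply/funext => q; apply/funext => v.
rewrite /refl /gsmul; apply: eq_bigr => j _.
rewrite -!/(finsum _) finsum_opp; apply: eq_finsum => i.
by rewrite opprK opprB addrC.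
Qed.

Lemma refl_expn S n : refl (gsexpn S n) = gsexpn (refl S) n.
Proof. by elim: n => [|n IHn]; rewrite ?refl_one //= refl_mul IHn. Qed.

Lemma refl_exp S : refl (gsexp S) = gsexp (refl S).
Proof.
apply/funext => p; apply/funext => q; apply/funext => v.
by rewrite /refl /gsexp; apply: eq_fsbigr => n _; rewrite -refl_expn.
Qed.
End GenericSeries.

(** * Representing series of operators by power series *)

Section Rep.
Variables (K : numFieldType) (W : lmodType K).
Local Notation E := (endo W).
Local Notation P1 := (fps E).
Local Notation P2 := (fps P1).
Implicit Types (S T : gseries W) (f g : P2) (c : K).

(** ** Power series in u and h *)

Definition sc c : P2 := fpsC (fpsC (c *: (1 : E))).

Lemma scE c f p q : (sc c * f) p q = c *: f p q.
Proof. by rewrite /sc !fpsCM endoZl mul1r. Qed.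
Lemma scC c f : sc c * f = f * sc c.
Proof.
apply: fpsP => p; apply: fpsP => q; rewrite scE /sc !fpsMC endoZr.
by rewrite mulr1.
Qed.

(** The ideal generated by the monomials u^p h^q of total degree at least N. *)
Definition vord N f := forall p q, (p + q < N)%N -> f p q = 0.

Lemma vordM M N f g : vord M f -> vord N g -> vord (M + N) (f * g).
Proof.
move=> fM gN p q ltpq; rewrite fpsM fps_sum big1 // => i _.
rewrite fpsM big1 // => j _; have := ltn_ord i; have := ltn_ord j => ltj lti.
case: (ltnP (i + j) M) => [lt|ge]; first by rewrite fM // mul0r.
by rewrite gN ?mulr0 //; lia.
Qed.
Lemma vordMl N f g : vord N f -> vord N (f * g).
Proof. by move=> fN; rewrite -[N]addn0; apply: vordM. Qed.
Lemma vordMr N f g : vord N g -> vord N (f * g).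
Proof. by move=> gN; rewrite -[N]add0n; apply: vordM. Qed.
Lemma vord1 f : f 0%N 0%N = 0 -> vord 1 f.
Proof. by move=> f0 [|p] [|q]. Qed.
Lemma vordX n f : f 0%N 0%N = 0 -> vord n (f ^+ n).
Proof.
move=> f0; elim: n => // n IHn; rewrite exprS -add1n; apply: vordM => //.
exact: vord1.
Qed.
Lemma vordD N f g : vord N f -> vord N g -> vord N (f + g).
Proof. by move=> fN gN p q lt; rewrite !fpsD fN ?gN ?addr0. Qed.
Lemma vordN N f : vord N f -> vord N (- f).
Proof. by move=> fN p q lt; rewrite !fpsN fN ?oppr0. Qed.
Lemma vord_le M N f : (M <= N)%N -> vord N f -> vord M f.
Proof. by move=> le fN p q lt; apply: fN; apply: leq_trans le. Qed.
Lemma vord_eq0 f : (forall N, vord N f) -> f = 0.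
Proof. by move=> f0; apply: fpsP => p; apply: fpsP => q; apply: (f0 (p + q).+1). Qed.

(** Exponentials and inverses are read off partial sums: a series without constant
    term has its n-th power in degrees n and above, so that each coefficient of the
    limit is that of a sufficiently long partial sum. *)
Definition expsum N f := \sum_(n < N) sc (n`!%:R)^-1 * f ^+ n.
Definition expf f : P2 := Fps (fun p => Fps (fun q => expsum (p + q).+1 f p q)).
Definition geosum N f := \sum_(n < N) (1 - f) ^+ n.
Definition neumann f : P2 := Fps (fun p => Fps (fun q => geosum (p + q).+1 f p q)).

Lemma sum_window N p q (F : nat -> P2) : (p + q < N)%N ->
  (forall n, (p + q < n)%N -> F n p q = 0) ->
  (\sum_(n < N) F n) p q = \sum_(n < (p + q).+1) F n p q.
Proof.
move=> lt F0; rewrite !fps_sum (big_ord_widen N (fun n => F n p q) lt) [RHS]big_mkcond.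
apply: eq_bigr => n _; case: ifPn => //; rewrite -leqNgt; exact: F0.
Qed.

Lemma expsum_window N f p q : f 0%N 0%N = 0 -> (p + q < N)%N ->
  expsum N f p q = expf f p q.
Proof.
move=> f0 lt; have F0 n : (p + q < n)%N -> (sc (n`!%:R)^-1 * f ^+ n) p q = 0.
  by move=> ltn; rewrite scE vordX ?scaler0.
rewrite /expsum (sum_window (F := fun n => sc _ * f ^+ n) lt F0).
by rewrite [RHS]/= /expsum (sum_window (F := fun n => sc _ * f ^+ n) (leqnn _) F0).
Qed.

Lemma vord_expf N f : f 0%N 0%N = 0 -> vord N (expf f - expsum N f).
Proof. by move=> f0 p q lt; rewrite !fpsB (expsum_window f0 lt) subrr. Qed.

Lemma geosum_window N f p q : f 0%N 0%N = 1 -> (p + q < N)%N ->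
  geosum N f p q = neumann f p q.
Proof.
move=> f0 lt; have F0 n : (p + q < n)%N -> ((1 - f) ^+ n) p q = 0.
  by move=> ltn; apply: vordX => //; rewrite !fpsB f0 subrr.
rewrite /geosum (sum_window (F := fun n => (1 - f) ^+ n) lt F0).
by rewrite [RHS]/= /geosum (sum_window (F := fun n => (1 - f) ^+ n) (leqnn _) F0).
Qed.

Lemma vord_neumann N f : f 0%N 0%N = 1 -> vord N (neumann f - geosum N f).
Proof. by move=> f0 p q lt; rewrite !fpsB (geosum_window f0 lt) subrr. Qed.

Lemma geosum_mull N f : geosum N f * f = 1 - (1 - f) ^+ N.
Proof.
have := subrX1 (1 - f) N; rewrite [1 - f - 1]addrC addKr -/(geosum N f) => /eqP.
rewrite mulNr -subr_eq0 opprK => /eqP eqf.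
have fC : GRing.comm f (geosum N f).
  apply: commr_sum => n _; apply: commrX; apply: commrB; first exact: commr1.
  exact: commr_refl.
by apply/eqP; rewrite -fC -subr_eq0 opprB addrC eqf.
Qed.

Lemma neumannVl f : f 0%N 0%N = 1 -> neumann f * f = 1.
Proof.
move=> f0; apply/eqP; rewrite -subr_eq0; apply/eqP/vord_eq0 => N.
have -> : neumann f * f - 1 = (neumann f - geosum N f) * f - (1 - f) ^+ N.
  by rewrite mulrBl geosum_mull -addrA -opprD subrK.
apply: vordD; last by apply/vordN/vordX; rewrite !fpsB f0 subrr.
by apply: vordMl; apply: vord_neumann.
Qed.

Lemma neumannVr f : f 0%N 0%N = 1 -> f * neumann f = 1.
Proof.
move=> f0; apply/eqP; rewrite -subr_eq0; apply/eqP/vord_eq0 => N.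
have -> : f * neumann f - 1 = f * (neumann f - geosum N f) - (1 - f) ^+ N.
  rewrite mulrBr; have -> : f * geosum N f = geosum N f * f.
    apply: commr_sum => n _; apply: commrX; apply: commrB; first exact: commr1.
    exact: commr_refl.
  by rewrite geosum_mull -addrA -opprD subrK.
apply: vordD; last by apply/vordN/vordX; rewrite !fpsB f0 subrr.
by apply: vordMr; apply: vord_neumann.
Qed.

(** Since d f commutes with f, each power satisfies d (f^n) = n (d f) f^(n-1); as d
    respects truncation, this passes from the partial sums to the exponential. *)
Lemma exp_deriv (d : P2 -> P2) f :
  {morph d : x y / x + y} ->
  (forall x y, d (x * y) = d x * y + x * d y) ->
  (forall c, d (sc c) = 0) -> (forall N x, vord N x -> vord N (d x)) ->
  f 0%N 0%N = 0 -> d f * f = f * d f -> d (expf f) = d f * expf f.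
Proof.
move=> dD dM dsc dvord f0 df.
have d0 : d 0 = 0 by apply: (addrI (d 0)); rewrite -dD !addr0.
have dN x : d (- x) = - d x by apply: (addrI (d x)); rewrite -dD !subrr d0.
have dfX n : d f * f ^+ n = f ^+ n * d f by apply: commrX.
have d1 : d 1 = 0.
  by apply: (addrI (d 1)); rewrite addr0 -[in RHS](mulr1 1) dM mulr1 mul1r.
have dX n : d (f ^+ n.+1) = (d f * f ^+ n) *+ n.+1.
  elim: n => [|n IHn]; first by rewrite expr1 expr0 mulr1.
  rewrite exprS dM IHn -mulrnAr mulrA -df -mulrA mulrnAr -exprS [RHS]mulrS.
  by rewrite mulrnAr.
have dsum N : d (expsum N.+1 f) = d f * expsum N f.
  rewrite /expsum (big_morph d dD d0) big_ord_recl expr0 mulr1 dsc add0r.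
  rewrite mulr_sumr; apply: eq_bigr => n _; rewrite dM dsc mul0r add0r dX.
  rewrite /= mulrA -scC -mulrA; apply: fpsP => p; apply: fpsP => q.
  rewrite !scE fpsMn fpsMn -scaler_nat scalerA factS natrM invfM mulrAC mulVf ?mul1r //.
  by rewrite pnatr_eq0.
apply/eqP; rewrite -subr_eq0; apply/eqP/vord_eq0 => N.
have -> : d (expf f) - d f * expf f =
    d (expf f - expsum N.+1 f) - d f * (expf f - expsum N f).
  by rewrite dD dN dsum mulrBr opprB addrA subrK.
apply: vordD; first by apply: dvord; apply: (@vord_le N N.+1) => //; exact: vord_expf.
by apply/vordN/vordMr/vord_expf.
Qed.

(** For an inner derivation y |-> x y - y x whose value c on f commutes with f, the
    factor c comes out of the exponential. *)
Lemma exp_inner (x f : P2) (c : P2) : f 0%N 0%N = 0 ->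
  x * f = f * x + c -> c * f = f * c -> x * expf f = expf f * x + c * expf f.
Proof.
move=> f0 xf cf; have dE : x * f - f * x = c by rewrite xf addrAC subrr add0r.
have := @exp_deriv (fun y => x * y - y * x) f _ _ _ _ f0; rewrite /= dE.
move=> /(_ _ _ _ _ cf) <-; first by rewrite addrC subrK.
- by move=> y z; rewrite mulrDr mulrDl opprD addrACA.
- by move=> y z; rewrite mulrBl mulrBr !mulrA addrA subrK.
- by move=> e; rewrite scC subrr.
by move=> N y yN; apply: vordD; [apply: vordMr|apply/vordN/vordMl].
Qed.

Lemma expf_comm (x f : P2) : f 0%N 0%N = 0 -> x * f = f * x ->
  x * expf f = expf f * x.
Proof.
move=> f0 xf; have := @exp_inner x f 0 f0; rewrite !mul0r mulr0 !addr0.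
by apply.
Qed.

(** Comparing coefficients in u d/du (exp f) = (u d/du f) exp f turns an exponential
    into a recursion. *)
Lemma exp_euler f p q : f 0%N 0%N = 0 ->
  Fps (fun p => f p *+ p) * f = f * Fps (fun p => f p *+ p) ->
  expf f p q *+ p = \sum_(i < p.+1) ((f i *+ i) * expf f (p - i)%N) q.
Proof.
move=> f0 fC; pose d (g : P2) : P2 := Fps (fun p => g p *+ p).
have : d (expf f) = d f * expf f.
  apply: exp_deriv => //.
  - by move=> x y; apply: fpsP => n; rewrite /= mulrnDl.
  - move=> x y; apply: fpsP => n; rewrite fpsD /= -sumrMnl -big_split /=.
    apply: eq_bigr => i _; rewrite mulrnAl mulrnAr -mulrnDr.
    by rewrite subnKC // -ltnS ltn_ord.
  - by move=> c; apply: fpsP => -[|n]; rewrite /= ?mulr0n ?mul0rn.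
  by move=> N x xN p' q' lt; rewrite /= fpsMn xN // mul0rn.
move/(congr1 (fun g : P2 => g p q)); rewrite /d.
by rewrite [LHS]/= fpsMn => ->; rewrite fpsM fps_sum.
Qed.

(** ** Representation of operator-valued series *)

(** Series without negative powers of u live in a power series ring over the
    endomorphisms, where exponentials and inverses obey algebraic rules. *)
Definition rep S f := forall p q v,
  S p q v = match p with Posz n => f n q v | Negz _ => 0 end.

Definition zc f (i : int) : P1 := match i with Posz n => f n | Negz _ => 0 end.

Lemma repE S f p q v : rep S f -> S p q v = zc f p q v.
Proof. by move=> ->; case: p. Qed.

Lemma rep_one : rep (@gsone K W) 1.
Proof. by case=> [[|n]|n] [|q] v. Qed.

Lemma rep_sub S T f g : rep S f -> rep T g -> rep (gssub S T) (f - g).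
Proof. by move=> Sf Tg [n|n] q v; rewrite /gssub Sf Tg ?subrr. Qed.

Lemma zcM f g p q v : finsum (fun i => \sum_(j < q.+1)
    zc f i j (zc g (p - i) (q - j)%N v)) = zc (f * g) p q v.
Proof.
case: p => p; last first.
  rewrite finsum0 // => -[i|i]; rewrite big1 //= => j _.
  suff -> : zc g (Negz p - Posz i) = 0 by rewrite endo0v.
  by have -> : Negz p - Posz i = Negz (p + i) by lia.
rewrite (@finsum_nat _ _ p) => [|i lt_p|i]; last by rewrite big1.
  2: { rewrite big1 // => j _; suff -> : zc g (Posz p - Posz i) = 0 by rewrite endo0v.
       by have -> : Posz p - Posz i = Negz (i - p).-1 by lia. }
rewrite -[zc _ (Posz p)]/((f * g) p) fpsM fps_sum endo_sum.
apply: eq_bigr => i _; rewrite fpsM endo_sum.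
apply: eq_bigr => j _; congr (f i j _).
by have -> : Posz p - Posz i = Posz (p - i) by have := ltn_ord i; lia.
Qed.

Lemma fin_zc f g p q j (v : W) : fin (fun i => zc f i j (zc g (p - i) q v)).
Proof.
exists (map Posz (iota 0 `|p|.+1)) => -[i|i] Ni //=.
suff -> : zc g (p - Posz i) = 0 by rewrite endo0v.
have lt : (`|p| < i)%N.
  move: Ni; rewrite (mem_map (f := Posz)) ?mem_iota; last by move=> ? ? [].
  by rewrite add0n ltnS -ltnNge.
by have -> : p - Posz i = Negz (`|(Posz i - p)|.-1) by lia.
Qed.

Lemma rep_mul S T f g : rep S f -> rep T g -> rep (gsmul S T) (f * g).
Proof.
move=> Sf Tg p q v; transitivity (zc (f * g) p q v); last by case: p.
rewrite -zcM finsum_sum => [|j]; last exact: fin_zc.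
apply: eq_bigr => j _; apply: eq_finsum => i.
by rewrite (repE _ _ _ Sf) (repE _ _ _ Tg).
Qed.

Lemma rep_expn S f n : rep S f -> rep (gsexpn S n) (f ^+ n).
Proof.
move=> Sf; elim: n => [|n IHn]; first exact: rep_one.
by rewrite exprS; apply: rep_mul.
Qed.

Lemma finsum_natw (F : nat -> W) N : (forall n, (N <= n)%N -> F n = 0) ->
  \sum_(n \in [set: nat]%classic) F n = \sum_(n < N) F n.
Proof.
move=> F0; rewrite (fsbigE (iota 0 N)) ?iota_uniq //; last first.
  by move=> n _; rewrite mem_iota add0n -leqNgt; apply: F0.
rewrite -(big_mkord xpredT F) /index_iota subn0.
by apply: eq_bigl => i; apply: mem_set.
Qed.

Lemma rep_exp S f : rep S f -> f 0%N 0%N = 0 -> rep (gsexp S) (expf f).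
Proof.
move=> Sf f0 p q v; rewrite /gsexp; case: p => p; last first.
  by rewrite fsbig1 // => n _; rewrite (rep_expn n Sf) scaler0.
rewrite (@finsum_natw _ (p + q).+1) => [|n lt].
  rewrite [RHS]/= /expsum !fps_sum endo_sum; apply: eq_bigr => n _.
  by rewrite scE (rep_expn n Sf).
by rewrite (rep_expn n Sf) vordX ?scaler0.
Qed.

Lemma rep_inv S f : rep S f -> f 0%N 0%N = 1 -> rep (gsinv S) (neumann f).
Proof.
move=> Sf f0 p q v; have S1f := rep_sub rep_one Sf.
rewrite /gsinv; case: p => p; last first.
  by rewrite fsbig1 // => n _; rewrite (rep_expn n S1f).
rewrite (@finsum_natw _ (p + q).+1) => [|n lt].
  rewrite [RHS]/= /geosum !fps_sum endo_sum; apply: eq_bigr => n _.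
  by rewrite (rep_expn n S1f).
by rewrite (rep_expn n S1f) vordX // !fpsB f0 subrr.
Qed.

Lemma rep_at0 S f : rep S f -> rep (gat0 S) (fpsC (f 0%N)).
Proof. by move=> Sf [[|p]|p] q v; rewrite /gat0 /= ?Sf. Qed.

End Rep.

(** * The exponentials of the vertex operators *)

Section Gbin.
Variable K : numFieldType.
Implicit Types (x y c : K).

Lemma gbin0 x : gbin x 0 = 1.
Proof. by rewrite /gbin big_ord0 fact0 divr1. Qed.

Lemma gbinS x n : n.+1%:R * gbin x n.+1 = (x - n%:R) * gbin x n.
Proof.
rewrite /gbin big_ord_recr /= factS natrM.
have nz : n`!%:R != 0 :> K by rewrite pnatr_eq0 -lt0n fact_gt0.
have nz1 : n.+1%:R != 0 :> K by rewrite pnatr_eq0.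
by field; rewrite nz nat1r nz1.
Qed.

Lemma gbin_nat m n : gbin (m%:R : K) n = 'C(m, n)%:R.
Proof.
elim: n => [|n IHn]; first by rewrite gbin0 bin0.
apply: (@mulfI _ n.+1%:R); first by rewrite pnatr_eq0.
rewrite gbinS IHn -natrM mul_bin_left natrM.
case: (leqP n m) => [le_nm|lt_mn]; first by rewrite natrB.
by rewrite bin_small // !mulr0.
Qed.

(** The Chu-Vandermonde identity, by induction from the recursion in n. *)
Lemma gbinD x y n :
  \sum_(i < n.+1) gbin x i * gbin y (n - i) = gbin (x + y) n.
Proof.
elim: n => [|n IHn]; first by rewrite big_ord1 !gbin0 mulr1.
apply: (@mulfI _ n.+1%:R); first by rewrite pnatr_eq0.
rewrite gbinS -IHn mulr_sumr mulr_sumr.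
pose s i := i%:R * (gbin x i * gbin y (n.+1 - i)).
pose t i := (n.+1 - i)%:R * (gbin x i * gbin y (n.+1 - i)).
transitivity (\sum_(i < n.+2) s i + \sum_(i < n.+2) t i).
  rewrite -big_split; apply: eq_bigr => i _; rewrite /s /t /= -mulrDl -natrD.
  by rewrite subnKC // -ltnS ltn_ord.
rewrite big_ord_recl /s mul0r add0r [X in _ + X]big_ord_recr /t /= subnn mul0r addr0.
rewrite -big_split; apply: eq_bigr => i _ /=; rewrite /bump /= add1n subSS.
have le_in : (i <= n)%N by rewrite -ltnS ltn_ord.
rewrite mulrA gbinS subSn // [_ * (gbin x i * _)]mulrCA gbinS natrB //.
by rewrite -[n%:R in RHS](subrK i%:R); ring.
Qed.

Lemma gbinNr x n : \sum_(i < n.+1) gbin (- x) i * gbin x (n - i) = (n == 0%N)%:R.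
Proof.
rewrite gbinD addNr; case: n => [|n]; first by rewrite gbin0.
by rewrite -[0]/(0%:R) gbin_nat bin0n.
Qed.
End Gbin.

Section Vertex.
Variables (K : numFieldType) (W : fock K).
Local Notation E := (endo W).
Local Notation P1 := (fps E).
Local Notation P2 := (fps P1).

Definition ga (j : 'I_2) (r : int) : W -> W :=
  match r with
  | Negz n => cr W (j, n)
  | Posz 0 => fun=> 0
  | Posz n.+1 => an W (j, n)
  end.

Local Notation a1 := (ga ord0).
Local Notation a2 := (ga ord_max).

Definition gEm_exponent : gseries W := fun p q v =>
  \sum_(r \in [set r : nat | (0 < r)%N]%classic)
    (- (upow (- (3 / 4)) r%:Z p q / r%:R) *: a1 (- r%:Z) v
     + (upow (1 / 4) r%:Z p q / r%:R) *: a2 (- r%:Z) v).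
Definition gEm := gsexp gEm_exponent.

Definition gEp_exponent : gseries W := fun p q v =>
  \sum_(r \in [set r : nat | (0 < r)%N]%classic)
    (upow (1 / 4) (- r%:Z) p q / r%:R) *: (a1 r%:Z v - a2 r%:Z v).
Definition gEp := gsexp gEp_exponent.

Lemma fsbig_pos (M : zmodType) (F : nat -> M) s : (0 < s)%N ->
  (forall r, r != s -> F r = 0) ->
  \sum_(r \in [set r : nat | (0 < r)%N]%classic) F r = F s.
Proof.
move=> s_gt0 F0; rewrite (fsbigE [:: s]) //.
- by rewrite big_cons big_nil mem_set //= addr0.
- by move=> r; rewrite /= inE => /eqP ->.
by move=> r _; rewrite inE; apply: F0.
Qed.

(** The exponents as series with coefficients in the operators; the one of E^+ is
    a series in 1/u. *)
Definition Sm : P2 := Fps (fun p => Fps (fun q =>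
  if (p + q)%N is r.+1 then
    - ('C(r.+1, q)%:R * (- (3 / 4)) ^+ q / r.+1%:R) *: cr W (ord0, r)
    + ('C(r.+1, q)%:R * (1 / 4) ^+ q / r.+1%:R) *: cr W (ord_max, r)
  else 0)).

Definition Sp : P2 := Fps (fun p => Fps (fun q =>
  if (p - q)%N is r.+1 then
    (gbin (- r.+1%:R) q * (1 / 4) ^+ q / r.+1%:R) *:
      (an W (ord0, r) - an W (ord_max, r))
  else 0)).

Lemma upow_neq (c : K) (p i : int) q : i != p - q%:Z -> upow c p i q = 0.
Proof. by rewrite /upow => /negPf ->. Qed.

Lemma upow_pos (c : K) (r : nat) (i : int) q : i = r%:Z - q%:Z ->
  upow c r%:Z i q = 'C(r, q)%:R * c ^+ q.
Proof. by move=> ->; rewrite /upow eqxx -gbin_nat. Qed.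

Lemma rep_Sm : rep gEm_exponent Sm.
Proof.
move=> p q v; rewrite /gEm_exponent.
pose F (r : nat) := - (upow (- (3 / 4)) r%:Z p q / r%:R) *: a1 (- r%:Z) v
  + (upow (1 / 4) r%:Z p q / r%:R) *: a2 (- r%:Z) v.
rewrite -[LHS]/(\sum_(r \in [set r : nat | (0 < r)%N]%classic) F r).
have F0 r : r%:Z != p + q%:Z -> F r = 0.
  move=> neq; rewrite /F !upow_neq ?mul0r ?oppr0 ?scale0r ?addr0 //;
  by apply: contra neq => /eqP ->; rewrite subrK.
have FE r : r.+1%:Z = p + q%:Z -> F r.+1 =
    - ('C(r.+1, q)%:R * (- (3 / 4)) ^+ q / r.+1%:R) *: cr W (ord0, r) v
    + ('C(r.+1, q)%:R * (1 / 4) ^+ q / r.+1%:R) *: cr W (ord_max, r) v.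
  by move=> eqr; rewrite /F !upow_pos // eqr addrK.
clearbody F; case: p => p in F0 FE *; last first.
  apply: fsbig1 => -[//|r] _; case: (r.+1%:Z =P Negz p + q%:Z) => [eqr|/eqP]; last exact: F0.
  by rewrite FE // bin_small ?mul0r ?oppr0 ?scale0r ?addr0 //; lia.
rewrite /=; case pq: (p + q)%N => [|r].
  by apply: fsbig1 => -[//|r] _; apply: F0; lia.
rewrite (@fsbig_pos _ _ r.+1) ?FE //; first by rewrite -PoszD pq.
by move=> s neq; apply: F0; lia.
Qed.

Lemma rep_Sp : rep (refl gEp_exponent) Sp.
Proof.
move=> p q v; rewrite /refl /gEp_exponent.
pose F (r : nat) := (upow (1 / 4) (- r%:Z) (- p) q / r%:R) *:
  (a1 r%:Z v - a2 r%:Z v).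
rewrite -[LHS]/(\sum_(r \in [set r : nat | (0 < r)%N]%classic) F r).
have F0 r : - r%:Z != q%:Z - p -> F r = 0.
  move=> neq; rewrite /F upow_neq ?mul0r ?scale0r //.
  by apply: contra neq => /eqP ->; apply/eqP; lia.
have FE r : p = r.+1%:Z + q%:Z -> F r.+1 =
    (gbin (- r.+1%:R) q * (1 / 4) ^+ q / r.+1%:R) *:
      (an W (ord0, r) v - an W (ord_max, r) v).
  move=> eqp; rewrite /F /upow eqp.
  have -> : (- (r.+1%:Z + q%:Z) == - r.+1%:Z - q%:Z) by lia.
  by rewrite mulrNz.
clearbody F; case: p => p in F0 FE *; last by apply: fsbig1 => r _; apply: F0; lia.
rewrite /=; case pq: (p - q)%N => [|r].
  by apply: fsbig1 => -[//|r] _; apply: F0; lia.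
rewrite (@fsbig_pos _ _ r.+1) ?FE //; first by lia.
by move=> s neq; apply: F0; lia.
Qed.

Lemma Sm00 : Sm 0%N 0%N = 0. Proof. by []. Qed.
Lemma Sp00 : Sp 0%N 0%N = 0. Proof. by []. Qed.

Definition Em : P2 := expf Sm.
Definition Ep : P2 := expf Sp.

Lemma rep_Em : rep gEm Em. Proof. exact: rep_exp rep_Sm Sm00. Qed.
Lemma rep_Ep : rep (refl gEp) Ep.
Proof. by rewrite /gEp refl_exp; exact: rep_exp rep_Sp Sp00. Qed.

Lemma Em00 : Em 0%N 0%N = 1.
Proof.
by rewrite /Em /expf /= /expsum big_ord1 scE expr0 fact0 invr1 scale1r.
Qed.

Definition Em0_inv : P2 := neumann (fpsC (Em 0%N)).

Lemma rep_Em0_inv : rep (gsinv (gat0 gEm)) Em0_inv.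
Proof. by apply: rep_inv (rep_at0 rep_Em) _; exact: Em00. Qed.

(** The coefficients of E^-(0)^{-1} E^-(u). *)
Definition Hf : P2 := Em0_inv * Em.

End Vertex.

(** * Normal ordering of the vertex operators *)

Section Modes.
Variables (K : numFieldType) (W : fock K).
Local Notation E := (endo W).
Local Notation P1 := (fps E).
Local Notation P2 := (fps P1).
Local Notation ser := (gseries W).
Implicit Types (v : W).

Definition gu : ser := fun p q =>
  if q == 0%N then efun (dg W (fun w => (w == p)%:R)) else fun=> 0.
Definition goh (e : K) : ser := fun p q =>
  if p == - q%:Z then efun (dg W (fun w => gbin (e * (w%:~R / 2)) q)) else fun=> 0.
(** X_alpha(u) with its last two factors replaced by T. *)
Definition dress (T : ser) : ser :=
  gsmul (gsinv (gat0 (@gEm K W))) (gsmul (@gEm K W) (gsmul (@gEp K W)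
    (gsmul (gsconst (ew W alpha)) T))).
Definition gX : ser := dress (gsmul gu (goh 1)).
Definition gXt : ser := gsmul gX (goh (- 1)).

Definition linser (S : ser) := forall i j, exists e : E, forall v, S i j v = e v.

Lemma linser_rep S f : rep S f -> linser S.
Proof. by move=> Sf i j; exists (zc f i j) => v; rewrite (repE _ _ _ Sf). Qed.
Lemma linser_refl S f : rep (refl S) f -> linser S.
Proof.
move=> Sf i j; exists (zc f (- i) j) => v.
by rewrite -(repE _ _ _ Sf) /refl opprK.
Qed.
Lemma linser_const (e : E) : linser (gsconst e).
Proof.
move=> i j; rewrite /gsconst; case: ((i == 0) && (j == 0%N)); first by exists e.
by exists 0.
Qed.
Lemma linser_gu : linser gu.
Proof.
move=> i j; rewrite /gu; case: (j == 0%N); last by exists 0.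
by exists (dg W (fun w => (w == i)%:R)).
Qed.

(** On weight w the right factor is the scalar series (1 + h/u)^(e w / 2). *)
Lemma smul_oh (S : ser) e w v p q :
  (forall i j c, S i j (c *: v) = c *: S i j v) -> pw W w v = v ->
  gsmul S (goh e) p q v =
  \sum_(l < q.+1) gbin (e * (w%:~R / 2)) l *: S (p + l%:Z) (q - l)%N v.
Proof.
move=> linS vw; rewrite /gsmul (reindex_inj rev_ord_inj); apply: eq_bigr => l _ /=.
rewrite subSS; have le_lq : (l <= q)%N by rewrite -ltnS ltn_ord.
rewrite -/(finsum _) (@finsum1 _ _ (p + l%:Z)); last first.
  move=> i neq; rewrite /goh ifF; last by apply/negbTE; lia.
  by rewrite -[X in S _ _ X](scale0r v) linS scale0r.
by rewrite /goh ifT; [rewrite (dg_wt _ vw) subKn // linS|lia].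
Qed.

(** T is obtained from T' on v by a substitution like that of [smul_oh]. *)
Definition twist (c : nat -> K) v (T T' : ser) := forall p q,
  T p q v = \sum_(l < q.+1) c l *: T' (p + l%:Z) (q - l)%N v.

(** A twist only recombines coefficients of the right factor, with scalars. *)
Lemma twist_smul c v S T T' : linser S ->
  (forall p q j, fin (fun i => S i j (T' (p - i) q v))) ->
  twist c v T T' -> twist c v (gsmul S T) (gsmul S T').
Proof.
move=> linS finST TT' p q.
pose G j l := c l *: finsum (fun i => S i j (T' (p + l%:Z - i) (q - j - l)%N v)).
transitivity (\sum_(j < q.+1) \sum_(l < (q - j).+1) G j l).
  apply: eq_bigr => j _.
  pose H (l : 'I_(q - j).+1) i := c l *: S i j (T' (p + l%:Z - i) (q - j - l)%N v).
  have finH l : fin (H l).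
    by have [r rP] := finST (p + l%:Z) (q - j - l)%N j; exists r => i /rP; rewrite /H => ->; rewrite scaler0.
  transitivity (finsum (fun i => \sum_l H l i)).
    apply: eq_finsum => i; rewrite TT'; have [f fE] := linS i j.
    rewrite fE endo_sumv; apply: eq_bigr => l _; rewrite endoZv /H fE.
    by rewrite addrAC.
  rewrite finsum_sum //; apply: eq_bigr => l _.
  apply/esym/(finsum_morph (h := fun v => c l *: v)); last exact: finST.
  - by move=> x y; rewrite scalerDr.
  - by rewrite scaler0.
rewrite exchange_triangle; apply: eq_bigr => l _.
rewrite /G -scaler_sumr; congr (_ *: _); apply: eq_bigr => j _.
by apply: eq_finsum => i; rewrite -!subnDA addnC.
Qed.

(** On the vector v and up to order Q in h, the coefficient of u^p in T is the
    coefficient of u^(p - w) in f(u) R(1/u), applied to v'. *)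
Definition normal_form N Q w v v' (T : ser) (f R : P2) := forall p q, (q <= Q)%N ->
  T p q v = \sum_(k < N) (zc f (p - w + k%:Z) * R k) q v'.

Lemma normal_form_fin N Q w v v' S T f g R p q j : rep S g ->
  normal_form N Q w v v' T f R -> (q <= Q)%N ->
  fin (fun i => S i j (T (p - i) q v)).
Proof.
move=> Sg Tf leq.
exists (map Posz (iota 0 (`|p - w| + N).+1)) => i Ni; rewrite (repE _ _ _ Sg).
case: i => i in Ni *; last by [].
suff -> : T (p - i%:Z) q v = 0 by rewrite endo0v.
rewrite Tf // big1 // => k _; suff -> : zc f (p - i%:Z - w + k%:Z) = 0.
  by rewrite mul0r.
move: Ni; rewrite (mem_map (f := Posz)) ?mem_iota; last by move=> ? ? [].
rewrite add0n ltnS -ltnNge => lt_i; have ltk := ltn_ord k.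
by have -> : p - i%:Z - w + k%:Z = Negz `|p - i%:Z - w + k%:Z|.-1 by lia.
Qed.

Lemma normal_form_smul N Q w v v' S T f g R : rep S g ->
  normal_form N Q w v v' T f R -> normal_form N Q w v v' (gsmul S T) (g * f) R.
Proof.
move=> Sg Tf p q leq.
transitivity (\sum_(k < N) \sum_(j < q.+1)
   finsum (fun i => zc g i j ((zc f (p - i - w + k%:Z) * R k) (q - j)%N v'))).
  rewrite exchange_big; apply: eq_bigr => j _; rewrite -finsum_sum.
    apply: eq_finsum => i; rewrite Tf ?(repE _ _ _ Sg) ?endo_sumv //.
    exact: leq_trans (leq_subr _ _) leq.
  move=> k; pose f' : P2 := Fps (fun n => f n * R k).
  have zcf' m : zc f m * R k = zc f' m by case: m => m //=; rewrite mul0r.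
  have [r rP] := @fin_zc _ _ g f' (p - w + k%:Z) (q - j)%N j v'.
  exists r => i /rP <-; rewrite zcf'; congr (zc g i j (zc f' _ _ _)); lia.
apply: eq_bigr => k _; pose f' : P2 := Fps (fun n => f n * R k).
have zcf' m : zc f m * R k = zc f' m by case: m => m //=; rewrite mul0r.
have -> : zc (g * f) (p - w + k%:Z) * R k = zc (g * f') (p - w + k%:Z).
  case: (p - w + k%:Z) => m; last by rewrite mul0r.
  by rewrite /= mulr_suml; apply: eq_bigr => i _; rewrite mulrA.
rewrite -zcM finsum_sum => [|j]; last exact: fin_zc.
apply: eq_bigr => j _; apply: eq_finsum => i; rewrite zcf'.
congr (zc g i j (zc f' _ _ _)); lia.
Qed.

(** The coefficient of u^{-p} h^q in the exponent of E^+ involves a_j(p - q) only. *)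
Lemma lowers_Sp p q : lowers (p - q) (Sp W p q).
Proof.
rewrite /Sp /=; case pq: (p - q)%N => [|r]; first exact: lowers0.
apply: lowersZ; apply: lowersD; first exact: (@lowers_an _ _ (ord0, r)).
by apply: lowersN; exact: (@lowers_an _ _ (ord_max, r)).
Qed.

Lemma lowers_Ep p q : lowers (p - q) (Ep W p q).
Proof.
have lowX n i j : lowers (i - j) ((Sp W ^+ n) i j).
  elim: n i j => [|n IHn] i j.
    rewrite expr0; case: i => [|i]; last exact: lowers0.
    by case: j => [|j]; [exact: lowers1|exact: lowers0].
  rewrite exprS fpsM fps_sum; apply: lowers_sum => i' _.
  rewrite fpsM; apply: lowers_sum => j' _.
  have le : (i - j <= (i' - j') + ((i - i') - (j - j')))%N.
    by have := ltn_ord i'; have := ltn_ord j'; lia.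
  refine (lowers_le le _); refine (lowersM _ _); first exact: lowers_Sp.
  exact: IHn.
rewrite /Ep /= /expsum !fps_sum; apply: lowers_sum => n _.
by rewrite scE; apply: lowersZ.
Qed.

Lemma Ep_eq0 N v k q : energy_lt N v -> (N + q <= k)%N -> Ep W k q v = 0.
Proof.
move=> vN le; apply: energy_lt0.
have := @lowers_Ep k q N v vN; have -> : (N - (k - q) = 0)%N by lia.
by [].
Qed.

Lemma energy_lt_ew N b v : energy_lt N v -> energy_lt N (ew W b v).
Proof. by move=> vN k w le; rewrite coef_ew vN. Qed.
Lemma energy_ltZ N (c : K) v : energy_lt N v -> energy_lt N (c *: v).
Proof. by move=> vN k w le; rewrite wcoefZ vN ?mulr0. Qed.

Local Notation T1 := (gsmul (gsconst (ew W alpha)) gu).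
Local Notation T2 := (gsmul (@gEp K W) T1).

Lemma T1E w v p q : pw W w v = v ->
  T1 p q v = if (p == w) && (q == 0%N) then ew W alpha v else 0.
Proof.
move=> vw; rewrite /gsmul big_ord_recl [X in _ + X]big1 ?addr0 => [|j _]; last first.
  by rewrite -/(finsum _); apply: finsum0 => i; rewrite /gsconst /= andbF.
rewrite -/(finsum _) (@finsum1 _ _ 0) => [|i]; last by rewrite /gsconst => /negPf ->.
rewrite /gsconst eqxx /= subr0 subn0 /gu.
case: (q == 0%N); last by rewrite andbF endo0v.
rewrite andbT (dg_wt _ vw) eq_sym; case: eqP => _; first by rewrite scale1r.
by rewrite scale0r endo0v.
Qed.

Lemma T2E w v p q : pw W w v = v -> T2 p q v = @gEp K W (p - w) q (ew W alpha v).
Proof.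
move=> vw; have linE := linser_refl (@rep_Ep K W).
rewrite -[LHS]/(\sum_(j < q.+1) finsum (fun i =>
  @gEp K W i j (T1 (p - i) (q - j)%N v))).
rewrite big_ord_recr big1 ?add0r => [|j _]; last first.
  apply: finsum0 => i; rewrite (T1E _ _ vw) subn_eq0 leqNgt /= ltn_ord andbF.
  by have [f ->] := linE i j; rewrite endo0v.
rewrite (@finsum1 _ _ (p - w)) => [|i neq].
  have pw_w : p - (p - w) = w by rewrite opprB addrC subrK.
  by rewrite (T1E _ _ vw) /= subnn pw_w !eqxx add0r.
rewrite (T1E _ _ vw) /= subnn andbT ifF; last by apply/negbTE; lia.
by have [f ->] := linE i q; rewrite endo0v.
Qed.

Lemma T2_normal N Q w v : pw W w v = v -> energy_lt N v ->
  normal_form (N + Q) Q w v (ew W alpha v) T2 1 (Ep W).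
Proof.
move=> vw vN p q leq; rewrite (T2E _ _ vw); set v' := ew W alpha v.
have zc1 i : zc (1 : P2) i = (i == 0)%:R by case: i => [[|i]|i].
have gEpE : @gEp K W (p - w) q v' = zc (Ep W) (w - p) q v'.
  by rewrite -(repE _ _ _ (@rep_Ep K W)) /refl opprB.
rewrite gEpE; case wp: (w - p) => [m|m].
  transitivity (\sum_(k < N + Q | k == m :> nat) Ep W k q v').
    case: (ltnP m (N + Q)) => [ltm|lem]; first by rewrite (big_pred1 (Ordinal ltm)).
    rewrite big1 => [|k /eqP km]; last by have := ltn_ord k; lia.
    by apply: (@Ep_eq0 N); [apply: energy_lt_ew|lia].
  rewrite big_mkcond; apply: eq_bigr => k _; rewrite zc1.
  have -> : (p - w + k%:Z == 0) = (k == m :> nat) by lia.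
  by case: eqP => _; rewrite ?mul1r ?mul0r.
rewrite big1 // => k _; rewrite zc1.
have -> : (p - w + k%:Z == 0) = false by lia.
by rewrite mul0r.
Qed.

(** On weight w the factor u^{d_alpha} contributes u^w, and the terms of E^+ of index
    at least N + Q kill a vector of energy less than N up to order Q in h. *)
Lemma dress_gu_normal N Q w v : pw W w v = v -> energy_lt N v ->
  normal_form (N + Q) Q w v (ew W alpha v) (dress gu) (Hf W) (Ep W).
Proof.
move=> vw vN; rewrite /Hf -[Em W]mulr1.
refine (normal_form_smul (@rep_Em0_inv K W) _).
refine (normal_form_smul (@rep_Em K W) _).
exact: T2_normal.
Qed.

Lemma dress_guZ w v p q c : pw W w v = v ->
  dress gu p q (c *: v) = c *: dress gu p q v.
Proof.
move=> vw; have [N vN] := energy_lt_ex v.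
have cvw : pw W w (c *: v) = c *: v by rewrite endoZv vw.
rewrite (dress_gu_normal (Q := q) cvw (energy_ltZ c vN)) //.
rewrite (dress_gu_normal (Q := q) vw vN) // scaler_sumr.
by apply: eq_bigr => k _; rewrite !endoZv.
Qed.

Lemma gX_twist w v : pw W w v = v ->
  twist (gbin (1 * (w%:~R / 2))) v gX (dress gu).
Proof.
move=> vw; have [N vN] := energy_lt_ex v; have linE := linser_refl (@rep_Ep K W).
apply: twist_smul; first exact: linser_rep (@rep_Em0_inv K W).
  move=> p q j; refine (normal_form_fin p j (@rep_Em0_inv K W) _ (leqnn q)).
  refine (normal_form_smul (@rep_Em K W) _); exact: (T2_normal vw vN).
apply: twist_smul; first exact: linser_rep (@rep_Em K W).
  move=> p q j; refine (normal_form_fin p j (@rep_Em K W) _ (leqnn q)).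
  exact: T2_normal vw vN.
apply: twist_smul; first exact: linE.
  move=> p q j; exists [:: p - w] => i; rewrite inE => neq.
  rewrite (T1E _ _ vw) ifF; last by apply/negbTE; lia.
  by have [f ->] := linE i j; rewrite endo0v.
apply: twist_smul; first exact: linser_const.
  by move=> p q j; exists [:: 0] => i; rewrite inE /gsconst => /negPf ->.
move=> p q; apply: smul_oh => // i j c.
by have [f fE] := linser_gu i j; rewrite !fE endoZv.
Qed.

Lemma gX_E w v p q : pw W w v = v ->
  gX p q v = \sum_(l < q.+1) gbin (w%:~R / 2) l *: dress gu (p + l%:Z) (q - l)%N v.
Proof. by move=> vw; rewrite (gX_twist vw) mul1r. Qed.

(** By the Chu-Vandermonde identity, the last factor of X~ undoes the twist. *)
Lemma gXt_E w v p q : pw W w v = v -> gXt p q v = dress gu p q v.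
Proof.
move=> vw; rewrite /gXt (smul_oh _ _ _ _ vw) => [|i j c]; last first.
  have cvw : pw W w (c *: v) = c *: v by rewrite endoZv vw.
  rewrite (gX_E _ _ cvw) (gX_E _ _ vw) scaler_sumr; apply: eq_bigr => l _.
  by rewrite (dress_guZ _ _ _ vw) !scalerA mulrC.
set x : K := w%:~R / 2; rewrite mulN1r.
pose G l m := (gbin (- x) l * gbin x m) *: dress gu (p + (l + m)%N%:Z) (q - (l + m))%N v.
transitivity (\sum_(l < q.+1) \sum_(m < (q - l).+1) G l m).
  apply: eq_bigr => l _; rewrite (gX_E _ _ vw) scaler_sumr; apply: eq_bigr => m _.
  by rewrite scalerA /G PoszD addrA subnDA.
rewrite sum_triangle big_ord_recl [X in _ + X]big1 ?addr0 => [|t _].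
  by rewrite /= big_ord1 /G /= !gbin0 mulr1 scale1r addr0 !subn0.
transitivity (\sum_(l < (bump 0 t).+1) (gbin (- x) l * gbin x (bump 0 t - l)) *:
    dress gu (p + (bump 0 t)%:Z) (q - bump 0 t)%N v).
  by apply: eq_bigr => l _; rewrite /G subnKC // -ltnS ltn_ord.
by rewrite -scaler_suml gbinNr scale0r.
Qed.

End Modes.

(** * Operators commuting with the vertex operators *)

Section Charge.
Variables (K : numFieldType) (W : fock K).
Local Notation E := (endo W).
Local Notation P1 := (fps E).
Local Notation P2 := (fps P1).
Local Notation cr := (cr W).
Local Notation an := (an W).
Local Notation Sm := (Sm W).
Local Notation Sp := (Sp W).
Local Notation Em := (Em W).
Local Notation Ep := (Ep W).
Local Notation Hf := (Hf W).

Lemma fpsC_M (R : pzRingType) (x y : R) : fpsC (x * y) = fpsC x * fpsC y.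
Proof.
apply: fpsP => n; rewrite fpsCM /fpsC /=; case: (n == 0%N) => //.
by rewrite mulr0.
Qed.
Lemma fpsC_D (R : pzRingType) (x y : R) : fpsC (x + y) = fpsC x + fpsC y.
Proof.
apply: fpsP => n; rewrite fpsD /fpsC /=; case: (n == 0%N) => //.
by rewrite addr0.
Qed.

(** The derivation sending the generating functions sum a_1(-s) w^s / s and
    sum a_2(-s) w^s / s to w^r and (w - h)^r - (-h)^r, for r = n + 1. The exponent
    of E^-(u) is the second one at w = u + h/4 minus the first one at
    w = u - 3h/4, so its image is the constant - (-h)^r. *)
Definition D n : P1 := Fps (fun q =>
  (q == 0%N)%:R *: an (ord0, n) +
  (if (q <= n)%N then (-1) ^+ q * 'C(n.+1, q)%:R else 0) *: an (ord_max, (n - q)%N)).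

Definition cst n : P1 := Fps (fun q =>
  (if q == n.+1 then - (-1) ^+ n.+1 else 0) *: (1 : E)).

Lemma cstC n (f : P2) : fpsC (cst n) * f = f * fpsC (cst n).
Proof.
apply: fpsP => p; apply: fpsP => q; rewrite fpsCM fpsMC !fpsM.
rewrite [RHS](reindex_inj rev_ord_inj) /=; apply: eq_bigr => i _.
rewrite subSS subKn; last by rewrite -ltnS ltn_ord.
by rewrite endoZl endoZr mul1r mulr1.
Qed.

Lemma bin_trinomial n q j : (j <= q)%N -> (q <= n)%N ->
  ('C(n, j) * 'C(n - j, q - j) = 'C(n, q) * 'C(q, j))%N.
Proof.
move=> lejq leqn; have lejn := leq_trans lejq leqn.
apply/eqP; rewrite -(eqn_pmul2r (fact_gt0 j)) -(eqn_pmul2r (fact_gt0 (q - j))).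
rewrite -(eqn_pmul2r (fact_gt0 (n - q))).
have e1 := bin_fact lejn; have e2 := bin_fact lejq; have e3 := bin_fact leqn.
have e4 : ('C(n - j, q - j) * ((q - j)`! * (n - q)`!) = (n - j)`!)%N.
  by have := @bin_fact (n - j) (q - j) (leq_sub2r _ leqn); rewrite subnBA // subnK.
apply/eqP; transitivity n`!; first by rewrite -e1 -e4; ring.
by rewrite -e3 -e2; ring.
Qed.

(** The scalar [D n j, Sm p m]. *)
Definition kappa n p j m : K :=
  if (p + m)%N is s.+1 then
    (- ('C(s.+1, m)%:R * (- (3 / 4)) ^+ m / s.+1%:R)) *
      ((j == 0%N)%:R * (if n == s then n.+1%:R else 0)) +
    ('C(s.+1, m)%:R * (1 / 4) ^+ m / s.+1%:R) *
      ((if (j <= n)%N then (-1) ^+ j * 'C(n.+1, j)%:R else 0) *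
        (if (n - j)%N == s then (n - j).+1%:R else 0))
  else 0.

Lemma comm_lin2 (A B C0 C1 : E) (a b x y u v : K) :
  A * C0 = C0 * A + u *: (1 : E) -> A * C1 = C1 * A -> B * C0 = C0 * B ->
  B * C1 = C1 * B + v *: (1 : E) ->
  (a *: A + b *: B) * (x *: C0 + y *: C1) =
  (x *: C0 + y *: C1) * (a *: A + b *: B) + (x * (a * u) + y * (b * v)) *: (1 : E).
Proof.
move=> h00 h01 h10 h11; rewrite !mulrDl !mulrDr !endoZl !endoZr h00 h01 h10 h11.
rewrite !scalerDr !scalerA scalerDl.
rewrite [b * y * v]mulrAC [a * x * u]mulrAC ![_ * x]mulrC ![_ * y]mulrC !mulrA.
set t1 := _ *: (C0 * A); set t2 := _ *: (_ : E); set t3 := _ *: (C1 * A).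
set t4 := _ *: (C0 * B); set t5 := _ *: (C1 * B); set t6 := _ *: (_ : E).
have ac (M : nmodType) (x1 x2 x3 x4 x5 x6 : M) :
    x1 + x2 + x3 + (x4 + (x5 + x6)) = x1 + x4 + (x3 + x5) + (x2 + x6).
  by rewrite !addrA [LHS](ACl ((1*4)*3*5*2*6)).
exact: ac.
Qed.

Lemma D_Sm_comm n p j m :
  D n j * Sm p m = Sm p m * D n j + kappa n p j m *: (1 : E).
Proof.
rewrite /kappa /Sm /D /=; case: (p + m)%N => [|s].
  by rewrite mulr0 mul0r add0r scale0r.
apply: comm_lin2; rewrite an_cr xpair_eqE ?eqxx //= scale0r addr0 //.
Qed.

(** The contributions of a_1 and a_2 cancel because (1/4 - 1)^q = (-3/4)^q, except
    that D lacks the term of index n + 1 of that expansion, which has no mode. *)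
Lemma sum_kappa n p q : \sum_(j < q.+1) kappa n p j (q - j) =
  if (p == 0%N) && (q == n.+1) then - (-1) ^+ n.+1 else 0.
Proof.
have [pq|pq] := eqVneq (p + q)%N n.+1; last first.
  rewrite ifF; last by apply/negbTE/negP => /andP[/eqP p0 /eqP qn]; move: pq; rewrite p0 qn eqxx.
  apply: big1 => j _; rewrite /kappa; case pj: (p + (q - j))%N => [//|s].
  have := ltn_ord j; rewrite ltnS => lejq.
  rewrite (_ : (j == 0%N :> nat)%:R * _ = 0) ?mulr0 ?add0r; last first.
    case: eqP => [j0|_]; last by rewrite mul0r.
    by rewrite ifF ?mulr0 //; apply/eqP; lia.
  case: leqP => [lejn|_]; last by rewrite mul0r mulr0.
  by rewrite ifF ?mulr0 //; apply/eqP; lia.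
pose t j : K := 'C(n.+1, q)%:R * ((1 / 4) ^+ (q - j) * (-1) ^+ j *+ 'C(q, j)).
have leq : (q <= n.+1)%N by lia.
have kE (j : 'I_q.+1) : kappa n p j (q - j) =
    (if j == 0%N :> nat then - ('C(n.+1, q)%:R * (- (3 / 4)) ^+ q) else 0) +
    (if (j <= n)%N then t j else 0).
  have := ltn_ord j; rewrite ltnS => lejq; rewrite /kappa.
  case pj: (p + (q - j))%N => [|s].
    have jn : (j = n.+1 :> nat) by lia.
    by rewrite jn ltnn addr0.
  have nz : s.+1%:R != 0 :> K by rewrite pnatr_eq0.
  congr (_ + _).
    case: eqP => [j0|_]; last by rewrite mul0r mulr0.
    have -> : s = n by lia.
    by rewrite j0 subn0 eqxx mul1r mulNr divfK // pnatr_eq0.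
  case: leqP => lejn; last by rewrite mul0r mulr0.
  have -> : s = (n - j)%N by lia.
  have bt := congr1 (fun m => m%:R : K) (bin_trinomial lejq leq).
  rewrite /= !natrM in bt; rewrite eqxx /t -subSn // -mulr_natr.
  transitivity ('C(n.+1, j)%:R * 'C(n.+1 - j, q - j)%:R * ((1 / 4) ^+ (q - j) * (-1) ^+ j) : K).
    have nz' : (n.+1 - j)%:R != 0 :> K by rewrite pnatr_eq0; lia.
    by field.
  by rewrite bt; ring.
rewrite (eq_bigr _ (fun j _ => kE j)) big_split /= big_ord_recl /= [X in _ + X + _]big1 // addr0.
have full : \sum_(j < q.+1) t j = 'C(n.+1, q)%:R * (- (3 / 4)) ^+ q.
  rewrite -mulr_sumr -exprDn; congr (_ * _ ^+ _); by field.
have [lqn|ltnq] := leqP q n.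
  rewrite ifF; last by apply/negbTE/negP => /andP[_ /eqP]; lia.
  rewrite (eq_bigr (fun j : 'I_q.+1 => t j)) ?full ?addNr // => j _.
  by rewrite ifT // (leq_trans _ lqn) // -ltnS ltn_ord.
have qn : q = n.+1 by lia.
have -> : (p == 0%N) && (q == n.+1) by lia.
have tn : t n.+1 = (-1) ^+ n.+1 by rewrite /t qn subnn !binn !mul1r mulr1n.
have -> : \sum_(j < q.+1) (if (j <= n)%N then t j else 0) = \sum_(j < n.+1) t j.
  rewrite qn big_ord_recr /= ltnn addr0; apply: eq_bigr => j _.
  by rewrite ifT // -ltnS ltn_ord.
by rewrite -full qn big_ord_recr /= tn opprD addrAC addNr add0r.
Qed.

Lemma D_Sm n : fpsC (D n) * Sm = Sm * fpsC (D n) + fpsC (cst n).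
Proof.
apply: fpsP => p; apply: fpsP => q; rewrite fpsD fpsCM fpsMC ?fpsD !fpsM.
rewrite [X in _ = X + _](reindex_inj rev_ord_inj) /=.
rewrite (eq_bigr (fun j : 'I_q.+1 =>
  Sm p (q - j)%N * D n j + kappa n p j (q - j) *: (1 : E))); last first.
  by move=> j _; apply: D_Sm_comm.
rewrite big_split /= -scaler_suml sum_kappa; congr (_ + _).
  apply: eq_bigr => j _; rewrite subSS subKn //.
  by rewrite -ltnS ltn_ord.
rewrite /fpsC /cst; case: (p == 0%N) => /=; last by rewrite scale0r.
by [].
Qed.

Lemma D_Sp n : fpsC (D n) * Sp = Sp * fpsC (D n).
Proof.
apply: fpsP => p; apply: fpsP => q; rewrite fpsCM fpsMC !fpsM.
rewrite [RHS](reindex_inj rev_ord_inj) /=; apply: eq_bigr => j _.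
rewrite subSS subKn; last by rewrite -ltnS ltn_ord.
case: (p - (q - j))%N => [|r]; first by rewrite mulr0 mul0r.
rewrite !endoZl !endoZr; congr (_ *: _).
have anC x y z c d : (c *: an x + d *: an y) * an z = an z * (c *: an x + d *: an y).
  by rewrite mulrDl mulrDr !endoZl !endoZr ![_ * an z]an_an.
by rewrite mulrBr mulrBl !anC.
Qed.

Lemma D_Em n : fpsC (D n) * Em = Em * fpsC (D n) + fpsC (cst n) * Em.
Proof. exact: exp_inner (Sm00 W) (D_Sm n) (cstC n _). Qed.

Lemma D_Ep n : fpsC (D n) * Ep = Ep * fpsC (D n).
Proof. exact: expf_comm (Sp00 W) (D_Sp n). Qed.

Lemma Em0_invP : fpsC (Em 0%N) * Em0_inv W = 1 /\ Em0_inv W * fpsC (Em 0%N) = 1.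
Proof. by split; [apply: neumannVr|apply: neumannVl]; exact: Em00. Qed.

(** The constant by which D fails to commute with E^-(u) cancels against the one
    coming from E^-(0)^{-1}. *)
Lemma D_Hf n : fpsC (D n) * Hf = Hf * fpsC (D n).
Proof.
have [fs sf] := Em0_invP; set f := fpsC _ in fs sf; set x := fpsC (D n).
set c := fpsC (cst n).
have xf : x * f = f * x + c * f.
  have := congr1 (fun g : P2 => fpsC (g 0%N)) (D_Em n).
  by rewrite fpsD !fpsCM fpsMC !fpsC_D !fpsC_M.
have xs : x * Em0_inv W = Em0_inv W * x - c * Em0_inv W.
  have : Em0_inv W * (x * f) * Em0_inv W = Em0_inv W * (f * x + c * f) * Em0_inv W by rewrite xf.
  rewrite -!mulrA fs mulr1 mulrDl mulrDr !mulrA sf mul1r -(cstC n (Em0_inv W)) -!mulrA.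
  by rewrite fs mulr1 => ->; rewrite addrK.
rewrite /Hf mulrA xs mulrBl -[Em0_inv W * x * _]mulrA D_Em -/x -/c.
by rewrite mulrDr !mulrA -(cstC n (Em0_inv W)) addrK.
Qed.

(** Translations of the weight and projections onto weight spaces satisfy the
    hypotheses below. *)
Section CommuteModes.
Variables (e : E).
Hypotheses (e_cr : forall x, e * cr x = cr x * e).
Hypotheses (e_an : forall x, e * an x = an x * e).

Let C (f : P2) := fpsC (fpsC e) * f = f * fpsC (fpsC e).

Let linC (c d : K) (x y : E) : e * x = x * e -> e * y = y * e ->
  e * (c *: x + d *: y) = (c *: x + d *: y) * e.
Proof. by move=> ex ey; rewrite mulrDl mulrDr !endoZl !endoZr ex ey. Qed.

Let C_Em : C Em.
Proof.
apply: expf_comm (Sm00 W) _; apply: fpsP => p; apply: fpsP => q.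
rewrite !fpsCM !fpsMC /Sm /=; case: (p + q)%N => [|r]; first by rewrite mulr0 mul0r.
exact: linC (e_cr _) (e_cr _).
Qed.

Let C_Ep : C Ep.
Proof.
apply: expf_comm (Sp00 W) _; apply: fpsP => p; apply: fpsP => q.
rewrite !fpsCM !fpsMC /Sp /=; case: (p - q)%N => [|r]; first by rewrite mulr0 mul0r.
by rewrite !endoZl !endoZr mulrBl mulrBr !e_an.
Qed.

Let C_Hf : C Hf.
Proof.
have [fs sf] := Em0_invP; set f := fpsC _ in fs sf; set x := fpsC (fpsC e).
have xf : x * f = f * x.
  have := congr1 (fun g : P2 => fpsC (g 0%N)) C_Em.
  by rewrite !fpsCM fpsMC !fpsC_M.
have xs : x * Em0_inv W = Em0_inv W * x.
  have : Em0_inv W * (x * f) * Em0_inv W = Em0_inv W * (f * x) * Em0_inv W by rewrite xf.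
  by rewrite -!mulrA fs mulr1 !mulrA sf mul1r => ->.
by rewrite /C /Hf mulrA xs -!mulrA C_Em.
Qed.

Lemma Hf_comm p q : e * Hf p q = Hf p q * e.
Proof.
have := congr1 (fun g : P2 => g p q) C_Hf.
by rewrite !fpsCM !fpsMC.
Qed.
Lemma Ep_comm p q : e * Ep p q = Ep p q * e.
Proof.
have := congr1 (fun g : P2 => g p q) C_Ep.
by rewrite !fpsCM !fpsMC.
Qed.
Lemma D_comm n q : e * D n q = D n q * e.
Proof. exact: linC (e_an _) (e_an _). Qed.
End CommuteModes.

Lemma D_Hf1 n p : D n * Hf p = Hf p * D n.
Proof. by have := congr1 (fun g : P2 => g p) (D_Hf n); rewrite fpsCM fpsMC. Qed.
Lemma D_Ep1 n p : D n * Ep p = Ep p * D n.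
Proof. by have := congr1 (fun g : P2 => g p) (D_Ep n); rewrite fpsCM fpsMC. Qed.
End Charge.

(** * Modes acting on power series in h *)

Section Fspace.
Variables (K : numFieldType) (W : fock K).
Local Notation E := (endo W).
Local Notation P1 := (fps E).
Local Notation P2 := (fps P1).
Local Notation Hf := (Hf W).
Local Notation Ep := (Ep W).

Definition gF := nat -> W.
Implicit Types (v : gF) (w : weight) (f g : P1).

Definition act f v : gF := fun n => \sum_(q < n.+1) f q (v (n - q)%N).
Definition ewF (b : weight) v : gF := fun n => ew W b (v n).
Definition gmodeop (S : gseries W) (r : int) v : gF := fun n =>
  \sum_(q < n.+1) S (- r - 1) q (v (n - q)%N).
Definition gvac : gF := fun n => if n == 0%N then bas W (onecm _) 0 else 0.

Definition wtF w v := forall n, pw W w (v n) = v n.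

Lemma actM f g v : act (f * g) v = act f (act g v).
Proof.
apply/funext => n; rewrite /act.
under eq_bigr => q _ do rewrite fpsM endo_sum.
under [RHS]eq_bigr => q _ do rewrite endo_sumv.
rewrite (sum_triangle n (fun i j => f i (g j (v (n - i - j)%N)))).
apply: eq_bigr => t _; apply: eq_bigr => i _.
rewrite -subnDA subnKC //; by rewrite -ltnS ltn_ord.
Qed.

Lemma act_eq f v v' n : (forall m, (m <= n)%N -> v m = v' m) -> act f v n = act f v' n.
Proof. by move=> eqv; apply: eq_bigr => q _; rewrite eqv ?leq_subr. Qed.

Lemma act0 f n : act f (fun=> 0) n = 0.
Proof. by rewrite /act big1 // => q _; rewrite endo0v. Qed.

Lemma act_ewF b f v : (forall q, ew W b * f q = f q * ew W b) ->
  act f (ewF b v) = ewF b (act f v).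
Proof.
move=> fb; apply/funext => n; rewrite /act /ewF endo_sumv; apply: eq_bigr => q _.
by rewrite -!endoM fb.
Qed.

(** Truncation of E^-(0)^{-1} E^-(u) E^+(u), coefficient of u^s. *)
Definition trunc N (s : int) : P1 := \sum_(k < N) zc Hf (s + k%:Z) * Ep k.

Lemma trunc_comm (x : P1) N s : (forall p, x * Hf p = Hf p * x) ->
  (forall k, x * Ep k = Ep k * x) -> x * trunc N s = trunc N s * x.
Proof.
move=> xH xE; apply: commr_sum => k _; apply: commrM; last exact: xE.
rewrite /GRing.comm; case: (s + k%:Z) => m; first exact: xH.
by rewrite /= mulr0 mul0r.
Qed.

Lemma bound_ex v n : exists N, forall m, (m <= n)%N -> energy_lt N (v m).
Proof.
elim: n => [|n [N vN]].
  by have [N vN] := energy_lt_ex (v 0%N); exists N => m; rewrite leqn0 => /eqP ->.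
have [M vM] := energy_lt_ex (v n.+1); exists (maxn M N) => m.
rewrite leq_eqVlt ltnS => /orP[/eqP ->|/vN]; last exact: energy_lt_mono (leq_maxr _ _).
exact: energy_lt_mono (leq_maxl _ _) vM.
Qed.

(** On weight w and up to a given order in h, a mode of X~ is a finite sum of normally
    ordered terms. *)
Lemma gmodeop_trunc w v r n : wtF w v -> exists N, forall M, (N <= M)%N ->
  forall m, (m <= n)%N ->
    gmodeop (@gXt K W) r v m = act (trunc M (- r - 1 - w)) (ewF alpha v) m.
Proof.
move=> vw; have [N vN] := bound_ex v n; exists (N + n)%N => M leNM m le_mn.
apply: eq_bigr => q _; have leq : (q <= n)%N.
  by rewrite (leq_trans _ le_mn) // -ltnS ltn_ord.
have vNm : energy_lt (M - n) (v (m - q)%N).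
  apply: energy_lt_mono (vN _ _); first by lia.
  exact: leq_trans (leq_subr _ _) le_mn.
rewrite (gXt_E _ _ (vw _)) (dress_gu_normal (Q := n) (vw _) vNm) //.
by rewrite subnK; [rewrite /trunc /ewF fps_sum endo_sum|lia].
Qed.

Lemma gmodeop_wt w v r : wtF w v -> wtF (w + alpha) (gmodeop (@gXt K W) r v).
Proof.
move=> vw n; have [N /(_ N (leqnn N)) vN] := gmodeop_trunc r n vw; rewrite vN //.
rewrite /act endo_sumv; apply: eq_bigr => q _; apply: pw_comm; last exact: pw_ew.
set e := pw W _.
have ecr x : e * cr W x = cr W x * e by rewrite /e /pw cr_dg.
have ean x : e * an W x = an W x * e by rewrite /e /pw an_dg.
have eP1 (f : P1) : (forall i, e * f i = f i * e) -> fpsC e * f = f * fpsC e.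
  by move=> ef; apply: fpsP => i; rewrite fpsCM fpsMC.
have comm : fpsC e * trunc N (- r - 1 - w) = trunc N (- r - 1 - w) * fpsC e.
  by apply: trunc_comm => i; apply: eP1 => j; [apply: Hf_comm|apply: Ep_comm].
by move/(congr1 (fun f : P1 => f q)): comm; rewrite fpsCM fpsMC.
Qed.

(** The conditions that cut the spaces L_0 and L_1 out of the Fock space. The vertex
    operators preserve them because D commutes with both of their exponentials. *)
Definition neutral w v := wtF w v /\ forall j n, act (D W j) v n = 0.

Lemma neutral_xt w v r : neutral w v -> neutral (w + alpha) (gmodeop (@gXt K W) r v).
Proof.
move=> [vw vD]; split; first exact: gmodeop_wt.
move=> j n; have [N /(_ N (leqnn N)) vN] := gmodeop_trunc r n vw.
rewrite (act_eq _ vN) -actM trunc_comm; last first.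
- by move=> k; apply: D_Ep1.
- by move=> p; apply: D_Hf1.
rewrite actM act_ewF; last first.
  by move=> q; apply: D_comm => x; rewrite an_ew.
rewrite (@act_eq _ _ (fun=> 0)) ?act0 // => m _.
by rewrite /ewF vD endo0v.
Qed.

(** The factor (1 + h/u)^{d_{alpha/2}} is a power of 1 + h/u on each weight space,
    so that modes of X are combinations of modes of X~ with coefficients in h. *)
Lemma gX_sum w v r n : wtF w v -> gmodeop (@gX K W) r v n =
  \sum_(l < n.+1) gbin (w%:~R / 2) l *: gmodeop (@gXt K W) (r - l%:Z) v (n - l)%N.
Proof.
move=> vw; rewrite /gmodeop.
pose G q l := gbin (w%:~R / 2) l *: dress (@gu K W) (- r - 1 + l%:Z) q (v (n - q - l)%N).
under eq_bigr => q _ do rewrite (gX_E _ _ (vw _)).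
transitivity (\sum_(l < n.+1) \sum_(q < (n - l).+1) G q l); last first.
  apply: eq_bigr => l _; rewrite scaler_sumr; apply: eq_bigr => q _.
  have e1 : - (r - l%:Z) - 1 = - r - 1 + l%:Z by lia.
  have e2 : (n - l - q = n - q - l)%N by lia.
  by rewrite (gXt_E _ _ (vw _)) /G e1 e2.
rewrite (sum_triangle n (fun l q => G q l)).
apply: eq_bigr => q _; apply: eq_bigr => l _; rewrite /G.
have -> : (n - (q - l) - l = n - q)%N by have := ltn_ord l; lia.
by [].
Qed.

Lemma neutral_x w v r : neutral w v -> neutral (w + alpha) (gmodeop (@gX K W) r v).
Proof.
move=> vinv; have [vw vD] := vinv; split=> [n|j n].
  rewrite (gX_sum _ _ vw) endo_sumv; apply: eq_bigr => l _.
  by rewrite endoZv (gmodeop_wt _ vw).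
have invt s := (neutral_xt s vinv).2 j.
pose x l := gmodeop (@gXt K W) (r - l%:Z) v.
pose G q l := gbin (w%:~R / 2) l *: D W j q (x l (n - q - l)%N).
transitivity (\sum_(q < n.+1) \sum_(l < (n - q).+1) G q l).
  apply: eq_bigr => q _; rewrite (gX_sum _ _ vw) endo_sumv.
  by apply: eq_bigr => l _; rewrite endoZv.
rewrite (exchange_triangle n G) big1 // => l _.
rewrite -scaler_sumr.
have -> : \sum_(q < (n - l).+1) D W j q (x l (n - q - l)%N) = act (D W j) (x l) (n - l)%N.
  apply: eq_bigr => q _; have -> : (n - q - l = n - l - q)%N by lia.
  by [].
by rewrite invt scaler0.
Qed.

Lemma neutral_ew b w v : neutral w v -> neutral (w + b) (ewF b v).
Proof.
move=> [vw vD]; split=> [n|j n]; first exact: pw_ew.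
rewrite act_ewF; first by rewrite /ewF vD endo0v.
by move=> q; apply: D_comm => x; rewrite an_ew.
Qed.

Lemma an_vac x w : an W x (bas W (onecm _) w) = 0.
Proof. by rewrite anU onecmE muln0 scale0r. Qed.

Lemma neutral_vac : neutral 0 gvac.
Proof.
split=> [n|j n].
  rewrite /gvac; case: (n == 0%N); last by rewrite endo0v.
  by rewrite /pw dgU eqxx scale1r.
rewrite /act big1 // => q _; rewrite /gvac; case: (n - q == 0)%N; last by rewrite endo0v.
by rewrite /D /= !an_vac !scaler0 addr0.
Qed.

(** A mode depends on the weight only by a shift of its index, and e^alpha raises
    the weight by 2. *)
Lemma gmodeop_shift w v r : wtF w v ->
  gmodeop (@gXt K W) r (ewF alpha v) = ewF alpha (gmodeop (@gXt K W) (r + alpha) v).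
Proof.
move=> vw; apply/funext => n; have vw' : wtF (w + alpha) (ewF alpha v).
  by move=> m; apply: pw_ew.
have [N vN] := bound_ex v n.
rewrite /ewF /gmodeop endo_sumv; apply: eq_bigr => q _.
have leq : (q <= n)%N by rewrite -ltnS ltn_ord.
rewrite !(gXt_E _ _ (vw _), gXt_E _ _ (vw' _)).
have vNq := vN _ (leq_subr q n).
rewrite (dress_gu_normal (Q := n) (vw' _) (energy_lt_ew _ vNq)) //.
rewrite (dress_gu_normal (Q := n) (vw _) vNq) // endo_sumv.
apply: eq_bigr => k _; rewrite -[in RHS]endoM.
have -> : - r - 1 - (w + alpha) + k%:Z = - (r + alpha) - 1 - w + k%:Z by ring.
have eC : ew W alpha * (zc Hf (- (r + alpha) - 1 - w + k%:Z) * Ep k) q =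
          (zc Hf (- (r + alpha) - 1 - w + k%:Z) * Ep k) q * ew W alpha.
  have eH p i : ew W alpha * Hf p i = Hf p i * ew W alpha.
    by apply: Hf_comm => x; rewrite ?cr_ew ?an_ew.
  have eE p i : ew W alpha * Ep p i = Ep p i * ew W alpha.
    by apply: Ep_comm => x; rewrite ?cr_ew ?an_ew.
  rewrite !fpsM; apply: commr_sum => i _; apply: commrM; last exact: eE.
  case: (_ + _) => m; [exact: eH|exact: commr0].
by rewrite eC endoM.
Qed.

Lemma Ep_vac k q w : Ep k q (bas W (onecm _) w) =
  if (k == 0%N) && (q == 0%N) then bas W (onecm _) w else 0.
Proof.
have SpV i j : Sp W i j (bas W (onecm _) w) = 0.
  rewrite /Sp /=; case: (i - j)%N => [|r] //.
  by rewrite endoZ endoB !an_vac subr0 scaler0.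
have XV n i j : (Sp W ^+ n.+1) i j (bas W (onecm _) w) = 0.
  rewrite exprSr fpsM fps_sum endo_sum big1 // => i' _.
  by rewrite fpsM endo_sum big1 // => j' _; rewrite endoM SpV endo0v.
rewrite /Ep /= /expsum !fps_sum endo_sum big_ord_recl big1 ?addr0 => [|n _]; last first.
  by rewrite scE endoZ XV scaler0.
rewrite scE fact0 invr1 scale1r expr0.
by case: k => [|k]; case: q => [|q].
Qed.

Lemma Hf0 q : Hf 0%N q = (q == 0%N)%:R.
Proof.
have [_ sf] := Em0_invP W.
have := congr1 (fun g : P2 => g 0%N q) sf.
by rewrite fpsMC => e; rewrite /Hf fpsM big_ord1 subn0 e; case: q {e}.
Qed.

Lemma mul_Ep_vac (f : P1) k n w : (f * Ep k) n (bas W (onecm _) w) =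
  if k == 0%N then f n (bas W (onecm _) w) else 0.
Proof.
rewrite fpsM endo_sum.
rewrite (@big_ord_last _ n (fun i => (f i * Ep k (n - i)%N) _)) => [|i lt_in].
  by rewrite endoM Ep_vac subnn eqxx andbT; case: ifP => // _; apply: endo0v.
by rewrite endoM Ep_vac subn_eq0 leqNgt lt_in andbF; apply: endo0v.
Qed.

(** E^+ fixes the vacuum and E^-(0)^{-1} E^-(u) is 1 at u = 0. *)
Lemma gmodeop_vac : gmodeop (@gXt K W) (- 1) gvac = ewF alpha gvac.
Proof.
have vw := neutral_vac.1; apply/funext => n.
have [N /(_ N.+1 (leqnSn N)) vN] := gmodeop_trunc (- 1) n vw; rewrite vN // /act.
rewrite (@big_ord_last _ n (fun q => trunc _ _ q (ewF _ _ (n - q)%N))); last first.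
  move=> q lt_qn; rewrite /ewF /gvac subn_eq0 leqNgt lt_qn /=.
  by rewrite !endo0v.
rewrite subnn /ewF {1}/gvac eqxx ewU /trunc fps_sum endo_sum.
rewrite (@big_ord_first _ N (fun k => (zc Hf (- -1 - 1 - 0 + k%:Z) * Ep k) n _)) => [|k].
  rewrite mul_Ep_vac eqxx subr0 addr0 opprK subrr -[zc Hf 0]/(Hf 0%N) Hf0 /gvac.
  by case: n {vN} => [|n]; [rewrite eqxx ewU|rewrite endo0v].
by rewrite mul_Ep_vac.
Qed.

(** Modulo h, with these coefficients, the modes of X and X~ are those of the lattice
    vertex operator attached to alpha. *)
Definition Hop (i : int) : E := zc Hf i 0%N.
Definition Gop (k : nat) : E := Ep k 0%N.

Lemma gmodeopt_mod_h w v r : wtF w v -> exists N, forall M, (N <= M)%N ->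
  gmodeop (@gXt K W) r v 0%N =
  \sum_(k < M) Hop (- r - 1 - w + k%:Z) (Gop k (ew W alpha (v 0%N))).
Proof.
move=> vw; have [N vN] := gmodeop_trunc r 0 vw; exists N => M leNM.
rewrite (vN M) // /act big_ord1 subnn fps_sum endo_sum.
by apply: eq_bigr => k _; rewrite fpsM big_ord1 subnn.
Qed.

Lemma gmodeop_mod_h w v r : wtF w v ->
  gmodeop (@gX K W) r v 0%N = gmodeop (@gXt K W) r v 0%N.
Proof.
by move=> vw; rewrite (gX_sum _ _ vw) big_ord1 gbin0 scale1r subr0 subnn.
Qed.

End Fspace.

(** * Relations between the modes modulo h *)

Section Heisenberg.
Variables (K : numFieldType) (W : fock K).
Local Notation E := (endo W).
Local Notation P1 := (fps E).
Local Notation P2 := (fps P1).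
Local Notation cr := (cr W).
Local Notation an := (an W).
Local Notation H := (Hop W).
Local Notation G := (Gop W).

Definition bop r : E := cr (ord_max, r) - cr (ord0, r).
Definition alph r : E := an (ord0, r) - an (ord_max, r).

Lemma fps_comm (R : pzRingType) (f g : fps R) :
  (forall i j, f i * g j = g j * f i) -> f * g = g * f.
Proof.
move=> fg; apply: fpsP => n; rewrite !fpsM [RHS](reindex_inj rev_ord_inj) /=.
apply: eq_bigr => i _; rewrite fg subSS subKn //.
by rewrite -ltnS ltn_ord.
Qed.

Lemma Hnat (n : nat) : H n%:Z = Em W n 0%N.
Proof.
have f0 p : (1 - fpsC (Em W 0%N)) p 0%N = 0.
  rewrite !fpsB; case: p => [|p]; last by rewrite subr0.
  have -> : fpsC (Em W 0%N) 0%N 0%N = 1 by exact: Em00.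
  by rewrite subrr.
have sigE p : Em0_inv W p 0%N = (p == 0%N)%:R.
  rewrite /Em0_inv /neumann /= /geosum !fps_sum big_ord_recl big1 => [|k _].
    by rewrite addr0 expr0; case: p.
  by rewrite exprS fpsM fps_sum big1 // => i _; rewrite fpsM big_ord1 f0 mul0r.
rewrite /Hop /= fps_sum (@big_ord_first _ n (fun i => (Em0_inv W i * Em W (n - i)%N) 0%N)).
  by rewrite fpsM big_ord1 sigE mul1r subn0.
by move=> i; rewrite fpsM big_ord1 sigE mul0r.
Qed.

Lemma Hneg (n : nat) : H (Negz n) = 0. Proof. by []. Qed.
Lemma Hneg_lt (i : int) : i < 0 -> H i = 0. Proof. by case: i. Qed.
Lemma H0 : H 0 = 1. Proof. by rewrite Hnat Em00. Qed.
Lemma G0 : G 0 = 1.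
Proof. by rewrite /Gop /Ep /= /expsum big_ord1 scE expr0 fact0 invr1 scale1r. Qed.

Lemma endo_commZ c (x y : E) : GRing.comm x y -> GRing.comm x (c *: y).
Proof. by move=> xy; rewrite /GRing.comm endoZl endoZr xy. Qed.

Lemma Sm_comm : Fps (fun p => Sm W p *+ p) * Sm W = Sm W * Fps (fun p => Sm W p *+ p).
Proof.
have cC (c d c' d' : K) x y x' y' : GRing.comm (c *: cr x + d *: cr y) (c' *: cr x' + d' *: cr y').
  by apply: commrD; apply: endo_commZ; apply: commr_sym; apply: commrD;
     apply: endo_commZ; apply: cr_cr.
apply: fps_comm => i j; change (Sm W i *+ i * Sm W j = Sm W j * (Sm W i *+ i)).
rewrite mulrnAl mulrnAr; congr (_ *+ _).
apply: fps_comm => i' j'; rewrite /Sm /=; case: (i + i')%N => [|r].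
  by rewrite mul0r mulr0.
case: (j + j')%N => [|s]; [by rewrite mul0r mulr0|exact: cC].
Qed.

Lemma Sp_comm : Fps (fun p => Sp W p *+ p) * Sp W = Sp W * Fps (fun p => Sp W p *+ p).
Proof.
have cC (c c' : K) r s : GRing.comm (c *: (an (ord0, r) - an (ord_max, r)))
                                    (c' *: (an (ord0, s) - an (ord_max, s))).
  by apply: endo_commZ; apply: commr_sym; apply: endo_commZ; apply: commrB;
     apply: commr_sym; apply: commrB; apply: an_an.
apply: fps_comm => i j; change (Sp W i *+ i * Sp W j = Sp W j * (Sp W i *+ i)).
rewrite mulrnAl mulrnAr; congr (_ *+ _).
apply: fps_comm => i' j'; rewrite /Sp /=; case: (i - i')%N => [|r].
  by rewrite mul0r mulr0.
case: (j - j')%N => [|s]; [by rewrite mul0r mulr0|exact: cC].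
Qed.

Lemma endoMnZ (x : E) n : x *+ n = n%:R *: x.
Proof. by apply: endoP => v; rewrite endoMn endoZ scaler_nat. Qed.

Lemma endo_mulIn n : injective (fun x : E => x *+ n.+1).
Proof.
move=> x y eqxy; apply: endoP => v.
have := congr1 (fun e : E => n.+1%:R^-1 *: e v) eqxy.
by rewrite /= !endoMn -!scaler_nat !scalerA mulVf ?scale1r // pnatr_eq0.
Qed.

(** Modulo h the exponent of E^- is the sum of bop r u^(r+1) / (r+1), and E^-(0) = 1. *)
Lemma H_rec n : H n%:Z *+ n = \sum_(r < n) bop r * H (n%:Z - r.+1%:Z).
Proof.
rewrite Hnat (exp_euler _ _ (Sm00 W) Sm_comm).
rewrite (big_ord_shift n (fun i => ((Sm W i *+ i) * Em W (n - i)%N) 0%N)).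
rewrite mulr0n mul0r add0r; apply: eq_bigr => r _; rewrite fpsM big_ord1 fpsMn.
have ltr := ltn_ord r.
have -> : n%:Z - r.+1%:Z = (n - r.+1)%N%:Z by lia.
rewrite Hnat; congr (_ * _); rewrite /Sm /= addn0 !bin0 !expr0 !mulr1.
rewrite endoMnZ scalerDr !scalerA mulrN !mul1r divff ?pnatr_eq0 //.
by apply: endoP => v; rewrite endoD !endoZ scale1r scaleN1r addrC.
Qed.

Lemma G_rec n : G n *+ n = \sum_(r < n) alph r * G (n - r.+1).
Proof.
rewrite /Gop (exp_euler _ _ (Sp00 W) Sp_comm).
rewrite (big_ord_shift n (fun i => ((Sp W i *+ i) * Ep W (n - i)%N) 0%N)).
rewrite mulr0n mul0r add0r; apply: eq_bigr => r _; rewrite fpsM big_ord1 fpsMn.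
congr (_ * _); rewrite /Sp /= gbin0 expr0 mulr1.
by rewrite endoMnZ scalerA mul1r divff ?pnatr_eq0 // scale1r.
Qed.

Lemma bop_comm r s : bop r * bop s = bop s * bop r.
Proof.
apply: commrB; apply: commr_sym; apply: commrB; exact: cr_cr.
Qed.

Lemma alph_bop r s :
  alph r * bop s = bop s * alph r - (if r == s then (r.+1 * 2)%:R else 0) *: (1 : E).
Proof.
have cr_an x y : x != y -> an x * cr y = cr y * an x.
  by move=> /negPf neq; rewrite an_cr neq scale0r addr0.
have eqE (i : 'I_2) : an (i, r) * cr (i, s) = cr (i, s) * an (i, r) +
    (if r == s then r.+1%:R else 0) *: (1 : E).
  by rewrite an_cr xpair_eqE eqxx.
rewrite /alph /bop !mulrBl !mulrBr !eqE (cr_an (ord0, r)) // (cr_an (ord_max, r)) //.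
set t := (if _ then r.+1%:R else 0) *: (1 : E).
have -> : (if r == s then (r.+1 * 2)%:R else 0) *: (1 : E) = t + t.
  by rewrite /t -scalerDl; case: (r == s); rewrite ?addr0 // muln2 -addnn natrD.
have ac (M : zmodType) (x y z u w : M) :
    x - (y + w) - (z + w - u) = x - z - (y - u) - (w + w).
  by rewrite !opprD !opprK !addrA [LHS](ACl (1*4*2*6*3*5)).
exact: ac.
Qed.

Lemma bop_H r l : bop r * H l = H l * bop r.
Proof.
case: l => [l|l]; last by rewrite mulr0 mul0r.
elim/ltn_ind: l => -[|l] IHl; first by rewrite H0 mulr1 mul1r.
apply: (@endo_mulIn l); rewrite /= -mulrnAr -mulrnAl H_rec mulr_sumr mulr_suml.
apply: eq_bigr => s _; have lts := ltn_ord s.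
have -> : l.+1%:Z - s.+1%:Z = (l - s)%N%:Z by lia.
by rewrite mulrA bop_comm -mulrA IHl ?mulrA //; lia.
Qed.

Lemma H_comm k l : H k * H l = H l * H k.
Proof.
case: k => [k|k]; last by rewrite mulr0 mul0r.
elim/ltn_ind: k => -[|k] IHk; first by rewrite H0 mulr1 mul1r.
apply: (@endo_mulIn k); rewrite /= -mulrnAl -mulrnAr H_rec mulr_sumr mulr_suml.
apply: eq_bigr => s _; have lts := ltn_ord s.
have -> : k.+1%:Z - s.+1%:Z = (k - s)%N%:Z by lia.
by rewrite -mulrA IHk ?mulrA ?bop_H //; lia.
Qed.

Lemma H_rec_int N (l : int) : l <= N%:Z ->
  \sum_(s < N) bop s * H (l - s.+1%:Z) = if l is Posz n then H l *+ n else 0.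
Proof.
case: l => l le_lN; last first.
  by rewrite big1 // => s _; rewrite Hneg_lt ?mulr0 //; lia.
rewrite H_rec (big_ord_widen N (fun s => bop s * H (l%:Z - s.+1%:Z)) (_ : l <= N)%N); last by lia.
rewrite [RHS]big_mkcond; apply: eq_bigr => s _; case: ltnP => // le_ls.
by rewrite Hneg_lt ?mulr0 //; lia.
Qed.

Lemma alph_H r (l : int) : alph r * H l = H l * alph r - H (l - r.+1%:Z) *+ 2.
Proof.
case: l => [l|l]; last first.
  by rewrite mulr0 mul0r Hneg_lt ?mul0rn ?subr0 //; lia.
elim/ltn_ind: l => -[|l] IHl.
  by rewrite H0 mulr1 mul1r Hneg_lt ?mul0rn ?subr0 //; lia.
apply: (@endo_mulIn l); rewrite /= -mulrnAr H_rec mulr_sumr.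
have step (s : 'I_l.+1) : alph r * (bop s * H (l.+1%:Z - s.+1%:Z)) =
    bop s * H (l.+1%:Z - s.+1%:Z) * alph r
    - (bop s * H (l.+1%:Z - r.+1%:Z - s.+1%:Z)) *+ 2
    - (if s == r :> nat then H (l.+1%:Z - r.+1%:Z) *+ (r.+1 * 2) else 0).
  have lts := ltn_ord s.
  rewrite mulrA alph_bop mulrBl -[X in X - _]mulrA.
  have -> : l.+1%:Z - s.+1%:Z = (l - s)%N%:Z by lia.
  rewrite IHl; last by lia.
  have -> : (l - s)%N%:Z - r.+1%:Z = l.+1%:Z - r.+1%:Z - s.+1%:Z by lia.
  rewrite mulrBr mulrnAr mulrA; congr (_ - _ - _).
  rewrite endoZl mul1r eq_sym; case: eqP => [eq_sr|_]; last by rewrite scale0r.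
  have -> : l.+1%:Z - r.+1%:Z = (l - s)%N%:Z by lia.
  by rewrite endoMnZ.
under eq_bigr => s _ do rewrite step.
rewrite !sumrB -mulr_suml -H_rec sumrMnl H_rec_int; last by lia.
rewrite -big_mkcond mulrnBl mulrnAl -addrA -opprD; congr (_ - _).
case: (leqP r l) => [le_rl|lt_lr].
  rewrite (big_pred1 (Ordinal (le_rl : (r < l.+1)%N))) //.
  have -> : l.+1%:Z - r.+1%:Z = (l - r)%N%:Z by lia.
  by rewrite -!mulrnA -mulrnDr; congr (_ *+ _); lia.
rewrite big_pred0 => [|s]; last by apply/negbTE; have := ltn_ord s; lia.
have -> : l.+1%:Z - r.+1%:Z = Negz (r - l).-1 by lia.
by rewrite Hneg !mul0rn addr0.
Qed.

Definition Gz (i : int) : E := match i with Posz n => G n | Negz _ => 0 end.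

Lemma Gz_lt (i : int) : i < 0 -> Gz i = 0. Proof. by case: i. Qed.

Lemma G_rec_int N (m : int) : m <= N%:Z ->
  \sum_(r < N) alph r * Gz (m - r.+1%:Z) = Gz m *~ m.
Proof.
case: m => m le_mN; last first.
  by rewrite mul0rz big1 // => s _; rewrite Gz_lt ?mulr0 //; lia.
rewrite -pmulrn [Gz _]/(G m) G_rec (big_ord_widen N (fun s => alph s * G (m - s.+1)) (_ : m <= N)%N); last by lia.
rewrite [RHS]big_mkcond; apply: eq_bigr => s _; case: ltnP => lts.
  have -> : m%:Z - s.+1%:Z = (m - s.+1)%N%:Z by lia.
  by [].
by rewrite Gz_lt ?mulr0 //; lia.
Qed.

Lemma telescope2 (M : zmodType) (y : nat -> M) n :
  \sum_(r < n) (y r.+1 - y r.+2 *+ 2 + y r.+3) = y 1%N - y 2%N - (y n.+1 - y n.+2).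
Proof.
elim: n => [|n IHn]; first by rewrite big_ord0 subrr.
rewrite big_ord_recr /= IHn opprB addrA mulr2n opprD !addrA.
by rewrite subrK addrK [in RHS]opprB addrA addrAC.
Qed.

Let ac_step (M : zmodType) (a b c y1 y2 y3 : M) :
  a - y1 *+ 2 - (b - y2 *+ 2) *+ 2 + (c - y3 *+ 2) =
  a - b *+ 2 + c - (y1 - y2 *+ 2 + y3) *+ 2.
Proof.
rewrite !mulrnDl !mulNrn !opprD !opprK !addrA.
by rewrite [LHS](ACl (1*4*5*10*2*3*6*7*8*9*11*12)).
Qed.

Let ac_end (M : zmodType) (a b c : M) i :
  a *+ i.+1 - b *+ i *+ 2 + (c *+ i - c) - (b - c) *+ 2 =
  (a - b *+ 2 + c) *+ i.+1.
Proof.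
rewrite !mulrnDl !mulNrn [b *+ 2 *+ _]mulrnAC [b *+ i.+1]mulrSr mulrnDl.
rewrite [c *+ i.+1]mulrSr [c *+ 2]mulr2n !opprD !opprK !addrA.
by rewrite [LHS](ACl (1*2*3*6*7*4*8*(5*9))) /= addNr addr0.
Qed.

(** The commutation E^+(u) H(v) = (1 - v/u)^2 H(v) E^+(u), coefficientwise. By
    induction on i through the recursion for i G(i): moving each alph r across H
    produces second differences, which telescope. *)
Lemma G_H (i l : int) : Gz i * H l =
  H l * Gz i - (H (l - 1) * Gz (i - 1)) *+ 2 + H (l - 2) * Gz (i - 2).
Proof.
case: i => [i|i]; last by rewrite !Gz_lt // !mulr0 mul0r mul0rn subr0 addr0.
elim/ltn_ind: i l => -[|i] IHi l.
  have -> : Gz 0 = 1 by exact: G0.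
  by rewrite !Gz_lt // !mulr0 mul0rn subr0 addr0 mulr1 mul1r.
pose y (k : nat) := H (l - k%:Z) * Gz (i.+1%:Z - k%:Z).
apply: (@endo_mulIn i); cbv beta.
have -> : Gz i.+1%:Z * H l *+ i.+1 = Gz i.+1%:Z *~ i.+1%:Z * H l.
  by rewrite -pmulrn mulrnAl.
rewrite -(@G_rec_int i.+1) // mulr_suml.
have step (r : 'I_i.+1) : alph r * Gz (i.+1%:Z - r.+1%:Z) * H l =
    H l * (alph r * Gz (i.+1%:Z - r.+1%:Z))
    - (H (l - 1) * (alph r * Gz (i%:Z - r.+1%:Z))) *+ 2
    + H (l - 2) * (alph r * Gz (i%:Z - 1 - r.+1%:Z))
    - (y r.+1 - y r.+2 *+ 2 + y r.+3) *+ 2.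
  have ltr := ltn_ord r; rewrite -mulrA.
  have -> : i.+1%:Z - r.+1%:Z = (i - r)%N%:Z by lia.
  rewrite IHi; last by lia.
  have -> : (i - r)%N%:Z - 1 = i%:Z - r.+1%:Z by lia.
  have -> : (i - r)%N%:Z - 2 = i%:Z - 1 - r.+1%:Z by lia.
  rewrite mulrDr mulrBr mulrnAr !mulrA !alph_H /y.
  have -> : l - 1 - r.+1%:Z = l - r.+2%:Z by lia.
  have -> : l - 2 - r.+1%:Z = l - r.+3%:Z by lia.
  have -> : i.+1%:Z - r.+1%:Z = (i - r)%N%:Z by lia.
  have -> : i.+1%:Z - r.+2%:Z = i%:Z - r.+1%:Z by lia.
  have -> : i.+1%:Z - r.+3%:Z = i%:Z - 1 - r.+1%:Z by lia.
  rewrite !mulrBl !mulrnAl; set b := H (l - 1) * _ * _; set c := H (l - 2) * _ * _.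
  set a := H l * _ * _; set y1 := _ * Gz _; set y2 := _ * Gz _; set y3 := _ * Gz _.
  exact: ac_step.
have tele : \sum_(r < i.+1) (y r.+1 - y r.+2 *+ 2 + y r.+3) *+ 2 = (y 1%N - y 2%N) *+ 2.
  rewrite sumrMnl (telescope2 y i.+1).
  have y0 k : (i.+1 < k)%N -> y k = 0 by move=> lt; rewrite /y Gz_lt ?mulr0 //; lia.
  by rewrite (y0 i.+2) ?(y0 i.+3) ?subr0 //; lia.
rewrite (eq_bigr _ (fun r _ => step r)) sumrB tele !big_split /= sumrN.
rewrite !sumrMnl -!mulr_sumr !G_rec_int; try lia.
rewrite !mulrzAr mulrzBr mulr1z -!pmulrn.
have -> : y 1%N = H (l - 1) * Gz (i.+1%:Z - 1) by [].
have -> : y 2%N = H (l - 2) * Gz (i.+1%:Z - 2) by [].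
have -> : i.+1%:Z - 1 = i%:Z by lia.
have -> : i.+1%:Z - 2 = i%:Z - 1 by lia.
rewrite subn1; exact: (ac_end (H l * Gz i.+1) (H (l - 1) * Gz i) (H (l - 2) * Gz (i%:Z - 1))  i).
Qed.

End Heisenberg.

(** * Spans and dominance of sequences *)

Section Span.
Variables (K : numFieldType) (V : lmodType K).
Implicit Types (B : V -> Prop) (u v : V).

Inductive kspan B : V -> Prop :=
| kspan0 : kspan B 0
| kspan_cons c b v of B b & kspan B v : kspan B (c *: b + v).

Lemma kspan_in B b : B b -> kspan B b.
Proof.
by move=> Bb; rewrite -[b]addr0 -[b]scale1r; apply: kspan_cons => //; apply: kspan0.
Qed.
Lemma kspanD B u v : kspan B u -> kspan B v -> kspan B (u + v).
Proof.
by elim=> [|c b u' Bb _ IHu] Bv; rewrite ?add0r // -addrA; apply: kspan_cons; auto.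
Qed.
Lemma kspanZ B c v : kspan B v -> kspan B (c *: v).
Proof.
elim=> [|d b v' Bb _ IHv]; first by rewrite scaler0; apply: kspan0.
by rewrite scalerDr scalerA; apply: kspan_cons.
Qed.
Lemma kspanN B v : kspan B v -> kspan B (- v).
Proof. by rewrite -scaleN1r; apply: kspanZ. Qed.
Lemma kspanB B u v : kspan B u -> kspan B v -> kspan B (u - v).
Proof. by move=> Bu Bv; apply/kspanD/kspanN. Qed.
Lemma kspanMn B v n : kspan B v -> kspan B (v *+ n).
Proof. by rewrite -scaler_nat; apply: kspanZ. Qed.
Lemma kspan_sum B (I : Type) (r : seq I) (P : pred I) (F : I -> V) :
  (forall i, P i -> kspan B (F i)) -> kspan B (\sum_(i <- r | P i) F i).
Proof. by move=> BF; elim/big_ind: _ => //; [apply: kspan0|apply: kspanD]. Qed.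
Lemma kspan_trans B B' v : (forall b, B b -> kspan B' b) -> kspan B v -> kspan B' v.
Proof.
move=> BB'; elim=> [|c b v' Bb _ IHv]; first exact: kspan0.
by apply: kspanD => //; apply/kspanZ/BB'.
Qed.
Lemma kspan_sub B B' v : (forall b, B b -> B' b) -> kspan B v -> kspan B' v.
Proof. by move=> BB'; apply: kspan_trans => b /BB'; apply: kspan_in. Qed.
Lemma kspan_endo B B' (f : endo V) v :
  (forall b, B b -> kspan B' (f b)) -> kspan B v -> kspan B' (f v).
Proof.
move=> BB'; elim=> [|c b v' Bb _ IHv]; first by rewrite endo0v; apply: kspan0.
by rewrite endoDv endoZv; apply: kspanD => //; apply/kspanZ/BB'.
Qed.
End Span.

Section Dominance.
Implicit Types (c x y : int) (s t u la : seq int).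

Definition sumz s : int := foldr +%R 0 s.
Definition sumsq s : int := foldr (fun x r => x ^+ 2 + r) 0 s.

(** For c = 0, the dominance order of sequences of the same length and sum; c is
    the excess of u over la in the terms already read. *)
Fixpoint dom c u la : Prop :=
  match u, la with
  | [::], [::] => c = 0
  | x :: u', y :: la' => 0 <= c + x - y /\ dom (c + x - y) u' la'
  | _, _ => False
  end.

Fixpoint below t s : Prop :=
  match t, s with
  | [::], [::] => True
  | x :: t', y :: s' => x <= y /\ below t' s'
  | _, _ => False
  end.

Lemma below_refl s : below s s.
Proof. by elim: s => //= x s ->. Qed.
Lemma below_sum t s : below t s -> sumz t <= sumz s.
Proof. by elim: t s => [|x t IHt] [|y s] //= [le_xy /IHt le_ts]; rewrite lerD. Qed.
Lemma below_sum_eq t s : below t s -> sumz t = sumz s -> t = s.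
Proof.
elim: t s => [|x t IHt] [|y s] //= [le_xy bts] eq_sum.
have le_ts := below_sum bts.
have eq_xy : x = y by lia.
by rewrite eq_xy (IHt s) //; lia.
Qed.

Lemma dom_refl s : dom 0 s s.
Proof. by elim: s => //= x s IHs; rewrite add0r subrr. Qed.
Lemma dom_sum c u la : dom c u la -> c + sumz u = sumz la.
Proof.
elim: u c la => [|x u IHu] c [|y la] //=; first by move=> ->.
by move=> [_ /IHu <-]; ring.
Qed.
Lemma dom_size c u la : dom c u la -> size u = size la.
Proof. by elim: u c la => [|x u IHu] c [|y la] //= [_ /IHu ->]. Qed.
Lemma dom_below c t s la : dom c s la -> below t s -> dom (c + sumz s - sumz t) t la.
Proof.
elim: s c t la => [|y s IHs] c [|x t] [|z la] //=.
  by move=> -> _; rewrite subrr.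
move=> [ge0 dsl] [le_xy bts]; have le_ts := below_sum bts; split; first by lia.
have := IHs _ _ _ dsl bts.
by have -> : c + y - z + sumz s - sumz t = c + (y + sumz s) - (x + sumz t) + x - z by ring.
Qed.

(** Strict dominance over a partition increases the sum of squares. In the induction
    an excess c is worth at most 2 c x, since it is to be spent on entries that
    replace entries at most x of la. *)
Lemma dom_sumsq x c u la : sorted >=%R (x :: la) -> all (fun y => 0 <= y) (x :: la) ->
  0 <= c -> dom c u la ->
  sumsq la + (u != la)%:R <= sumsq u + 2 * c * x.
Proof.
elim: u x c la => [|z u IHu] x c [|y la] //=.
  by move=> _ /andP[x_ge0 _] c_ge0 _; rewrite !add0r !mulr_ge0.
move=> /andP[le_yx la_sorted] /and3P[x_ge0 y_ge0 la_ge0] c_ge0 [ge0 dul].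
have /(IHu y) := dul; rewrite /= la_sorted y_ge0 la_ge0 => /(_ isT isT ge0) IH.
rewrite eqseq_cons negb_and.
have sq : 0 <= 2 * c * (x - y) by rewrite !mulr_ge0 ?subr_ge0.
have sq' : (z != y)%:R <= (z - y) ^+ 2 :> int.
  case: eqVneq => [->|neq]; first by rewrite subrr expr0n.
  by rewrite -gtz0_ge1 /= lt_def sqr_ge0 expf_neq0 ?subr_eq0.
move: IH sq sq'; case: (z != y); case: (u != la) => /= IH sq sq'; nia.
Qed.
End Dominance.

(** * Leading terms modulo h *)

Section Leading.
Variables (K : numFieldType) (W : fock K).
Local Notation E := (endo W).
Local Notation H := (Hop W).
Local Notation G := (Gop W).
Implicit Types (s t u la : seq int) (w mu : int) (v : W).

Definition vacw w : W := bas W (onecm _) w.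
Definition hh s w : W := foldr (fun i v => H i v) (vacw w) s.

Lemma hh_neg s w : has (fun x => x < 0) s -> hh s w = 0.
Proof.
elim: s => //= x s IHs /orP[x_lt0|/IHs ->]; last exact: endo0v.
by rewrite Hneg_lt.
Qed.

Lemma hh_swap x y s w : hh (x :: y :: s) w = hh (y :: x :: s) w.
Proof. by rewrite /= -!endoM H_comm. Qed.

Lemma hh_rot x t1 t2 w : hh (t1 ++ x :: t2) w = hh (x :: t1 ++ t2) w.
Proof. by elim: t1 => //= y t1 ->; rewrite /= -!endoM H_comm. Qed.

Lemma hh_perm s t w : perm_eq s t -> hh s w = hh t w.
Proof.
elim: s t => [|x s IHs] t; first by rewrite perm_sym => /perm_nilP ->.
move=> eq_st; have : x \in t by rewrite -(perm_mem eq_st) mem_head.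
move=> /[dup] xt; case/splitPr: t / xt eq_st => t1 t2 eq_st _.
rewrite hh_rot /= (IHs (t1 ++ t2)) // -(perm_cons x) (perm_trans eq_st) //.
by rewrite -[x :: t2]cat1s -[x :: t1 ++ t2]cat1s perm_catCA.
Qed.

Lemma ew_hh b s w : ew W b (hh s w) = hh s (w + b).
Proof.
elim: s => [|x s IHs] /=; first by rewrite /vacw ewU.
rewrite -IHs -!endoM /Hop; case: x => x; last by rewrite mulr0 mul0r.
by congr (efun _ _); apply: Hf_comm => y; rewrite ?cr_ew ?an_ew.
Qed.

(** The modes of X~ modulo h, truncated to M terms of E^+. *)
Definition Qn M mu : E := \sum_(k < M) H (mu + k%:Z) * G k.

(** Summing [G_H]: the factor (1 - v/u)^2 trades indices between Q and H. *)
Lemma Qn_H M mu x : Qn M.+2 mu * H x =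
  H x * Qn M.+2 mu - (H (x - 1) * Qn M.+1 (mu + 1)) *+ 2 + H (x - 2) * Qn M (mu + 2).
Proof.
have zK (n : nat) : Gz W n%:Z = G n by [].
rewrite /Qn mulr_suml.
under eq_bigr => k _ do rewrite -zK -mulrA G_H mulrDr mulrBr mulrnAr !mulrA H_comm
  ![H (mu + _) * _]H_comm.
rewrite big_split sumrB /= sumrMnl; congr (_ - _ *+ 2 + _).
- by rewrite mulr_sumr; apply: eq_bigr => k _; rewrite mulrA.
- rewrite (big_ord_shift M.+1 (fun k => H (x - 1) * H (mu + k%:Z) * Gz W (k%:Z - 1))).
  rewrite Gz_lt // mulr0 add0r mulr_sumr; apply: eq_bigr => k _.
  rewrite mulrA -zK; congr (_ * H _ * Gz W _); lia.
- pose y k := H (x - 2) * H (mu + k%:Z) * Gz W (k%:Z - 2).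
  rewrite (big_ord_shift M.+1 y) (big_ord_shift M (fun k => y k.+1)).
  rewrite {1 2}/y !Gz_lt // !mulr0 !add0r mulr_sumr; apply: eq_bigr => k _.
  rewrite mulrA -zK; congr (_ * H _ * Gz W _); lia.
Qed.

Lemma G_vacw k w : G k (vacw w) = if k == 0%N then vacw w else 0.
Proof. by rewrite /Gop Ep_vac andbT. Qed.

Definition lower_terms mu s w v :=
  exists t, [/\ below t s, t != s & v = hh (mu + sumz s - sumz t :: t) w].

(** Normal ordering raises the last index at the expense of the others. *)
Lemma Qn_hh M mu s w : (2 * size s < M)%N ->
  kspan (lower_terms mu s w) (Qn M mu (hh s w) - hh (mu :: s) w).
Proof.
elim: s M mu => [|x s IHs] M mu.
  case: M => // M _; rewrite /= /Qn endo_sum.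
  rewrite (@big_ord_first _ M (fun k => (H (mu + k%:Z) * G k) (vacw w))).
    by rewrite endoM G_vacw addr0 subrr; apply: kspan0.
  by move=> k; rewrite endoM G_vacw endo0v.
rewrite [size (_ :: _)]/= => ltM; case: M ltM => [|[|M]] ltM; [lia|lia|].
have {}ltM : (2 * size s < M)%N by lia.
have sub (y mu' : int) : y <= x -> mu' = mu + x - y -> forall v,
    kspan (lower_terms mu' s w) v -> kspan (lower_terms mu (x :: s) w) (H y v).
  move=> le_yx -> v; apply: kspan_endo => _ [t [bts neq ->]].
  apply: kspan_in; exists (y :: t); split=> //=; first by rewrite eqseq_cons negb_and neq orbT.
  rewrite -!endoM H_comm; congr (efun (H _ * _) _); lia.
have low M' (y mu' : int) : y < x -> mu' = mu + x - y -> (2 * size s < M')%N ->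
    kspan (lower_terms mu (x :: s) w) (H y (Qn M' mu' (hh s w))).
  move=> lt_yx emu ltM'; rewrite -[Qn M' mu' _](subrK (hh (mu' :: s) w)) endoDv.
  apply: kspanD; first by apply: sub emu _ (IHs _ _ ltM'); apply: ltW.
  apply: kspan_in; exists (y :: s); split; first by rewrite /=; split; [apply: ltW|apply: below_refl].
    by rewrite eqseq_cons negb_and lt_eqF.
  rewrite -[LHS]/(hh (y :: mu' :: s) w) hh_swap; congr (hh (_ :: _) w); rewrite emu /=; lia.
rewrite [hh (x :: s) w]/= -endoM Qn_H endoD endoB endoMn !endoM hh_swap.
rewrite addrAC; apply: kspanD; last by apply: low; lia.
rewrite addrAC; apply: kspanB; last by apply/kspanMn/low; lia.
rewrite [hh _ w]/= -endoBv; apply: (sub _ mu); [by []|lia|].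
by apply: IHs; lia.
Qed.

(** The indices r of the vector whose leading term is [hh la]. *)
Fixpoint modes_of la : seq int :=
  if la is mu :: la' then (- mu - 1 - 2 * (size la')%:Z) :: modes_of la' else [::].

Definition vec la : gF W := foldr (gmodeop (@gXt K W)) (gvac W) (modes_of la).

Lemma neutral_vec la : neutral (2 * (size la)%:Z) (vec la).
Proof.
elim: la => [|mu la IHla]; first exact: neutral_vac.
have -> : 2 * (size (mu :: la))%:Z = 2 * (size la)%:Z + alpha by rewrite /alpha /=; lia.
exact: neutral_xt.
Qed.

(** Each application of a mode raises the new index at the expense of the later
    ones, so that the terms other than the leading one dominate la strictly. *)
Definition dom_terms la w v := exists u, [/\ dom 0 u la, u != la & v = hh u w].

Lemma vec_dom la : kspan (dom_terms la (2 * (size la)%:Z))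
  (vec la 0%N - hh la (2 * (size la)%:Z)).
Proof.
elim: la => [|mu la IHla].
  by rewrite /vec /= /gvac eqxx subrr; apply: kspan0.
set w := 2 * (size la)%:Z in IHla.
have -> : 2 * (size (mu :: la))%:Z = w + alpha by rewrite /w /alpha /=; lia.
have [N vN] := gmodeopt_mod_h (- mu - 1 - 2 * (size la)%:Z) (neutral_vec la).1.
pose M := maxn N (2 * size la).+1.
have -> : vec (mu :: la) 0%N = Qn M mu (ew W alpha (vec la 0%N)).
  rewrite {1}/vec /= (vN M); last exact: leq_maxl.
  rewrite /Qn endo_sum; apply: eq_bigr => k _; rewrite endoM; congr (H _ _); lia.
have QnE u : dom 0 u la ->
    kspan (dom_terms (mu :: la) (w + alpha)) (Qn M mu (hh u (w + alpha)) - hh (mu :: u) (w + alpha)).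
  move=> dul; have ltM : (2 * size u < M)%N by rewrite (dom_size dul) leq_maxr.
  apply: kspan_sub (Qn_hh mu (w + alpha) ltM) => _ [t [btu neq ->]].
  exists (mu + sumz u - sumz t :: t); have le := below_sum btu; split=> //=.
    split; first by lia.
    have := dom_below dul btu; congr dom; lia.
  apply: contra_neq neq => -[e1 e2]; apply: below_sum_eq => //; lia.
have {IHla} := kspan_endo (f := Qn M mu * ew W alpha)
  (B' := dom_terms (mu :: la) (w + alpha)) _ IHla.
rewrite endoM => IH.
rewrite -(subrK (hh la w) (vec la 0%N)) endoDv endoDv -addrA ew_hh; apply: kspanD; last first.
  exact/QnE/dom_refl.
apply: IH => _ [u [dul neq ->]].
rewrite endoM ew_hh -(subrK (hh (mu :: u) (w + alpha)) (Qn M mu _)).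
apply: kspanD; first exact: QnE.
apply: kspan_in; exists (mu :: u); split=> //=; last by rewrite eqseq_cons eqxx.
by rewrite add0r subrr.
Qed.

Definition part la := sorted >=%R la && all (fun y => 0 <= y) la.

Lemma sumsq_perm s t : perm_eq s t -> sumsq s = sumsq t.
Proof.
have E u : sumsq u = \sum_(x <- u) x ^+ 2.
  by elim: u => [|x u IHu]; rewrite ?big_nil ?big_cons //= IHu.
by rewrite !E; apply: perm_big.
Qed.
Lemma sumz_perm s t : perm_eq s t -> sumz s = sumz t.
Proof.
have E u : sumz u = \sum_(x <- u) x.
  by elim: u => [|x u IHu]; rewrite ?big_nil ?big_cons //= IHu.
by rewrite !E; apply: perm_big.
Qed.

Definition upper_terms la w v := exists nu,
  [/\ part nu, size nu = size la, sumz nu = sumz la, sumsq la < sumsq nu & v = hh nu w].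

Lemma part_sort s : all (fun y => 0 <= y) s -> part (sort >=%R s).
Proof. by move=> s_ge0; rewrite /part all_sort s_ge0 andbT sort_sorted //; exact: ge_total. Qed.

Lemma vec_hh la : part la ->
  kspan (upper_terms la (2 * (size la)%:Z)) (vec la 0%N - hh la (2 * (size la)%:Z)).
Proof.
move=> /andP[la_sorted la_ge0]; apply: kspan_trans (vec_dom la) => _ [u [dul neq ->]].
have [u_ge0|] := boolP (all (fun y => 0 <= y) u); last first.
  rewrite -has_predC => u_neg; rewrite hh_neg; first exact: kspan0.
  by apply: sub_has u_neg => x /=; rewrite -ltNge.
have pu := permEl (perm_sort >=%R u).
apply: kspan_in; exists (sort >=%R u); split.
- exact: part_sort.
- by rewrite size_sort (dom_size dul).
- by rewrite (sumz_perm pu) -(dom_sum dul) add0r.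
- rewrite (sumsq_perm pu).
  have := @dom_sumsq (head 0 la) 0 u la; rewrite neq mulr0 mul0r addr0 => lt.
  suff : sumsq la + true%:R <= sumsq u by rewrite /=; lia.
  apply: lt => //.
    by case: (la) la_sorted => //= x l ->; rewrite lexx.
  by case: (la) la_ge0 => //= x l /andP[-> ->].
- by apply: hh_perm; rewrite perm_sym.
Qed.
End Leading.

(** * Independence modulo h *)

(** Repeated vectors are merged, so that the coefficients form a function. *)
Lemma kspan_repr (K : numFieldType) (V : lmodType K) (I : eqType) (f : I -> V)
    (P : I -> Prop) v :
  kspan (fun b => exists i, P i /\ b = f i) v ->
  exists s (c : I -> K),
    [/\ uniq s, forall i, i \in s -> P i & v = \sum_(i <- s) c i *: f i].
Proof.
elim=> [|d _ v' [i0 [Pi0 ->]] _ [s [c [us Ps ->]]]].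
  by exists [::], (fun=> 0); rewrite big_nil.
case: (boolP (i0 \in s)) => s_i0.
  exists s, (fun i => if i == i0 then d + c i else c i); split=> //.
  rewrite !(bigD1_seq i0) //= eqxx scalerDl -addrA; congr (_ + (_ + _)).
  by apply: eq_bigr => i /negPf ->.
exists (i0 :: s), (fun i => if i == i0 then d else c i); split=> /=.
- by rewrite s_i0.
- by move=> i; rewrite inE => /orP[/eqP ->|/Ps].
rewrite big_cons eqxx; congr (_ + _); apply: eq_big_seq => i s_i.
by case: eqP s_i0 => // <-; rewrite s_i.
Qed.

Section Independence.
Variables (K : numFieldType) (W : fock K).
Local Notation E := (endo W).
Local Notation H := (Hop W).
Local Notation mon := {cmonom mode}.
Implicit Types (k : mon) (s t u la : seq int) (w mu : int) (v : W).

(** By induction on phi, the coordinate (k i, w i) of the relation isolates c i. *)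
Lemma triangular_free (I : eqType) (P : I -> Prop) (f : I -> W)
    (k : I -> mon) (w : I -> int) (phi : I -> nat) :
  (forall i, P i -> coef (k i) (w i) (f i) != 0) ->
  (forall i j, P i -> P j -> coef (k i) (w i) (f j) != 0 -> j = i \/ (phi j < phi i)%N) ->
  forall (s : seq I) (c : I -> K), uniq s -> (forall i, i \in s -> P i) ->
    \sum_(i <- s) c i *: f i = 0 -> forall i, i \in s -> c i = 0.
Proof.
move=> diag tri s c us Ps sum0 i; have [n] := ubnP (phi i).
elim: n i => // n IHn i; rewrite ltnS => le_n s_i.
have := congr1 (coef (k i) (w i)) sum0; rewrite linear_sum wcoef0 (bigD1_seq i) //=.
rewrite big1_seq ?addr0 => [|j /andP[neq_ji s_j]].
  by rewrite wcoefZ => /eqP; rewrite mulf_eq0 (negPf (diag _ (Ps _ s_i))) orbF => /eqP.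
rewrite wcoefZ; have [->|/(tri _ _ (Ps _ s_i) (Ps _ s_j))] := eqVneq (coef (k i) (w i) (f j)) 0.
  by rewrite mulr0.
case=> [eq_ji|lt_ji]; first by rewrite eq_ji eqxx in neq_ji.
by rewrite (IHn j) ?mul0r // (leq_trans lt_ji).
Qed.

Definition pure k := forall n, k (ord0, n) = 0%N.

(** Among the coordinates without a_1, those of least degree reduce to c at k. *)
Definition lead k w (c : K) v := forall k' w', pure k' ->
  (mdeg k' <= mdeg k)%N -> coef k' w' v = c * ((k' == k) && (w' == w))%:R.

Lemma mdeg_kmul k x : mdeg (kmul k x) = (mdeg k).+1.
Proof. by rewrite kmul_def (mdegM k (ucm x)) [mdeg (ucm x)]mdegU addn1. Qed.

Lemma pure_kdiv k x : pure k -> pure (kdiv k x).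
Proof. by move=> pk n; rewrite kdivE pk sub0n. Qed.

Lemma coef_bop r v k w : pure k ->
  coef k w (bop W r v) =
  if (0 < k (ord_max, r))%N then coef (kdiv k (ord_max, r)) w v else 0.
Proof. by move=> pk; rewrite /bop endoB wcoefD wcoefN !coef_cr pk subr0. Qed.

(** Only the linear term a_2(-n-1)/(n+1) of H(n+1) contributes in lowest degree. *)
Lemma lead_H n k w c v : lead k w c v ->
  lead (kmul k (ord_max, n)) w (n.+1%:R^-1 * c) (H n.+1%:Z v).
Proof.
elim/ltn_ind: n => n IHn kv k' w' pk'; rewrite mdeg_kmul => le_k'.
apply: (mulfI (_ : n.+1%:R != 0 :> K)); first by rewrite pnatr_eq0.
rewrite !mulrA mulfV ?pnatr_eq0 // mul1r -wcoefZ scaler_nat -endoMn H_rec endo_sum.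
rewrite linear_sum (@big_ord_last _ n (fun r => coef k' w' ((bop W r * H (n.+1%:Z - r.+1%:Z)) v))).
  rewrite subrr endoM H0 coef_bop //.
  case: ifP => [k'n|/negbT]; last first.
    rewrite -leqNgt leqn0 => /eqP k'n; case: eqP => [eqk'|_]; last by rewrite mulr0.
    by move: k'n; rewrite eqk' kmulE eqxx addn1.
  rewrite kv; last by rewrite -ltnS -(mdeg_kmul _ (ord_max, n)) kdivK.
    by rewrite kdiv_eq.
  exact: pure_kdiv.
move=> r lt_rn; rewrite endoM coef_bop //; case: ifP => // k'r.
have -> : n.+1%:Z - r.+1%:Z = (n - r).-1.+1%:Z by lia.
rewrite (IHn _ _ kv) //; last 2 first.
- exact: pure_kdiv.
- rewrite mdeg_kmul (leq_trans _ (leqnSn _)) //.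
  by rewrite -ltnS -(mdeg_kmul _ (ord_max, r)) kdivK // ltnS.
- case: eqP => [e|_]; last by rewrite mulr0.
  have := mdeg_kmul (kdiv k' (ord_max, r)) (ord_max, r); rewrite kdivK // e mdeg_kmul.
  by move=> e'; move: le_k'; rewrite e' ltnn.
- lia.
Qed.

Definition monz s : mon :=
  foldr (fun x k => if x is Posz n.+1 then kmul k (ord_max, n) else k) (onecm _) s.

Lemma lead_hh s w : all (fun x => 0 <= x) s ->
  exists2 c : K, c != 0 & lead (monz s) w c (hh W s w).
Proof.
elim: s => [|[[|n]|n] s IHs] //=.
- exists 1; first exact: oner_neq0.
  by move=> k' w' _ _; rewrite /hh /= /vacw coef_bas mul1r eq_sym [w == _]eq_sym.
- by move=> /IHs[c c0 ld]; exists c => //; rewrite H0.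
- move=> /IHs[c c0 ld]; exists (n.+1%:R^-1 * c); last exact: lead_H.
  by rewrite mulf_neq0 // invr_neq0 // pnatr_eq0.
Qed.

Lemma pure_monz s : pure (monz s).
Proof.
by elim: s => [|[[|n]|n] s IHs] m //=; rewrite ?onecmE ?kmulE ?IHs.
Qed.

Lemma monzE s n : monz s (ord_max, n) = count_mem n.+1%:Z s.
Proof.
elim: s => [|[[|m]|m] s IHs] //=; rewrite ?onecmE ?kmulE ?IHs //.
by rewrite addnC xpair_eqE eqxx /= eqz_nat eqSS.
Qed.

(** The monomial records the multiplicities of the positive entries, and the length
    then gives the number of zeros. *)
Lemma monz_inj la la' : part la -> part la' -> size la = size la' ->
  monz la = monz la' -> la = la'.
Proof.
move=> /andP[sla pla] /andP[sla' pla'] eq_size eq_mon.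
apply: (sorted_eq (leT := >=%R)) => //.
- by move=> x y z; rewrite /= => yx xz; apply: le_trans xz yx.
- by move=> x y /andP[xy yx]; apply: le_anti; apply/andP.
have cp n : count_mem n.+1%:Z la = count_mem n.+1%:Z la' by rewrite -!monzE eq_mon.
have pos : perm_eq [seq x <- la | 0 < x] [seq x <- la' | 0 < x].
  apply/allP => x _ /=; rewrite !count_filter; apply/eqP.
  have [x_gt0|x_le0] := boolP (0 < x); last first.
    by rewrite !(@eq_count _ _ pred0) ?count_pred0 // => y /=;
      apply/negbTE/negP => /andP[/eqP -> ] ; apply/negP.
  case: x x_gt0 => [[|n]|n] // _.
  have eqc u : count (predI (pred1 n.+1%:Z) (fun x => 0 < x)) u = count_mem n.+1%:Z u.
    by apply: eq_count => y /=; case: eqP => // ->.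
  by rewrite !eqc.
have zero u : all (fun y => 0 <= y) u ->
    (count_mem (0%Z : int) u = size u - size [seq x <- u | (0 < x)%R])%N.
  move=> u_ge0; rewrite size_filter -(count_predC (fun x => 0 < x) u) addKn.
  apply: eq_in_count => y /(allP u_ge0) /= y_ge0; by rewrite -leNgt eq_le y_ge0 andbT.
apply/allP => -[[|n]|n] _ /=; apply/eqP; [|exact: cp|].
  by rewrite !zero // eq_size (perm_size pos).
have neg u : all (fun y => 0 <= y) u -> count_mem (Negz n) u = 0%N.
  by move=> /allP u_ge0; apply/count_memPn/negP => /u_ge0.
by rewrite !neg.
Qed.

Definition wsize la : int := 2 * (size la)%:Z.

Lemma hh_free (s : seq (seq int)) (c : seq int -> K) : uniq s -> (forall la, la \in s -> part la) ->
  \sum_(la <- s) c la *: hh W la (wsize la) = 0 -> forall la, la \in s -> c la = 0.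
Proof.
have ld la : part la -> exists2 c : K, c != 0 & lead (monz la) (wsize la) c (hh W la (wsize la)).
  by move=> /andP[_]; apply: lead_hh.
move=> us sP; apply: (@triangular_free _ part _ monz wsize (fun la => mdeg (monz la))) => //.
  move=> la /ld[d d0 ->] //; last exact: pure_monz.
  by rewrite !eqxx mulr1.
move=> la nu pla pnu; have [d d0 ld'] := ld _ pnu.
case: ltnP; [by right|move=> le]; rewrite ld' //; last exact: pure_monz.
case: (monz la =P monz nu) => [eq_mon|_]; last by rewrite mulr0 eqxx.
case: (wsize la =P wsize nu) => [eq_size|_]; last by rewrite mulr0 eqxx.
left; apply: monz_inj => //; move: eq_size; rewrite /wsize; lia.
Qed.

Lemma hh_notin_span la : part la ->
  ~ kspan (fun b => exists nu, (part nu /\ nu != la) /\ b = hh W nu (wsize nu))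
          (hh W la (wsize la)).
Proof.
move=> pla /kspan_repr[s [c [us sP e]]].
have la_s : la \notin s by apply/negP => /sP[_]; rewrite eqxx.
have := @hh_free (la :: s) (fun nu => if nu == la then -1 else c nu).
rewrite /= la_s us => /(_ isT) free; have : (if la == la then -1 else c la) = 0.
  apply: free (mem_head _ _).
    by move=> nu; rewrite inE => /orP[/eqP ->|/sP[]].
  rewrite big_cons eqxx scaleN1r [X in - X]e addrC; apply/eqP; rewrite subr_eq0; apply/eqP.
  apply: eq_big_seq => nu s_nu; case: eqP => // eq_nu.
  by rewrite eq_nu (negPf la_s) in s_nu.
by rewrite eqxx => /eqP; rewrite oppr_eq0 oner_eq0.
Qed.

(** The reductions modulo h of the basis vectors are independent: expand in the
    [hh nu] and compare the terms with the least sum of squares. *)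
Lemma vec_free (s : seq (seq int)) (c : seq int -> K) : uniq s -> (forall la, la \in s -> part la) ->
  \sum_(la <- s) c la *: vec W la 0%N = 0 -> forall la, la \in s -> c la = 0.
Proof.
move=> us sP sum0 la; have [n] := ubnP `|sumsq la|.
elim: n la => // n IHn la; rewrite ltnS => le_n s_la.
have [//|c_la] := eqVneq (c la) 0; have pla := sP _ s_la; exfalso.
apply: (@hh_notin_span la) => //; set B := fun b => _.
have sq_ge0 u : 0 <= sumsq u by elim: u => //= x u IHu; rewrite addr_ge0 ?sqr_ge0.
have span_la nu : part nu -> sumsq la <= sumsq nu ->
    kspan B (vec W nu 0%N - hh W nu (wsize nu)).
  move=> pnu le_nu; apply: kspan_sub (vec_hh W pnu) => _ [t [pt szt _ lt_t ->]].
  exists t; split; last by rewrite /wsize szt.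
  split=> //; apply/negP => /eqP eq_t; move: lt_t; rewrite eq_t; lia.
have -> : hh W la (wsize la) =
    - (vec W la 0%N - hh W la (wsize la)) - (c la)^-1 *: \sum_(nu <- s | nu != la) c nu *: vec W nu 0%N.
  move/eqP: sum0; rewrite (bigD1_seq la) //= addrC addr_eq0 => /eqP ->.
  by rewrite scalerN opprK scalerA mulVf // scale1r opprB subrK.
apply: kspanB; first exact/kspanN/span_la.
apply: kspanZ; rewrite big_seq_cond; apply: kspan_sum => nu /andP[s_nu neq].
have [lt_nu|le_nu] := ltP (sumsq nu) (sumsq la).
  rewrite (IHn nu) //; first by rewrite scale0r; apply: kspan0.
  have := sq_ge0 nu; have := sq_ge0 la; lia.
apply: kspanZ; rewrite -(subrK (hh W nu (wsize nu)) (vec W nu 0%N)).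
apply: kspanD; first by apply: span_la => //; apply: sP.
by apply: kspan_in; exists nu; split=> //; split=> //; apply: sP.
Qed.

End Independence.

(** * Generation modulo h *)

Section Spanning.
Variables (K : numFieldType) (W : fock K).
Local Notation E := (endo W).
Local Notation H := (Hop W).
Local Notation an := (an W).
Local Notation mon := {cmonom mode}.
Implicit Types (k : mon) (s t la : seq int) (w : int) (u v : W).

(** These operators are the constant terms in h of the D n. *)
Definition flat v := forall n, (an (ord0, n) + an (ord_max, n)) v = 0.

Lemma ord2 (j : 'I_2) : j = ord0 \/ j = ord_max.
Proof. by case: j => -[|[|//]] ltj; [left|right]; apply: val_inj. Qed.

(** The equations trade a factor a_1(-n) for a factor a_2(-n). *)
Lemma flat_eq0 v : flat v -> (forall k w, pure k -> coef k w v = 0) -> v = 0.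
Proof.
move=> fv pv; apply: coefP => k w; rewrite wcoef0.
pose d1 := wdeg (fun x => x.1 == ord0); have [m] := ubnP (d1 k).
elim: m k => // m IHm k; rewrite ltnS => le_m.
have [pk|/existsNP[n /eqP]] := pselect (pure k); first exact: pv.
rewrite -lt0n => kn; have eq_k := kdivK kn; set k' := kdiv k _ in eq_k.
have := congr1 (coef k' w) (fv n); rewrite endoD wcoefD wcoef0 !coef_an eq_k.
have d1k : d1 k = (d1 k').+1 by rewrite -{1}eq_k /d1 wdegM addn1.
rewrite (IHm (kmul k' (ord_max, n))) ?mulr0 ?addr0; last by rewrite /d1 wdegM addn0 -/d1 -d1k.
by move/eqP; rewrite mulf_eq0 pnatr_eq0 muln_eq0 /= => /eqP.
Qed.

Lemma flatD u v : flat u -> flat v -> flat (u + v).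
Proof. by move=> fu fv n; rewrite endoDv fu fv addr0. Qed.
Lemma flatZ c v : flat v -> flat (c *: v).
Proof. by move=> fv n; rewrite endoZv fv scaler0. Qed.
Lemma flat0 : flat 0.
Proof. by move=> n; rewrite endo0v. Qed.
Lemma flat_sum (I : Type) (r : seq I) (P : pred I) (F : I -> W) :
  (forall i, P i -> flat (F i)) -> flat (\sum_(i <- r | P i) F i).
Proof. by move=> fF; elim/big_ind: _ => //; [apply: flat0|apply: flatD]. Qed.

Lemma flat_bop r v : flat v -> flat (bop W r v).
Proof.
move=> fv n; rewrite -endoM.
suff -> : (an (ord0, n) + an (ord_max, n)) * bop W r =
          bop W r * (an (ord0, n) + an (ord_max, n)) by rewrite endoM fv endo0v.
have an_crn x y : x != y -> an x * cr W y = cr W y * an x.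
  by move=> /negPf neq; rewrite an_cr neq scale0r addr0.
have eqE (i : 'I_2) : an (i, n) * cr W (i, r) = cr W (i, r) * an (i, n) +
    (if n == r then n.+1%:R else 0) *: (1 : E).
  by rewrite an_cr xpair_eqE eqxx.
rewrite /bop mulrBr mulrBl !mulrDl !mulrDr !eqE (an_crn (ord0, n) (ord_max, r)) //.
rewrite (an_crn (ord_max, n) (ord0, r)) //; set t := _ *: (1 : E).
have ac (M : zmodType) (a b c d x : M) : a + (b + x) - (c + x + d) = a + b - (c + d).
  by rewrite addrA [c + x + d]addrAC opprD addrACA subrr addr0.
exact: ac.
Qed.

Definition hh_of w v := exists s, v = hh W s w.

(** The recursion for H expresses bop r through H(r+1) and the bop of smaller index. *)
Lemma bop_hh r w v : kspan (hh_of w) v -> kspan (hh_of w) (bop W r v).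
Proof.
suff bh s : kspan (hh_of w) (bop W r (hh W s w)).
  elim=> [|c _ v' [s ->] _ IHv]; first by rewrite endo0v; apply: kspan0.
  by rewrite endoDv endoZv; apply/kspanD => //; apply: kspanZ.
elim/ltn_ind: r s => r IHr s.
have -> : bop W r (hh W s w) = hh W (r.+1%:Z :: s) w *+ r.+1 -
    \sum_(q < r) bop W q (hh W (r.+1%:Z - q.+1%:Z :: s) w).
  rewrite [hh W (r.+1%:Z :: s) w]/= -endoMn H_rec endo_sum big_ord_recr /=.
  by rewrite subrr H0 addrC addrK.
apply: kspanB; first by apply/kspanMn/kspan_in; eexists.
by apply: kspan_sum => q _; apply: IHr.
Qed.

(** Products of the operators [bop] on the vacuum: they stay flat, and [bop n] acts on
    the coordinates without a_1 as the multiplication by a_2(-n-1). *)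
Lemma flat_dual k w : pure k -> exists e, [/\ flat e, kspan (hh_of w) e &
  forall k' w', pure k' -> coef k' w' e = ((k == k') && (w == w'))%:R].
Proof.
have [m] := ubnP (mdeg k); elim: m k => // m IHm k; rewrite ltnS => le_m pk.
have [->|k1] := eqVneq k (onecm _).
  exists (vacw W w); split.
  - by move=> n; rewrite endoD !an_vac addr0.
  - by apply: kspan_in; exists [::].
  - by move=> k' w' _; apply: coef_bas.
have [[j n] kx] : exists x, (0 < k x)%N.
  apply/not_existsP => k0; case/eqP: k1; apply: kP => x; rewrite onecmE.
  by case: (posnP (k x)) => // /k0.
have [eq_j|eq_j] := ord2 j; first by rewrite eq_j pk in kx.
rewrite eq_j in kx; have eq_k := kdivK kx; have pk' := pure_kdiv (ord_max, n) pk.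
have deg_k := mdeg_kmul (kdiv k (ord_max, n)) (ord_max, n); rewrite eq_k in deg_k.
have [|e [fe he ce]] := IHm (kdiv k (ord_max, n)) _ pk'; first by rewrite -deg_k.
exists (bop W n e); split; [exact: flat_bop|exact: bop_hh|].
move=> k' w' pl; rewrite coef_bop //; case: ifP => [k'n|/negbT].
  by rewrite ce; [rewrite [_ == kdiv k' _]eq_sym kdiv_eq // eq_k eq_sym|apply: pure_kdiv].
rewrite -leqNgt leqn0 => /eqP k'n; case: eqP => // eq_k'.
by rewrite eq_k' k'n in kx.
Qed.

Definition evenw w := exists m : int, w = 2 * m.
Definition even_supp v := forall k w, ~ evenw w -> coef k w v = 0.

(** Flat vectors are determined by the coordinates without a_1, which can be matched
    by finitely many vectors of the dual family. *)
Lemma flat_span v : flat v -> even_supp v ->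
  kspan (fun b => exists s m, b = hh W s (2 * m)) v.
Proof.
move=> fv ev; have [s [c eq_v]] := bas_expand v.
have dual (x : mon * weight) : exists e, `[< pure x.1 >] && `[< evenw x.2 >] ->
    [/\ flat e, kspan (hh_of x.2) e &
     forall k w, pure k -> coef k w e = ((x.1 == k) && (x.2 == w))%:R].
  have [/andP[/asboolP px _]|_] := boolP (_ && _); last by exists 0.
  by have [e He] := flat_dual x.2 px; exists e.
have /choice[e eP] := dual.
pose v' := \sum_(x <- s | `[< pure x.1 >] && `[< evenw x.2 >]) c x *: e x.
have -> : v = v'.
  apply/eqP; rewrite -subr_eq0; apply/eqP; apply: flat_eq0.
    apply: flatD => //; rewrite -scaleN1r; apply: flatZ; apply: flat_sum => x Px.
    by apply: flatZ; have [] := eP x Px.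
  move=> k w pk; rewrite wcoefD wcoefN; apply/eqP; rewrite subr_eq0; apply/eqP.
  have [ew|ew] := pselect (evenw w); last first.
    rewrite ev // linear_sum big1 // => x Px.
    have [_ _ ce] := eP x Px; rewrite /= wcoefZ ce //; case: (x.2 =P w) => [eq_w|_]; last by rewrite andbF mulr0.
    by case: ew; rewrite -eq_w; apply/asboolP; case/andP: Px.
  rewrite eq_v !linear_sum [RHS]big_mkcond /=; apply: eq_bigr => x _.
  rewrite wcoefZ coef_bas; case: ifP => [Px|].
    by have [_ _ ce] := eP x Px; rewrite wcoefZ ce.
  move/negbT; rewrite negb_and => /orP[] /asboolP nP.
    by case: eqP => [eq_k|_]; [case: nP; rewrite eq_k|rewrite mulr0].
  by case: (x.2 =P w) => [eq_w|_]; [case: nP; rewrite eq_w|rewrite andbF mulr0].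
apply: kspan_sum => x Px; apply: kspanZ; have [_ he _] := eP x Px.
have [m eq_m] : evenw x.2 by apply/asboolP; case/andP: Px.
by apply: kspan_sub he => _ [t ->]; exists t, m; rewrite eq_m.
Qed.

Definition vec_shift v := exists la (m : int), part la /\ v = ew W (2 * m) (vec W la 0%N).

Lemma sumsq_le s : all (fun x => 0 <= x) s -> sumsq s <= sumz s ^+ 2 /\ 0 <= sumz s.
Proof.
elim: s => //= x s IHs /andP[x_ge0 /IHs[le ge0]]; split; last by rewrite addr_ge0.
nia.
Qed.

(** Downward induction on the sum of squares, which the sum bounds. *)
Lemma hh_span_part la m : part la -> kspan vec_shift (hh W la (2 * m)).
Proof.
have [n] := ubnP `|sumz la ^+ 2 - sumsq la|.
elim: n la => // n IHn la; rewrite ltnS => le_n pla.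
pose q := m - (size la)%:Z.
have -> : hh W la (2 * m) = ew W (2 * q) (vec W la 0%N) -
    ew W (2 * q) (vec W la 0%N - hh W la (2 * (size la)%:Z)).
  rewrite -endoBv opprB addrC subrK ew_hh; congr hh; rewrite /q; lia.
apply: kspanB; first by apply: kspan_in; exists la, q.
have := kspan_endo (f := ew W (2 * q)) (B' := fun b => exists nu,
  [/\ part nu, size nu = size la, sumz nu = sumz la, sumsq la < sumsq nu & b = hh W nu (2 * m)])
  _ (vec_hh W pla); move=> IH.
apply: kspan_trans (IH _) => {IH}.
  move=> _ [nu [pnu _ eq_sum lt_sq ->]]; apply: IHn => //.
  have [_ nu_ge0] := andP pnu; have [le_nu _] := sumsq_le nu_ge0.
  by move: le_n le_nu lt_sq; rewrite eq_sum; lia.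
move=> _ [nu [pnu szn eq_sum lt_sq ->]]; apply: kspan_in; exists nu; split=> //.
by rewrite ew_hh; congr hh; rewrite /q; lia.
Qed.

Lemma hh_span s m : kspan vec_shift (hh W s (2 * m)).
Proof.
have [s_ge0|] := boolP (all (fun y => 0 <= y) s); last first.
  rewrite -has_predC => s_neg; rewrite hh_neg; first exact: kspan0.
  by apply: sub_has s_neg => x /=; rewrite -ltNge.
rewrite -(hh_perm _ _ (permEl (perm_sort >=%R s))).
exact/hh_span_part/part_sort.
Qed.

Lemma flat_vec_span v : flat v -> even_supp v -> kspan vec_shift v.
Proof.
move=> fv ev; apply: kspan_trans (flat_span fv ev) => _ [s [m ->]].
exact: hh_span.
Qed.
End Spanning.

(** * Approximation in the h-adic topology *)

Local Open Scope classical_set_scope.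

Section Hadic.
Variables (K : numFieldType) (V : lmodType K).
Local Notation F := (nat -> V).
Implicit Types (B L M : set F) (u v : F) (c : nat -> K).

Definition gscaleh c v : F := fun n => \sum_(i < n.+1) c i *: v (n - i)%N.
Definition ghshift (N : nat) v : F := fun n => if (n < N)%N then 0 else v (n - N)%N.
Definition ghspan B : set F :=
  [set v | exists n (c : 'I_n -> nat -> K) (b : 'I_n -> F),
    (forall i, B (b i)) /\ v = \sum_(i < n) gscaleh (c i) (b i)].
Definition ghcomplete M : set F :=
  [set v | exists m : nat -> F, (forall k, M (m k)) /\
    v = fun n => \sum_(k < n.+1) m k (n - k)%N].
Definition ghfree B : Prop :=
  forall n (c : 'I_n -> nat -> K) (b : 'I_n -> F),
    injective b -> (forall i, B (b i)) ->
    \sum_(i < n) gscaleh (c i) (b i) = 0 -> forall i, c i = 0.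
Definition ghdense B L : Prop :=
  forall v, L v -> forall N : nat,
    exists s l : F, [/\ B s, L l & v = s + ghshift N l].
Definition gtopological_basis B L : Prop :=
  [/\ B `<=` L, ghfree B & ghdense (ghspan B) L].

Lemma ghspan0 B : ghspan B 0.
Proof. by exists 0%N, (fun=> fun=> 0), (fun=> 0); split; [case|rewrite big_ord0]. Qed.

Lemma ghspan_cons B c b v : B b -> ghspan B v -> ghspan B (gscaleh c b + v).
Proof.
move=> Bb [n [d [a [Ba ->]]]].
exists n.+1, (fun i => oapp d c (unlift ord0 i)), (fun i => oapp a b (unlift ord0 i)).
split=> [i|]; first by case: (unlift ord0 i).
rewrite big_ord_recl unlift_none /=; congr (_ + _); apply: eq_bigr => i _.
by rewrite liftK.
Qed.

Lemma ghspan_ind B (P : F -> Prop) : P 0 ->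
  (forall c b v, B b -> ghspan B v -> P v -> P (gscaleh c b + v)) ->
  forall v, ghspan B v -> P v.
Proof.
move=> P0 Pc v [n [c [b [Bb ->]]]]; elim: n c b Bb => [|n IHn] c b Bb.
  by rewrite big_ord0.
rewrite big_ord_recl; apply: Pc => //; last exact: IHn.
by exists n, (fun i => c (lift ord0 i)), (fun i => b (lift ord0 i)).
Qed.

Lemma ghspanD B u v : ghspan B u -> ghspan B v -> ghspan B (u + v).
Proof.
move=> + Bv; elim/ghspan_ind => [|c b u' Bb _ IHu]; first by rewrite add0r.
by rewrite -addrA; apply: ghspan_cons.
Qed.

Lemma ghshift1E v n : ghshift 1 v n = if n is n'.+1 then v n' else 0.
Proof. by rewrite /ghshift; case: n => // n; rewrite subn1. Qed.

Lemma ghspan_shift1 B v : ghspan B v -> ghspan B (ghshift 1 v).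
Proof.
elim/ghspan_ind => [|c b u Bb _ IHu].
  suff -> : ghshift 1 0 = 0 by apply: ghspan0.
  by apply/funext => -[|n].
have -> : ghshift 1 (gscaleh c b + u) =
    gscaleh (fun i => if i is j.+1 then c j else 0) b + ghshift 1 u.
  apply/funext => n; rewrite !addrfctE !ghshift1E; case: n => [|n].
    by rewrite /gscaleh big_ord1 scale0r addr0.
  by rewrite /gscaleh [in RHS]big_ord_recl scale0r add0r.
exact: ghspan_cons.
Qed.

Lemma ghspan_endo B B' (e : endo V) v : (forall b, B b -> B' (fun n => e (b n))) ->
  ghspan B v -> ghspan B' (fun n => e (v n)).
Proof.
move=> BB'; elim/ghspan_ind => [|c b u Bb _ IHu].
  suff -> : (fun n => e ((0 : F) n)) = 0 by apply: ghspan0.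
  by apply/funext => n; apply: endo0v.
have -> : (fun n => e ((gscaleh c b + u) n)) = gscaleh c (fun n => e (b n)) + (fun n => e (u n)).
  apply/funext => n; rewrite !addrfctE endoDv /gscaleh endo_sumv; congr (_ + _).
  by apply: eq_bigr => i _; rewrite endoZv.
by apply: ghspan_cons; first exact: BB'.
Qed.

(** These are the submodules L for which V[[h]] / L has no h-torsion. *)
Definition saturated L := [/\ L 0, forall c u v, L u -> L v -> L (gscaleh c u + v),
  forall u v, L u -> L v -> L (u - v) &
  forall v, v 0%N = 0 -> L v -> L (fun n => v n.+1)].

Section Approximation.
Variables (S L : set F).
Hypotheses (L_sat : saturated L) (S_L : S `<=` L).
Hypothesis (S_gen : forall v, L v -> kspan (fun x => exists2 b, S b & x = b 0%N) (v 0%N)).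

Lemma ghspan_closed : ghspan S `<=` L.
Proof.
have [L0 LD _ _] := L_sat; move=> v; elim/ghspan_ind => // c b u Sb _.
by apply: LD; apply: S_L.
Qed.

(** Approximating modulo h, and dividing the difference by h. *)
Lemma approx1 v : L v -> exists s l, [/\ ghspan S s, L l & v = s + ghshift 1 l].
Proof.
move=> Lv; have [L0 LD LB Lh] := L_sat.
have [s Ss s0] : exists2 s, ghspan S s & s 0%N = v 0%N.
  elim: (S_gen Lv) => [|k _ x [b Sb ->] _ [s Ss <-]].
    by exists 0 => //; apply: ghspan0.
  exists (gscaleh (fun i => if i == 0%N then k else 0) b + s); first exact: ghspan_cons.
  by rewrite addrfctE /gscaleh big_ord1 subnn.
exists s, (fun n => (v - s) n.+1); split=> //.
  apply: Lh; first by rewrite addrfctE opprfctE s0 subrr.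
  exact/LB/ghspan_closed.
apply/funext => n; rewrite addrfctE ghshift1E; case: n => [|n]; first by rewrite addr0 s0.
by rewrite addrfctE opprfctE addrC subrK.
Qed.

Lemma dense_span : ghdense (ghspan S) L.
Proof.
move=> v Lv N; elim: N v Lv => [|N IHN] v Lv.
  exists 0, v; split=> //; first exact: ghspan0.
  by apply/funext => n; rewrite addrfctE /ghshift subn0 add0r.
have [s [l [Ss Ll ->]]] := approx1 Lv; have [s' [l' [Ss' Ll' ->]]] := IHN _ Ll.
exists (s + ghshift 1 s'), l'; split=> //; first exact/ghspanD/ghspan_shift1.
rewrite -addrA; congr (_ + _); apply/funext => -[|n]; rewrite !addrfctE !ghshift1E.
  by rewrite /ghshift add0r.
by congr (_ + _); rewrite /ghshift ltnS subSS.
Qed.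

Lemma sub_complete_span : L `<=` ghcomplete (ghspan S).
Proof.
move=> v Lv.
have /choice[next nextP] : forall x : {u | L u}, exists sl : F * {u | L u},
    ghspan S sl.1 /\ sval x = sl.1 + ghshift 1 (sval sl.2).
  move=> [u Lu]; have [s [l [Ss Ll eq_u]]] := approx1 Lu.
  by exists (s, exist L l Ll).
pose rest k := iter k (fun x => (next x).2) (exist L v Lv).
exists (fun k => (next (rest k)).1); split=> [k|]; first by case: (nextP (rest k)).
apply/funext => n; suff : forall k, sval (rest k) n =
    \sum_(i < n.+1) (next (rest (i + k)%N)).1 (n - i)%N.
  by move/(_ 0%N) => /= ->; apply: eq_bigr => i _; rewrite addn0.
elim: n => [|n IHn] k; have [_ ->] := nextP (rest k).
  by rewrite big_ord1 addrfctE ghshift1E addr0.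
rewrite addrfctE ghshift1E big_ord_recl; congr (_ + _).
rewrite -[(next (rest k)).2]/(rest k.+1) IHn; apply: eq_bigr => i _.
by rewrite addnS.
Qed.
End Approximation.
End Hadic.

(** * The basis theorem over a Fock space *)

Section Admissible.
Implicit Types (rs : seq int) (la : seq int) (r : int).

Lemma adm_rcons rs r : admissible (rcons rs r) =
  admissible rs && (if rs is x :: s then r <= last x s - 2 else r <= - 1).
Proof.
case: rs => [|x s]; first by rewrite /admissible /= andbT.
by rewrite /admissible /= rcons_path andbA.
Qed.

Lemma adm_modes_of la : part la -> admissible (rev (modes_of la)).
Proof.
elim: la => [//|mu la IHla] /andP[/= mula /andP[mu_ge0 la_ge0]].
rewrite rev_cons adm_rcons IHla; last by rewrite /part (path_sorted mula).
case: la mula {la_ge0 IHla} => [|y la] /=; first by lia.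
move=> /andP[le_y _]; rewrite rev_cons.
case: (rev (modes_of la)) => [|x s] /=; last rewrite last_rcons; lia.
Qed.

Lemma modes_of_adm rs : admissible rs -> exists2 la, part la & rs = rev (modes_of la).
Proof.
elim/last_ind: rs => [|rs r IHrs]; first by exists [::].
rewrite adm_rcons => /andP[/IHrs[la pla ->] le_r].
exists (- r - 1 - 2 * (size la)%:Z :: la).
  case: la pla le_r => [|y la] /=; first by rewrite /part /= andbT; lia.
  rewrite rev_cons /part /= => /andP[-> /andP[y_ge0 ->]].
  by case: (rev (modes_of la)) => [|x s] /=; rewrite ?last_rcons y_ge0; lia.
rewrite /= rev_cons; congr rcons; lia.
Qed.

(** Appending a zero part amounts to raising the weight by alpha. *)
Lemma modes_of_rcons la : modes_of (rcons la 0) = rcons [seq r - 2 | r <- modes_of la] (- 1).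
Proof.
elim: la => //= mu la ->; rewrite size_rcons; congr (_ :: _); lia.
Qed.

Lemma part_rcons la : part la -> part (rcons la 0).
Proof.
move=> /andP[sla pla]; rewrite /part all_rcons lexx pla !andbT.
case: la sla pla => //= x la pth /andP[x_ge0 la_ge0]; rewrite rcons_path pth /=.
by have /allP := (la_ge0 : all _ la) => ge0; case/lastP: la ge0 {pth la_ge0} => // s y ge0;
  rewrite last_rcons ge0 // mem_rcons mem_head.
Qed.

Lemma foldr_shift (T : Type) (P : T -> Prop) (y : int -> T -> T) (e : T -> T) z rs :
  P z -> (forall r v, P v -> P (y r v)) ->
  (forall r v, P v -> y r (e v) = e (y (r + alpha) v)) ->
  e (foldr y z rs) = foldr y (e z) [seq r - 2 | r <- rs].
Proof.
move=> Pz Py ye; have Pf s : P (foldr y z s) by elim: s => //= r s; apply: Py.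
by elim: rs => //= r rs <-; rewrite ye // subrK.
Qed.
End Admissible.

Section Basis.
Variables (K : numFieldType) (W : fock K).
Local Notation F := (gF W).
Implicit Types (u v : F) (la : seq int) (m : int).

Definition gmonom (y : int -> F -> F) (rs : seq int) : F :=
  foldl (fun v r => y r v) (gvac W) rs.
Definition gBW0 : set F :=
  [set gmonom (gmodeop (@gX K W)) rs | rs in [set rs | admissible rs]].
Definition gBtildeW0 : set F :=
  [set gmonom (gmodeop (@gXt K W)) rs | rs in [set rs | admissible rs]].
Definition gL0 : set F := ghcomplete (ghspan
  [set v | exists (k : int) (b : F), gBW0 b /\ v = ewF (k * alpha) b]).
Definition gL1 : set F := [set ewF lambda1 v | v in gL0].
Definition gBtildeL1 (m : int) : set F :=
  [set ewF (lambda1 + m * alpha) b | b in gBtildeW0].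
Definition gBtildeL1_lim : set F := \bigcup_(m in [set: int]) gBtildeL1 m.

(** This turns out to be L_0. Unlike the latter it is visibly closed under division
    by h, which lets generation modulo h imply h-adic density. *)
Definition evenker : set F :=
  [set v | (forall n, even_supp (v n)) /\ forall j n, act (D W j) v n = 0].

Lemma actD f u v n : act f (u + v) n = act f u n + act f v n.
Proof. by rewrite /act -big_split /=; apply: eq_bigr => q _; apply: endoDv. Qed.
Lemma actB f u v n : act f (u - v) n = act f u n - act f v n.
Proof. by rewrite /act -sumrB /=; apply: eq_bigr => q _; apply: endoBv. Qed.
Lemma act_scale f c v n : act f (gscaleh c v) n = \sum_(i < n.+1) c i *: act f v (n - i)%N.
Proof.
transitivity (\sum_(q < n.+1) \sum_(i < (n - q).+1) c i *: f q (v (n - q - i)%N)).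
  by apply: eq_bigr => q _; rewrite endo_sumv; apply: eq_bigr => i _; rewrite endoZv.
rewrite (exchange_triangle n (fun q i => c i *: f q (v (n - q - i)%N))).
apply: eq_bigr => i _; rewrite scaler_sumr; apply: eq_bigr => q _.
by rewrite subnAC.
Qed.

Lemma evenker_saturated : saturated evenker.
Proof.
split.
- split=> [n k w _|j n]; first exact: wcoef0.
  by rewrite /act big1 // => q _; apply: endo0v.
- move=> c u v [eu ku] [ev kv]; split=> [n k w ow|j n].
    rewrite addrfctE wcoefD ev // addr0 linear_sum big1 // => i _ /=.
    by rewrite wcoefZ eu // mulr0.
  rewrite actD kv addr0 act_scale big1 // => i _.
  by rewrite ku scaler0.
- move=> u v [eu ku] [ev kv]; split=> [n k w ow|j n].
    by rewrite addrfctE opprfctE wcoefD wcoefN eu // ev // subr0.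
  by rewrite actB ku kv subr0.
- move=> v v0 [ev kv]; split=> [n|j n]; first exact: ev.
  rewrite -[RHS](kv j n.+1) /act [RHS]big_ord_recr subnn v0 endo0v [RHS]addr0.
  apply: eq_bigr => q _; have leq : (q <= n)%N by rewrite -ltnS.
  by rewrite [RHS]/= subSn.
Qed.

Lemma neutral_evenker m v : neutral (2 * m) v -> evenker v.
Proof.
move=> [vw vD]; split=> // n k w ow; rewrite -vw coef_pw.
by case: eqP => // eq_w; case: ow; exists m.
Qed.

Lemma evenker_flat v : evenker v -> flat (v 0%N) /\ even_supp (v 0%N).
Proof.
move=> [ev kv]; split=> // n; have := kv n 0%N; rewrite /act big_ord1 /D /=.
by rewrite expr0 bin0 mul1r !scale1r (subn0 n).
Qed.

Lemma evenker_complete (M : set F) : M `<=` evenker -> ghcomplete M `<=` evenker.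
Proof.
move=> M_ker v [m [Mm ->]]; split=> [n k w ow|j n].
  by rewrite linear_sum big1 // => i _; apply: (M_ker _ (Mm i)).1.
rewrite /act; transitivity (\sum_(q < n.+1) \sum_(k < (n - q).+1) D W j q (m k (n - q - k)%N)).
  by apply: eq_bigr => q _; rewrite endo_sumv.
rewrite (exchange_triangle n (fun q k => D W j q (m k (n - q - k)%N))) big1 // => k _.
rewrite -[RHS]((M_ker _ (Mm k)).2 j (n - k)%N); apply: eq_bigr => q _.
by rewrite subnAC.
Qed.

Definition vecX la : F := foldr (gmodeop (@gX K W)) (gvac W) (modes_of la).

Lemma neutral_vecX la : neutral (2 * (size la)%:Z) (vecX la).
Proof.
elim: la => [|mu la IHla]; first exact: neutral_vac.
have -> : 2 * (size (mu :: la))%:Z = 2 * (size la)%:Z + alpha by rewrite /alpha /=; lia.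
exact: neutral_x.
Qed.

(** X and X~ differ by powers of 1 + h/u, which are 1 modulo h. *)
Lemma vecX_mod_h la : vecX la 0%N = vec W la 0%N.
Proof.
elim: la => //= mu la IHla; rewrite /vecX /vec /= (gmodeop_mod_h _ (neutral_vecX la).1).
by rewrite /gmodeop !big_ord1 subnn -/(vecX la) IHla.
Qed.

Lemma gmonomE y la : gmonom y (rev (modes_of la)) = foldr y (gvac W) (modes_of la).
Proof. by rewrite /gmonom foldl_rev. Qed.

Definition shiftsX : set F :=
  [set v | exists (k : int) (b : F), gBW0 b /\ v = ewF (k * alpha) b].
Definition shifts : set F :=
  [set v | exists (k : int) (b : F), gBtildeW0 b /\ v = ewF (k * alpha) b].

Lemma neutral_shift m (k : int) v : neutral (2 * m) v -> evenker (ewF (k * alpha) v).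
Proof.
move=> /(neutral_ew (k * alpha)) nv; apply: (@neutral_evenker (m + k)).
by move: nv; congr neutral; rewrite /alpha; lia.
Qed.

Lemma shiftsX_ker : shiftsX `<=` evenker.
Proof.
move=> _ [k [_ [[rs /modes_of_adm[la _ ->] <-] ->]]]; rewrite gmonomE.
exact: neutral_shift (neutral_vecX la).
Qed.
Lemma shifts_ker : shifts `<=` evenker.
Proof.
move=> _ [k [_ [[rs /modes_of_adm[la _ ->] <-] ->]]]; rewrite gmonomE.
exact: neutral_shift (neutral_vec W la).
Qed.

Lemma shifts_gen v : evenker v ->
  kspan (fun x => exists2 b, shifts b & x = b 0%N) (v 0%N).
Proof.
move=> /evenker_flat[fv ev]; apply: kspan_sub (flat_vec_span fv ev) => _ [la [m [pla ->]]].
exists (ewF (2 * m) (vec W la)) => //; exists m, (vec W la); split; last by rewrite mulrC.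
by exists (rev (modes_of la)); [apply: adm_modes_of|rewrite gmonomE].
Qed.
Lemma shiftsX_gen v : evenker v ->
  kspan (fun x => exists2 b, shiftsX b & x = b 0%N) (v 0%N).
Proof.
move=> /evenker_flat[fv ev]; apply: kspan_sub (flat_vec_span fv ev) => _ [la [m [pla ->]]].
exists (ewF (2 * m) (vecX la)); last by rewrite /ewF vecX_mod_h.
exists m, (vecX la); split; last by rewrite mulrC.
by exists (rev (modes_of la)); [apply: adm_modes_of|rewrite gmonomE].
Qed.

Lemma gL0E : gL0 = evenker.
Proof.
apply/seteqP; split; last first.
  exact: sub_complete_span evenker_saturated shiftsX_ker shiftsX_gen.
apply: evenker_complete; apply: ghspan_closed evenker_saturated shiftsX_ker.
Qed.

Lemma gBtilde_lim_shifts : gBtildeL1_lim = [set ewF lambda1 v | v in shifts].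
Proof.
apply/seteqP; split=> [_ [m _ [b Bb <-]]|_ [_ [m [b [Bb ->]]] <-]].
  exists (ewF (m * alpha) b); first by exists m, b.
  by apply/funext => n; rewrite /ewF ewD addrC.
exists m => //; exists b => //; apply/funext => n; by rewrite /ewF ewD addrC.
Qed.

Lemma ewF_vec la : ewF alpha (vec W la) = vec W (rcons la 0).
Proof.
rewrite /vec modes_of_rcons foldr_rcons gmodeop_vac.
apply: (@foldr_shift _ (fun v => exists w, neutral w v)).
- by exists 0; apply: neutral_vac.
- by move=> r v [w nv]; exists (w + alpha); apply: neutral_xt.
- by move=> r v [w [vw _]]; apply: gmodeop_shift vw.
Qed.

Lemma ewF_vec_nseq la k (m : int) :
  ewF (2 * m) (vec W la) = ewF (2 * (m - k%:Z)) (vec W (iter k (rcons^~ 0) la)).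
Proof.
elim: k => [|k ->] /=; first by rewrite subr0.
rewrite -ewF_vec; apply/funext => n; rewrite /ewF ewD; congr (ew W _ _).
rewrite /alpha; lia.
Qed.

Lemma part_iter la k : part la -> part (iter k (rcons^~ 0) la).
Proof. by move=> pla; elim: k => //= k; apply: part_rcons. Qed.

(** Written with a common shift, finitely many vectors are indexed by distinct
    sequences; their reductions modulo h are independent, and the coefficients vanish
    one order in h after the other. *)
Lemma ghfree_lim : ghfree gBtildeL1_lim.
Proof.
move=> n c b b_inj; rewrite gBtilde_lim_shifts => Bb sum0.
have /choice[x xP] : forall i, exists x : seq int * int,
    part x.1 /\ b i = ewF lambda1 (ewF (2 * x.2) (vec W x.1)).
  move=> i; have [_ [k [_ [[rs /modes_of_adm[la pla ->] <-] ->]]] <-] := Bb i.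
  by exists (la, k); split=> //=; rewrite gmonomE mulrC.
(* Large enough that every shift can be lowered to - M. *)
pose M := \sum_i `|(x i).2|%N.
have le_M i : - M%:Z <= (x i).2.
  suff : (`|(x i).2| <= M)%N by lia.
  by rewrite /M (bigD1 i) //= leq_addr.
pose nu i := iter `|(x i).2 + M%:Z| (rcons^~ 0) (x i).1.
have p_nu i : part (nu i) by apply/part_iter; case: (xP i).
have bE i : b i = ewF lambda1 (ewF (2 * - M%:Z) (vec W (nu i))).
  have [_ ->] := xP i; rewrite (ewF_vec_nseq _ `|(x i).2 + M%:Z|); congr (ewF _ (ewF _ _)).
  by have := le_M i; lia.
have nu_inj : injective nu by move=> i j eq_nu; apply: b_inj; rewrite !bE eq_nu.
suff c0 N i : c i N = 0 by move=> i; apply/funext => N; apply: c0.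
elim/ltn_ind: N i => N IHN i.
have := congr1 (fun v : F => v N) sum0; rewrite fct_sumE.
have -> : \sum_j gscaleh (c j) (b j) N =
    ew W lambda1 (ew W (2 * - M%:Z) (\sum_j c j N *: vec W (nu j) 0%N)).
  rewrite !endo_sumv; apply: eq_bigr => j _; rewrite /gscaleh.
  rewrite (@big_ord_last _ N (fun k => c j k *: b j (N - k)%N)) => [|k lt_kN].
    by rewrite subnn bE !endoZv.
  by rewrite IHN // scale0r.
rewrite ewD => /(congr1 (ew W (- (2 * - M%:Z + lambda1)))).
rewrite ewD subrr ew0 endo1E endo0v => {}sum0.
pose d la := if [pick j | nu j == la] is Some j then c j N else 0.
have dE j : d (nu j) = c j N.
  rewrite /d; case: pickP => [j' /eqP/nu_inj -> //|/(_ j)].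
  by rewrite eqxx.
rewrite -dE; apply: (@vec_free K W [seq nu j | j <- enum 'I_n]).
- by rewrite map_inj_uniq // enum_uniq.
- by move=> la /mapP[j _ ->].
- by rewrite big_map big_enum /= -[RHS]sum0; apply: eq_bigr => j _; rewrite dE.
- by apply: map_f; rewrite mem_enum.
Qed.

Theorem topological_basis_fock : gtopological_basis gBtildeL1_lim gL1.
Proof.
split; last 2 first.
- exact: ghfree_lim.
- move=> v L1v N; have [u] := L1v; rewrite gL0E => Lu <-.
  have [s [l [Ss Ll ->]]] := dense_span evenker_saturated shifts_ker shifts_gen Lu N.
  exists (ewF lambda1 s), (ewF lambda1 l); split.
  + rewrite gBtilde_lim_shifts; apply: ghspan_endo Ss => b Sb; by exists b.
  + by exists l; rewrite ?gL0E.
  + apply/funext => n; rewrite /ewF !addrfctE endoDv /ghshift; congr (_ + _).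
    by case: ifP => // _; apply: endo0v.
- rewrite gBtilde_lim_shifts => _ [v Sv <-]; exists v => //; rewrite gL0E.
  exact: shifts_ker.
Qed.

End Basis.

(** * The Fock space of the theorem *)

Lemma malgZU (R : ringType) (I : choiceType) (c : R) (k : I) :
  << c *g k >> = c *: << k >> :> {malg R[I]}.
Proof. by apply/malgP => x; rewrite mcoeffZ !mcoeffU mulr_natr. Qed.

Section Concrete.
Variable K : numFieldType.
Local Notation mon := {cmonom mode}.
Local Notation VK := {malg K[fkey]}.

Lemma linextEw (f : fkey -> V K) (v : V K) (d : {fset fkey}) : (msupp v `<=` d)%fset ->
  linext f v = \sum_(k <- d) v@_k *: f k.
Proof.
move=> sub_d; apply: big_fset_incl => // k _ /mcoeff_outdom ->.
exact: scale0r.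
Qed.

Lemma linext_linear (f : fkey -> V K) : linear (linext f).
Proof.
move=> c u v; pose d := (msupp u `|` msupp v)%fset.
have sub_d : (msupp (c *: u + v) `<=` d)%fset.
  apply: fsubset_trans (msuppD_le _ _) _; apply: fsetSU; exact: msuppZ_le.
rewrite (linextEw _ sub_d) (linextEw _ (fsubsetUl (msupp u) (msupp v))).
rewrite (linextEw _ (fsubsetUr (msupp u) (msupp v))) scaler_sumr -big_split /=.
apply: eq_bigr => k _; rewrite mcoeffD mcoeffZ scalerDl scalerA.
by [].
Qed.

Lemma linextU (f : fkey -> V K) k : linext f << k >> = f k.
Proof.
have sub_k : (msupp (<< k >> : V K) `<=` [fset k])%fset by apply: msuppU_le.
by rewrite (linextEw _ sub_k) big_seq_fset1 mcoeffU eqxx scale1r.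
Qed.

Lemma mcoeff_scalar (k : fkey) : scalar (fun v : V K => v@_k).
Proof. by move=> c u v; rewrite mcoeffD mcoeffZ. Qed.

Lemma malg_expand (v : V K) : v = \sum_(x <- msupp v) v@_x *: << (x.1, x.2) >>.
Proof.
rewrite {1}(monalgE v); apply: eq_bigr => x _; rewrite malgZU.
by case: x.
Qed.

Definition Fock0 : fock K.
Proof.
refine (@Fock K VK (fun k w => << (k, w) >>) (fun k w v => v@_(k, w))
  (fun f => linext (fun x => f x.1 x.2)) _ _ _ _ _ _).
- by move=> k w; apply: mcoeff_scalar.
- by move=> f; apply: linext_linear.
- by move=> u v eq_uv; apply/malgP => -[k w]; apply: eq_uv.
- by move=> k w k' w'; rewrite mcoeffU xpair_eqE.
- by move=> v; exists (msupp v), (fun x => v@_x); apply: malg_expand.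
- by move=> f k w; apply: linextU.
Defined.

Lemma kdiv_fun j n : (fun k : fkey => (n.+1 * k.1 (j, n))%:R *: << (kdiv k.1 (j, n), k.2) >> : V K) =
  (fun k => (n.+1 * k.1 (j, n))%:R *: << (divcm k.1 (ucm (j, n)), k.2) >>).
Proof. by apply/funext => k; rewrite kdiv_def. Qed.
Lemma kmul_fun x : (fun k : fkey => << (kmul k.1 x, k.2) >> : V K) =
  (fun k => << (mmul k.1 (ucm x), k.2) >>).
Proof. by apply/funext => k; rewrite kmul_def. Qed.
Lemma key_fun (f : weight -> K) : (fun k : fkey => f k.2 *: << (k.1, k.2) >> : V K) =
  (fun k => f k.2 *: << k >>).
Proof. by apply/funext => -[k w]. Qed.

Lemma an_E j n : efun (an Fock0 (j, n)) = @a K j n.+1 :> (V K -> V K).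
Proof. rewrite /an -lock; exact: (congr1 (@linext K) (kdiv_fun j n)). Qed.
Lemma cr_E j n : efun (cr Fock0 (j, n)) = @a K j (Negz n) :> (V K -> V K).
Proof. rewrite /cr -lock; exact: (congr1 (@linext K) (kmul_fun (j, n))). Qed.
Lemma ga_E j r : @ga K Fock0 j r = @a K j r :> (V K -> V K).
Proof. by case: r => [[|n]|n]; [|exact: an_E|exact: cr_E]. Qed.

Lemma ew_E b : efun (ew Fock0 b) = @expw K b :> (V K -> V K).
Proof. by rewrite /ew -lock. Qed.
Lemma dg_E f : efun (dg Fock0 f) = @diagw K f :> (V K -> V K).
Proof. rewrite /dg -lock; exact: (congr1 (@linext K) (key_fun f)). Qed.

Lemma ga_fun : @ga K Fock0 = @a K :> ('I_2 -> int -> V K -> V K).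
Proof. by apply/funext => j; apply/funext => r; apply: ga_E. Qed.
Lemma ew_fun : (fun b => efun (ew Fock0 b)) = @expw K :> (weight -> V K -> V K).
Proof. by apply/funext => b; apply: ew_E. Qed.
Lemma dg_fun : (fun f => efun (dg Fock0 f)) = @diagw K :> ((weight -> K) -> V K -> V K).
Proof. by apply/funext => f; apply: dg_E. Qed.

(** X_alpha as a function of the operators from which it is built: proving equality of
    those operators avoids comparing the series. *)
Definition Xalpha_of (act : 'I_2 -> int -> V K -> V K) (e : weight -> V K -> V K)
    (d : (weight -> K) -> V K -> V K) : series K :=
  let Em : series K := gsexp (fun p q v =>
    \sum_(r \in [set r : nat | (0 < r)%N])
      (- (upow (- (3 / 4)) r%:Z p q / r%:R) *: act ord0 (- r%:Z) v
       + (upow (1 / 4) r%:Z p q / r%:R) *: act ord_max (- r%:Z) v)) in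
  let Ep : series K := gsexp (fun p q v =>
    \sum_(r \in [set r : nat | (0 < r)%N])
      (upow (1 / 4) (- r%:Z) p q / r%:R) *: (act ord0 r%:Z v - act ord_max r%:Z v)) in
  let u : series K := fun p q =>
    if q == 0%N then d (fun w => (w == p)%:R) else fun=> 0 in
  let oh (e : K) : series K := fun p q =>
    if p == - q%:Z then d (fun w => gbin (e * (w%:~R / 2)) q) else fun=> 0 in
  gsmul (gsinv (gat0 Em)) (gsmul Em (gsmul Ep (gsmul (gsconst (e alpha)) (gsmul u (oh 1))))).

Lemma gX_of : @gX K Fock0 = Xalpha_of (@ga K Fock0) (fun b => efun (ew Fock0 b))
  (fun f => efun (dg Fock0 f)).
Proof. reflexivity. Qed.
Lemma Xalpha_of_E : @Xalpha K = Xalpha_of (@a K) (@expw K) (@diagw K).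
Proof. reflexivity. Qed.
Lemma Xalpha_E : @gX K Fock0 = @Xalpha K.
Proof. by rewrite gX_of ga_fun ew_fun dg_fun -Xalpha_of_E. Qed.
Lemma Xtilde_E : @gXt K Fock0 = @Xtilde K.
Proof.
apply: (etrans (y := gsmul (@Xalpha K) (@goh K Fock0 (-1)))).
  exact: (congr1 (fun X => gsmul X (@goh K Fock0 (-1))) Xalpha_E).
exact: (congr1 (fun d : (weight -> K) -> V K -> V K => gsmul (@Xalpha K) (fun p q =>
    if p == - q%:Z then d (fun w => gbin (- 1 * (w%:~R / 2)) q) else fun=> 0)) dg_fun).
Qed.

(** Likewise for the conclusion, as a function of the series and of e^{w alpha/2}. *)
Definition basis_statement (X Xt : series K) (e : weight -> V K -> V K) : Prop :=
  let eF b (v : F K) : F K := fun n => e b (v n) in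
  let B (S : series K) : set (F K) :=
    [set monom (modeop S) rs | rs in [set rs | admissible rs]] in
  topological_basis
    (\bigcup_(m in [set: int]) [set eF (lambda1 + m * alpha) b | b in B Xt])
    [set eF lambda1 v | v in hcomplete (hspan
      [set v | exists (k : int) (b : F K), B X b /\ v = eF (k * alpha) b])].

Lemma basis_Fock0 : basis_statement (@gX K Fock0) (@gXt K Fock0) (fun b => efun (ew Fock0 b)).
Proof. exact: (@topological_basis_fock K Fock0). Qed.

Lemma basisP : topological_basis (@BtildeL1_lim K) (@L1 K).
Proof. by have := basis_Fock0; rewrite Xalpha_E Xtilde_E ew_fun. Qed.
End Concrete.

Theorem theorem3p18 (R : realType) :
  topological_basis (@BtildeL1_lim (complex R)) (@L1 (complex R)).
Proof. exact: basisP. Qed.
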